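(* For every integer $n\ge 1$ let $R=(R(t))_{t\ge 0}$ be the diffusion with $R(0)=0$ satisfying $dR(t)=\sqrt{2}\,dB(t)+b_n(R(t))\,dt$ up to the time $\tau_n=\inf\{t\ge 0: R(t)=\pi\}$. Then, as $n\to\infty$, $$\mathbb{E}[\tau_n]\sim \frac{\ln(n)}{n}.$$
   Context: Here $(B(t))_{t\ge 0}$ is a standard real Brownian motion and $b_n:(0,\pi)\to\mathbb{R}$ is given by $$b_n(r)=2\,\frac{\sin^n(r)}{\int_0^r\sin^n(u)\,du}-n\,\frac{\cos(r)}{\sin(r)},\qquad r\in(0,\pi).$$ As $r\to 0_+$ one has $b_n(r)\sim (n+2)/r$, so $0$ is an entrance boundary: the diffusion $R$ can be started at $0$ and never returns to $0$ at positive times. ($R(t)$ is the radius of a ball $D(t)$ of the sphere $\mathbb{S}^{n+1}$, where $D$ is a ball-valued dual process intertwined with the Brownian motion on $\mathbb{S}^{n+1}$ with generator the Laplacian, and $\tau_n$ is then a strong stationary time for this Brownian motion.) The notation $u_n\sim v_n$ means $u_n/v_n\to 1$ as $n\to\infty$. *)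

(* Defs.v *)
From mathcomp Require Import all_boot all_order all_algebra.
From mathcomp Require Import all_classical all_reals all_analysis.

Set Implicit Arguments.
Unset Strict Implicit.
Unset Printing Implicit Defensive.

Import Order.TTheory GRing.Theory Num.Theory.
Import numFieldNormedType.Exports.

Local Open Scope classical_set_scope.
Local Open Scope ring_scope.

(* Time is indexed by R; only the indices t >= 0 are meaningful. *)
Record filtration (R : realType) d (T : measurableType d)
    (F : R -> set (set T)) : Prop := Filtration {
  filtration_sigma : forall t : R, 0 <= t -> sigma_algebra setT (F t) ;
  filtration_measurable : forall t : R, 0 <= t -> F t `<=` @measurable d T ;
  filtration_homo : forall s t : R, 0 <= s -> s <= t -> F s `<=` F t }.

Definition adapted (R : realType) d (T : measurableType d)
    (F : R -> set (set T)) (X : R -> T -> R) : Prop :=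
  forall t : R, 0 <= t -> forall U : set R, measurable U -> F t (X t @^-1` U).

Definition continuous_path (R : realType) (x : R -> R) : Prop :=
  {within `[0, +oo[, continuous x}.

(* Standard real Brownian motion relative to the filtration F. The second
   argument of normal_prob is the standard deviation, not the variance. *)
Record brownian_motion (R : realType) d (T : measurableType d)
    (P : probability T R) (F : R -> set (set T)) (B : R -> T -> R) : Prop :=
  BrownianMotion {
  bm_adapted : adapted F B ;
  bm_start : {ae P, forall w, B 0 w = 0} ;
  bm_continuous : {ae P, forall w, continuous_path (B ^~ w)} ;
  bm_indep : forall s t : R, 0 <= s -> s < t ->
    forall (A : set T) (U : set R), F s A -> measurable U ->
    P (A `&` [set w | U (B t w - B s w)%R]) =
    (P A * P [set w | U (B t w - B s w)%R])%E ;
  bm_gauss : forall s t : R, 0 <= s -> s < t ->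
    forall U : set R, measurable U ->
    P [set w | U (B t w - B s w)%R] = normal_prob 0 (Num.sqrt (t - s)) U }.

(* Only meaningful on `]0, pi[; elsewhere the value is junk. *)
Definition drift (R : realType) (n : nat) (r : R) : R :=
  2 * (sin r ^+ n / (\int[lebesgue_measure]_(u in `[0, r]) (sin u ^+ n)))
  - n%:R * (cos r / sin r).

(* Equal to +oo when the path never reaches a at a nonnegative time. *)
Definition hitting_time (R : realType) (T : Type) (X : R -> T -> R) (a : R)
    (w : T) : \bar R :=
  ereal_inf [set t%:E | t in [set t : R | 0 <= t /\ X t w = a]].

(* Weak solution, started at the entrance boundary 0, of
   dX = sqrt 2 dB + drift n (X) dt up to the hitting time of pi. As the noise is
   additive, the stochastic integral of sqrt 2 is sqrt 2 * B t and the equation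
   is pathwise. The state space before the hitting time is `]0, pi[, where the
   drift is defined, apart from the starting point. *)
Record radius_diffusion (R : realType) (n : nat) d (T : measurableType d)
    (P : probability T R) (F : R -> set (set T)) (B X : R -> T -> R) : Prop :=
  RadiusDiffusion {
  rd_filtration : filtration F ;
  rd_brownian : brownian_motion P F B ;
  rd_adapted : adapted F X ;
  rd_continuous : {ae P, forall w, continuous_path (X ^~ w)} ;
  rd_start : {ae P, forall w, X 0 w = 0} ;
  rd_range : {ae P, forall w, forall t : R, 0 < t ->
    (t%:E < hitting_time X pi w)%E -> 0 < X t w < pi} ;
  rd_equation : {ae P, forall w, forall t : R, 0 <= t ->
    (t%:E < hitting_time X pi w)%E ->
    lebesgue_measure.-integrable `[0, t] (fun s => (drift n (X s w))%:E) /\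
    X t w = Num.sqrt 2 * B t w
            + \int[lebesgue_measure]_(s in `[0, t]) drift n (X s w)} }.

(* Main.v *)
(* The generator L f = f'' + b_n f' of the diffusion admits almost solutions of
   L f = 1. Put c = cos r and k = m^2 / n. With a fixed large m, the function
   - arcsinh (c / sqrt k) / n increases by about ln n / n from 0 to pi. Since
   b_n sin r behaves like n |c| when |c| is large compared with n^(-1/2) and is of order
   sqrt n when |c| is at most of that order, adding - D c / (n sqrt (c^2 + k))
   with D = -1, resp. D large, and a small multiple of sin (r / 4), which gives
   the derivatives at 0 and pi the required sign, yields L f <= 1 + o(1), resp.
   L f >= 1 - o(1).

   Ito's formula is replaced by a discretised Dynkin inequality. On a grid of
   mesh h, the path is followed as long as it stays below pi and both X and B
   oscillate by at most rho on every step. Freezing f at the previous grid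
   point, the Gaussian increment of sqrt 2 B contributes h f'' and the drift
   contributes at least h (lam - f''), when L f >= lam. Summation gives
   lam E[tau] <= f pi - f 0 if lam > 0 and, applied to - f, the reverse
   inequality. *)

Require Import Defs.
From HB Require Import structures.
From mathcomp Require Import all_boot all_order all_algebra.
From mathcomp Require Import all_classical all_reals all_analysis.
From mathcomp Require Import measurable_realfun ring lra.

Set Implicit Arguments.
Unset Strict Implicit.
Unset Printing Implicit Defensive.

Import Order.TTheory GRing.Theory Num.Theory.
Import numFieldNormedType.Exports.

Local Open Scope classical_set_scope.
Local Open Scope ring_scope.

(** Heuristic for the rate: away from the equator cos r = 0 the drift is about n |cos r| / sin r, so
    the noiseless radius needs the time (1/n) * int sin r / |cos r| dr, cut off where |cos r| has
    order n^(-1/2). Each hemisphere costs ln n / (2n); the crossing, of width n^(-1/2) at speed sqrt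
    n, costs only O(1/n). The parameter m is fixed in terms of the tolerance before n grows.

    Two obstacles shape the stochastic part. The drift blows up at both ends, hence already at the
    starting point, so it cannot be frozen over a time step. Instead the whole noise increment of
    the step is applied first, and the drift is then followed along the true path, where the mean
    value theorem is enough. Moreover the hitting time may fail to be measurable, so it is compared
    path by path with a measurable discrete lifetime. The test functions are bounded and smooth on
    the whole line because a Gaussian increment can leave [0, pi]. *)

Section derivative_rules.
Context {R : realType}.
Implicit Types (f g : R -> R) (x : R).

Lemma is_derive1_cst (k x : R) : is_derive x 1 (fun _ : R => k) 0.
Proof. exact: is_derive_cst. Qed.

Lemma is_derive1D f g x df dg : is_derive x 1 f df -> is_derive x 1 g dg ->
  is_derive x 1 (fun y => f y + g y) (df + dg).
Proof. exact: is_deriveD. Qed.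

Lemma is_derive1N f x df : is_derive x 1 f df ->
  is_derive x 1 (fun y => - f y) (- df).
Proof. exact: is_deriveN. Qed.

Lemma is_derive1B f g x df dg : is_derive x 1 f df -> is_derive x 1 g dg ->
  is_derive x 1 (fun y => f y - g y) (df - dg).
Proof. exact: is_deriveB. Qed.

Lemma is_derive1M f g x df dg : is_derive x 1 f df -> is_derive x 1 g dg ->
  is_derive x 1 (fun y => f y * g y) (f x * dg + g x * df).
Proof. exact: is_deriveM. Qed.

Lemma is_derive1Ml f x df (k : R) : is_derive x 1 f df ->
  is_derive x 1 (fun y => k * f y) (k * df).
Proof. exact: is_deriveZ. Qed.

Lemma is_derive1X f x df (m : nat) : is_derive x 1 f df ->
  is_derive x 1 (fun y => f y ^+ m) (m%:R * f x ^+ m.-1 * df).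
Proof. by move=> fd; have := is_deriveX m fd; rewrite exprfctE. Qed.

Lemma is_derive1V f x df : f x != 0 -> is_derive x 1 f df ->
  is_derive x 1 (fun y => (f y)^-1) (- (f x) ^- 2 * df).
Proof. exact: is_deriveV. Qed.

Lemma is_derive1_continuous f x df : is_derive x 1 f df -> {for x, continuous f}.
Proof. by case=> + _; move/derivable1_diffP/differentiable_continuous. Qed.

Lemma within_continuousB (A : set R) f g : {within A, continuous f} ->
  {within A, continuous g} -> {within A, continuous (fun x => f x - g x)}.
Proof. by move=> cf cg x; apply: (@continuousB _ _ (subspace A) f g x); [exact: cf|exact: cg]. Qed.

Lemma within_continuousD (A : set R) f g : {within A, continuous f} ->
  {within A, continuous g} -> {within A, continuous (fun x => f x + g x)}.
Proof. by move=> cf cg x; apply: (@continuousD _ _ (subspace A) f g x); [exact: cf|exact: cg]. Qed.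

Lemma within_continuousM (A : set R) f g : {within A, continuous f} ->
  {within A, continuous g} -> {within A, continuous (fun x => f x * g x)}.
Proof. by move=> cf cg x; apply: (@continuousM _ (subspace A) f g x); [exact: cf|exact: cg]. Qed.

Lemma within_continuous_cst (A : set R) (k : R) :
  {within A, continuous (fun _ : R => k)}.
Proof. by apply: continuous_subspaceT => x; exact: cvg_cst. Qed.

Lemma ge0_derive_le f df (a b : R) : a <= b ->
  (forall x, a < x < b -> is_derive x 1 f (df x)) ->
  (forall x, a < x < b -> 0 <= df x) ->
  {within `[a, b], continuous f} -> f a <= f b.
Proof.
move=> ab fd df0 cf; rewrite -subr_ge0.
pose g x := if a < x < b then df x else 0.
have fg x : x \in `]a, b[%R -> is_derive x 1 f (g x).
  by rewrite in_itv/= /g => xab; rewrite xab; exact: fd.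
have [x _ ->] := MVT_segment ab fg cf; rewrite mulr_ge0 ?subr_ge0// /g.
by case: ifPn => // ?; exact: df0.
Qed.

End derivative_rules.

(** * The drift *)

Section sine_integral.
Context {R : realType}.
Variable n : nat.

Definition sinI (r : R) : R := \int[lebesgue_measure]_(u in `[0, r]) (sin u ^+ n).

Lemma continuous_sinX : continuous (fun u : R => sin u ^+ n).
Proof.
move=> x; apply: (@continuous_comp _ _ _ sin (fun y => y ^+ n)).
  exact: continuous_sin.
exact: exprn_continuous.
Qed.

Lemma integrable_sinX (a b : R) :
  lebesgue_measure.-integrable `[a, b] (EFin \o (fun u : R => sin u ^+ n)).
Proof.
apply: continuous_compact_integrable; first exact: segment_compact.
by apply: continuous_subspaceT; exact: continuous_sinX.
Qed.

Lemma sinI0 : sinI 0 = 0.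
Proof. by rewrite /sinI set_itv1 Rintegral_set1. Qed.

Lemma is_derive_sinI (x : R) : 0 < x -> is_derive x 1 sinI (sin x ^+ n).
Proof.
move=> x0.
have [||d e] := @continuous_FTC1_closed R (fun u => sin u ^+ n) 0 x (x + 1) _ _ x0 (@continuous_sinX x).
- by rewrite ltrDl.
- exact: integrable_sinX.
by apply: DeriveDef; [exact: d | rewrite -derive1E e].
Qed.

Lemma continuous_sinI (b : R) : 0 <= b -> {within `[0, b], continuous sinI}.
Proof.
move=> b0; apply: (@parameterized_integral_continuous R 0 b (fun u => sin u ^+ n)) => //.
exact: integrable_sinX.
Qed.

End sine_integral.

Section sine_integral_bounds.
Context {R : realType}.
Variable n : nat.
Local Notation sinI := (@sinI R n).

Lemma continuous_sinI_sub (a b : R) : 0 <= a -> a <= b ->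
  {within `[a, b], continuous sinI}.
Proof.
move=> a0 ab; apply: (continuous_subspaceW _ (continuous_sinI (le_trans a0 ab))).
by apply: subset_itvr; rewrite bnd_simp.
Qed.

Lemma sinI_le (a b : R) : 0 <= a -> a <= b -> b <= pi -> sinI a <= sinI b.
Proof.
move=> a0 ab bpi; apply: (@ge0_derive_le R sinI (fun x => sin x ^+ n)) => //.
- by move=> x /andP[ax _]; apply: is_derive_sinI; exact: le_lt_trans ax.
- move=> x /andP[ax xb]; rewrite exprn_ge0// sin_ge0_pi//.
  by rewrite (ltW (le_lt_trans a0 ax)) (le_trans (ltW xb)).
- exact: continuous_sinI_sub.
Qed.

Lemma sinI_lipschitz (a b : R) : 0 <= a -> a <= b -> b <= pi ->
  sinI b - sinI a <= b - a.
Proof.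
move=> a0 ab bpi; suff : a - sinI a <= b - sinI b by lra.
apply: (@ge0_derive_le R (fun x => x - sinI x) (fun x => 1 - sin x ^+ n)) => //.
- move=> x /andP[ax _]; apply: is_derive1B.
  by apply: is_derive_sinI; exact: le_lt_trans ax.
- apply: within_continuousB; last exact: continuous_sinI_sub.
  by apply: continuous_subspaceT => y; exact: cvg_id.
Qed.

Lemma sinI_ge0 (r : R) : 0 <= r <= pi -> 0 <= sinI r.
Proof. by move=> /andP[r0 rp]; rewrite -(sinI0 n) sinI_le. Qed.

Lemma sinI_gt0 (r : R) : 0 < r <= pi -> 0 < sinI r.
Proof.
move=> /andP[r0 rp].
have [|c cr] := @MVT R sinI (fun x => sin x ^+ n) 0 r r0 _ (continuous_sinI (ltW r0)).
  by move=> x; rewrite in_itv/= => /andP[x0 _]; exact: is_derive_sinI.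
rewrite sinI0 !subr0 => ->; rewrite mulr_gt0// exprn_gt0// sin_gt0_pi//.
by move: cr; rewrite in_itv/= => /andP[-> cr]; rewrite (lt_le_trans cr).
Qed.

(** The difference of the two sides vanishes at 0 and has derivative (n+1) sin r * [sinI r], which
    is nonnegative. *)
Lemma cos_sinI_le (r : R) : 0 <= r <= pi ->
  n.+1%:R * cos r * sinI r <= sin r ^+ n.+1.
Proof.
move=> /andP[r0 rp]; rewrite -subr_ge0.
pose f (x : R) := sin x ^+ n.+1 - n.+1%:R * (cos x * sinI x).
have -> : 0 = f 0 by rewrite /f sinI0 sin0 expr0n/= !mulr0 subr0.
rewrite -mulrA -/(f r).
apply: (@ge0_derive_le R f (fun x => n.+1%:R * (sin x * sinI x))) => //.
- move=> x /andP[x0 _].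
  apply: (is_derive_eq (is_derive1B (is_derive1X n.+1 (is_derive_sin x))
    (is_derive1Ml n.+1%:R
      (is_derive1M (is_derive_cos x) (is_derive_sinI n x0))))).
  by rewrite /=; ring.
- move=> x /andP[x0 xr]; rewrite !mulr_ge0//.
    by rewrite sin_ge0_pi// ltW//= (le_trans (ltW xr)).
  by rewrite sinI_ge0// ltW//= (le_trans (ltW xr)).
- apply: within_continuousB.
    by apply: continuous_subspaceT => y; exact: continuous_sinX.
  apply: within_continuousM.
    by apply: continuous_subspaceT => y; exact: cvg_cst.
  apply: within_continuousM; last exact: continuous_sinI_sub.
  by apply: continuous_subspaceT => y; exact: continuous_cos.
Qed.

(** Companion of [cos_sinI_le] in the other direction. The difference vanishes at 0 and its
    derivative is 2 sin r (sin^(n+1) r - n cos r [sinI r]), nonnegative by that lemma where cos r >=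
    0 and trivially elsewhere. *)
Lemma sinI_cos_ge (r : R) : 0 <= r <= pi ->
  sin r ^+ n.+1 * cos r <= sinI r * (n%:R * cos r ^+ 2 + 1).
Proof.
move=> /andP[r0 rp]; rewrite -subr_ge0.
pose f (x : R) := sinI x * (n%:R * cos x ^+ 2 + 1) - sin x ^+ n.+1 * cos x.
have -> : 0 = f 0 by rewrite /f sinI0 sin0 expr0n/= !mul0r subr0.
rewrite -/(f r).
apply: (@ge0_derive_le R f
  (fun x => 2 * sin x * (sin x ^+ n.+1 - n%:R * cos x * sinI x))) => //.
- move=> x /andP[x0 _].
  apply: (is_derive_eq (is_derive1B
    (is_derive1M (is_derive_sinI n x0)
      (is_derive1D (is_derive1Ml n%:R (is_derive1X 2 (is_derive_cos x)))
        (is_derive1_cst 1 x)))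
    (is_derive1M (is_derive1X n.+1 (is_derive_sin x)) (is_derive_cos x)))).
  apply/eqP; rewrite -subr_eq0; apply/eqP => /=.
  transitivity (sin x ^+ n * (1 - (cos x ^+ 2 + sin x ^+ 2))).
    by rewrite !(exprS (sin x) n) -(natr1 n); ring.
  by rewrite cos2Dsin2 subrr mulr0.
- move=> x /andP[x0 xr].
  have x0p : 0 <= x <= pi by rewrite ltW//= (le_trans (ltW xr)).
  rewrite !mulr_ge0// ?sin_ge0_pi// subr_ge0.
  have [c0|c0] := leP 0 (cos x).
    apply: le_trans (cos_sinI_le x0p); rewrite -!mulrA ler_wpM2r//.
      by rewrite mulr_ge0// sinI_ge0.
    by rewrite ler_nat.
  apply: (@le_trans _ _ 0); last by rewrite exprn_ge0// sin_ge0_pi.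
  by rewrite -mulrA mulr_ge0_le0// mulr_le0_ge0 ?sinI_ge0// ltW.
- apply: within_continuousB.
    apply: within_continuousM; first exact: continuous_sinI_sub.
    apply: continuous_subspaceT => y.
    apply: cvgD; last exact: cvg_cst.
    apply: cvgM; first exact: cvg_cst.
    by apply: (@continuous_comp _ _ _ cos (fun y => y ^+ 2)); [exact: continuous_cos|exact: exprn_continuous].
  apply: within_continuousM; apply: continuous_subspaceT => y.
    exact: continuous_sinX.
  exact: continuous_cos.
Qed.

End sine_integral_bounds.

Lemma bernoulli_ge {R : realFieldType} (y : R) (m : nat) : 0 <= y <= 1 ->
  1 - m%:R * y <= (1 - y) ^+ m.
Proof.
move=> /andP[y0 y1]; elim: m => [|m ih]; first by rewrite expr0 mul0r subr0.
have m0 : 0 <= m%:R :> R by [].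
rewrite exprS -natr1; have : 0 <= (1 - y) ^+ m by rewrite exprn_ge0// subr_ge0.
by move: ih; set z := (1 - y) ^+ m; nra.
Qed.

(** The logarithmic derivative of [sinI]. The drift is twice this ratio minus n cot r, so bounds on
    the drift reduce to bounds on it. *)
Definition sin_ratio {R : realType} n (r : R) : R := sin r ^+ n / sinI n r.

Section drift_bounds.
Context {R : realType}.
Variable n : nat.
Hypothesis n0 : (0 < n)%N.
Local Notation b := (@drift R n).
Local Notation q := (sin_ratio n).

Lemma drift_sin (r : R) : 0 < r < pi ->
  b r * sin r = 2 * (q r * sin r) - n%:R * cos r.
Proof.
move=> rpi; rewrite /drift mulrBl; congr (_ - _).
  by rewrite -mulrA.
by rewrite -mulrA divfK// gt_eqF// sin_gt0_pi.
Qed.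

Lemma sin_pow_ratio_gt0 (r : R) : 0 < r < pi -> 0 < q r.
Proof.
move=> /andP[r0 rp]; rewrite divr_gt0//.
  by rewrite exprn_gt0// sin_gt0_pi// r0.
by rewrite sinI_gt0// r0 ltW.
Qed.

Lemma sin_pow_ratio_ge (r : R) : 0 < r < pi -> n.+1%:R * cos r <= q r * sin r.
Proof.
move=> /andP[r0 rp].
rewrite /sin_ratio mulrAC -exprSr ler_pdivlMr ?cos_sinI_le ?(ltW r0) ?(ltW rp)//.
by rewrite sinI_gt0// r0 ltW.
Qed.

Lemma sin_pow_ratio_le (r : R) : 0 < r < pi ->
  q r * sin r * cos r <= n%:R * cos r ^+ 2 + 1.
Proof.
move=> /andP[r0 rp].
have -> : q r * sin r * cos r = sin r ^+ n.+1 * cos r / sinI n r.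
  by rewrite /sin_ratio exprSr; ring.
rewrite ler_pdivrMr; first by rewrite [leRHS]mulrC sinI_cos_ge// (ltW r0) ltW.
by rewrite sinI_gt0// r0 ltW.
Qed.

(** One of the two copies of [q r * sin r] in [drift_sin] absorbs n cos r, by [sin_pow_ratio_ge]. *)
Lemma drift_sin_ge_ratio (r : R) : 0 < r < pi -> q r * sin r <= b r * sin r.
Proof.
move=> rpi; rewrite drift_sin//.
have := sin_pow_ratio_ge rpi; have := sin_pow_ratio_gt0 rpi.
have s0 := sin_gt0_pi rpi.
set Q := q r => Q0; rewrite -natr1 => h.
have n1 : 0 < n%:R :> R by rewrite ltr0n.
have := mulr_gt0 Q0 s0; have [c0|c0] := leP 0 (cos r); first by nra.
by nra.
Qed.

Lemma drift_sin_ge (r : R) : 0 < r < pi -> n%:R * `|cos r| <= b r * sin r.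
Proof.
move=> rpi; rewrite drift_sin//.
have := sin_pow_ratio_ge rpi; have := sin_pow_ratio_gt0 rpi.
have s0 := sin_gt0_pi rpi.
set Q := q r => Q0; rewrite -natr1 => h.
have n1 : 0 < n%:R :> R by rewrite ltr0n.
have := mulr_gt0 Q0 s0; have [c0|c0] := leP 0 (cos r).
  by rewrite ger0_norm//; nra.
by rewrite ltr0_norm//; nra.
Qed.

Lemma drift_ge0 (r : R) : 0 < r < pi -> 0 <= b r.
Proof.
move=> rpi; rewrite -(pmulr_lge0 _ (sin_gt0_pi rpi)).
by rewrite (le_trans _ (drift_sin_ge rpi))// mulr_ge0.
Qed.

Lemma drift_sin_le_cos_gt0 (r : R) : 0 < r < pi -> 0 < cos r ->
  b r * sin r * cos r <= n%:R * cos r ^+ 2 + 2.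
Proof.
move=> rpi c0; rewrite drift_sin//.
by have := sin_pow_ratio_le rpi; set Q := q r; nra.
Qed.

(** By monotonicity it suffices to bound [sinI] at the point just before pi / 2 whose cosine is c =
    1 / (2 sqrt n). There n c^2 = 1/4, so [sinI_cos_ge] reads c sin^(n+1) <= (5/4) [sinI], and
    Bernoulli's inequality keeps sin^(n+1) above 1/2. *)
Lemma sinI_ge_half (r : R) : pi / 2 <= r <= pi ->
  (6 * Num.sqrt n%:R)^-1 <= sinI n r.
Proof.
move=> /andP[r2 rpi].
have n1 : 1 <= n%:R :> R by rewrite ler1n.
pose c : R := (2 * Num.sqrt n%:R)^-1.
have sn0 : 0 < Num.sqrt n%:R :> R by rewrite sqrtr_gt0; lra.
have c0 : 0 < c by rewrite invr_gt0; lra.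
have nc : n%:R * c ^+ 2 = 4^-1.
  rewrite /c exprVn exprMn sqr_sqrtr; last lra.
  by rewrite invfM mulrCA mulfV ?mulr1; [congr (_^-1); ring|lra].
have c2 : c ^+ 2 <= 4^-1.
  by rewrite -nc ler_peMl// sqr_ge0.
have c1 : c <= 1 by move: c2; rewrite expr2; nra.
have c01 : -1 <= c <= 1 by rewrite c1 andbT; lra.
have a0 : 0 <= acos c by exact: acos_ge0.
have acr : acos c <= r.
  apply: le_trans r2; rewrite leNgt; apply/negP => h.
  have : cos (acos c) < cos (pi / 2).
    by rewrite ltr_cos// in_itv/= ?a0 ?acos_lepi//; have := pi_gt0 R; lra.
  by rewrite acosK// cos_pihalf; lra.
apply: le_trans (sinI_le n a0 acr rpi).
have := @sinI_cos_ge R n (acos c); rewrite acosK// nc a0 acos_lepi// => /(_ isT).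
set s := sin (acos c) => h.
have s1 : s <= 1 by exact: sin_le1.
have s0 : 0 <= s by rewrite sin_ge0_pi// a0 acos_lepi.
have s2 : s ^+ 2 = 1 - c ^+ 2 by rewrite /s sin2cos2 acosK.
have sn : 2^-1 <= s ^+ n.+1.
  have : 2^-1 <= (s ^+ 2) ^+ n.+1.
    rewrite s2; apply: le_trans (bernoulli_ge _ _); last first.
      by rewrite sqr_ge0/=; lra.
    by rewrite -(natr1 n) mulrDl nc mul1r; move: c2; set C := c ^+ 2; lra.
  rewrite -exprM mulnC exprM expr2.
  have : s ^+ n.+1 <= 1 by rewrite exprn_ile1.
  have : 0 <= s ^+ n.+1 by rewrite exprn_ge0.
  by nra.
have -> : (6 * Num.sqrt n%:R)^-1 = 3^-1 * c.
  by rewrite /c -invfM; congr (_^-1); ring.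
by nra.
Qed.

Lemma cos_le0_ge_pihalf (r : R) : 0 <= r <= pi -> cos r <= 0 -> pi / 2 <= r.
Proof.
move=> /andP[r0 rp]; apply: contra_leP => r2; rewrite -cos_pihalf.
by rewrite ltr_cos ?in_itv/= ?r0//; have := pi_gt0 R; lra.
Qed.

Lemma sin_ratio_le_sqrt (r : R) : 0 < r < pi -> cos r <= 0 ->
  q r <= 6 * Num.sqrt n%:R.
Proof.
move=> /andP[r0 rp] c0.
have r2 : pi / 2 <= r by apply: cos_le0_ge_pihalf => //; rewrite !ltW.
have sn0 : 0 < Num.sqrt n%:R :> R by rewrite sqrtr_gt0 ltr0n.
have I0 : 0 < sinI n r by rewrite sinI_gt0// r0 ltW.
have := @sinI_ge_half r; rewrite r2 ltW// => /(_ isT) h.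
apply: (@le_trans _ _ (sinI n r)^-1).
  rewrite /sin_ratio ler_piMl ?invr_ge0 ?(ltW I0)//.
by rewrite -[leRHS]invrK lef_pV2// posrE invr_gt0; lra.
Qed.

Lemma drift_sin_le_cos_le0 (r : R) : 0 < r < pi -> cos r <= 0 ->
  b r * sin r <= n%:R * `|cos r| + 12 * Num.sqrt n%:R.
Proof.
move=> rpi c0; rewrite drift_sin// ler0_norm//.
have := sin_ratio_le_sqrt rpi c0; have := sin_pow_ratio_gt0 rpi.
have := sin_gt0_pi rpi; have := sin_le1 r.
by set s := sin r; set Q := q r; set S := Num.sqrt _; nra.
Qed.

(** In the equatorial window |cos| <= c with c = sqrt (x / n), sin^(n+1) is at least exp (-4x),
    while [sinI] is at most 5c: it is at most c at the entrance [s0] of the window, by [cos_sinI_le]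
    and n c^2 = x >= 1, and it then grows by at most r - [s0], the length travelled. *)
Lemma sin_ratio_ge_sqrt (x r : R) : 1 <= x -> 2 * x <= n%:R -> 0 < r < pi ->
  cos r ^+ 2 <= x / n%:R ->
  expR (- 4 * x) / (5 * Num.sqrt x) * Num.sqrt n%:R <= q r * sin r.
Proof.
move=> x1 xn rpi; have /andP[r0 rp] := rpi.
have n1 : 1 <= n%:R :> R by rewrite ler1n.
set y := x / n%:R => cy.
have y0 : 0 < y by rewrite divr_gt0//; lra.
have y2 : y <= 2^-1 by rewrite ler_pdivrMr; lra.
have ny : n%:R * y = x by rewrite mulrC divfK//; lra.
pose c := Num.sqrt y.
have c2 : c ^+ 2 = y by rewrite sqr_sqrtr// ltW.
have c0 : 0 < c by rewrite sqrtr_gt0.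
have c1 : c <= 1 by move: c2; rewrite expr2; nra.
have cr : `|cos r| <= c by rewrite -sqrtr_sqr ler_sqrt// ltW.
have /andP[cr1 cr2] : - c <= cos r <= c by rewrite -ler_norml.
have c11 : -1 <= c <= 1 by lra.
set s0 := acos c.
have s00 : 0 <= s0 by exact: acos_ge0.
have s0pi : s0 <= pi by exact: acos_lepi.
have cs0 : cos s0 = c by exact: acosK.
have s0r : s0 <= r.
  rewrite leNgt; apply/negP => h.
  have : cos s0 < cos r by rewrite ltr_cos ?in_itv/= ?s00 ?s0pi ?(ltW r0) ?(ltW rp).
  by rewrite cs0; lra.
have sge (z : R) : s0 <= z <= r -> 2^-1 <= sin z.
  move=> /andP[sz zr].
  have z0 : 0 <= z <= pi by rewrite (le_trans s00)// (le_trans zr)// ltW.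
  have zc : `|cos z| <= c.
    rewrite ler_norml; apply/andP; split.
      apply: (le_trans cr1); rewrite leNgt; apply/negP.
      by rewrite ltr_cos ?in_itv//=; [rewrite ltNge zr|rewrite !ltW].
    rewrite -cs0 leNgt; apply/negP.
    by rewrite ltr_cos ?in_itv//=; [rewrite ltNge sz|rewrite s00].
  have zy : cos z ^+ 2 <= y.
    by rewrite -c2 -(ger0_norm (sqr_ge0 (cos z))) normrX lerXn2r// nnegrE// ltW.
  have := sin_ge0_pi z0; have := sin2cos2 z; rewrite expr2.
  by move: zy; set S := sin z; set C := cos z ^+ 2; nra.
have Is0 : sinI n s0 <= c.
  have := @cos_sinI_le R n s0; rewrite s00 s0pi cs0 => /(_ isT) h.
  have h1 : sin s0 ^+ n.+1 <= 1 by rewrite exprn_ile1 ?sin_le1// sin_ge0_pi// s00.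
  have : n%:R * c * sinI n s0 <= 1.
    apply: le_trans h1; apply: le_trans h; rewrite ler_wpM2r//.
      by rewrite sinI_ge0// s00.
    by rewrite ler_wpM2r ?ler_nat// ltW.
  have nc1 : 1 <= n%:R * c * c by rewrite -mulrA -expr2 c2 ny.
  move=> h2; rewrite -(@ler_pM2l _ (n%:R * c)) ?(le_trans h2)// mulr_gt0//; lra.
(* The cosine changes by at most 2c in the window, where sin >= 1/2, hence r - [s0] <= 4c. *)
have Ir : sinI n r <= 5 * c.
  have [z zsr crs] : exists2 z, z \in `[s0, r] & cos r - cos s0 = - sin z * (r - s0).
    apply: MVT_segment => //; apply: continuous_subspaceT => z.
    exact: continuous_cos.
  have := @sinI_lipschitz R n s0 r s00 s0r (ltW rp).
  by move: crs; have := sge z zsr; rewrite cs0; set S := sin z; nra.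
have sn : expR (- 4 * x) <= sin r ^+ n.+1.
  have sr1 : 0 <= sin r ^+ n.+1 by rewrite exprn_ge0// ltW// sin_gt0_pi.
  apply: (@le_trans _ _ ((sin r ^+ 2) ^+ n.+1)); last first.
    by rewrite -exprM mulnC exprM expr2 ler_piMl// exprn_ile1// sin_le1.
  apply: (@le_trans _ _ ((1 - y) ^+ n.+1)); last first.
    rewrite lerXn2r ?nnegrE ?sqr_ge0//; first lra.
    by rewrite sin2cos2; lra.
  apply: (@le_trans _ _ (expR (- 2 * y) ^+ n.+1)).
    rewrite -expRM_natl ler_expR -(natr1 n).
    have yx : y <= x by rewrite ler_pdivrMr; nra.
    have -> : (n%:R + 1) * (- 2 * y) = - 2 * (n%:R * y) - 2 * y by ring.
    by rewrite ny; lra.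
  rewrite lerXn2r ?nnegrE ?expR_ge0//; first lra.
  (* For 0 <= y <= 1/2, exp (-2y) <= 1 / (1 + 2y) <= 1 - y. *)
  rewrite mulNr expRN -[leRHS]invrK lef_pV2 ?posrE ?expR_gt0 ?invr_gt0; [|lra..].
  apply: le_trans (expR_ge1Dx _); rewrite -[X in X <= _]mul1r ler_pdivrMr; last lra.
  by nra.
have I0 : 0 < sinI n r by rewrite sinI_gt0// r0 ltW.
have -> : q r * sin r = sin r ^+ n.+1 / sinI n r by rewrite /sin_ratio exprSr; ring.
rewrite ler_pdivlMr//.
have sx0 : 0 < Num.sqrt x by rewrite sqrtr_gt0; lra.
have sn0 : 0 < Num.sqrt n%:R :> R by rewrite sqrtr_gt0; lra.
have cE : c = Num.sqrt x / Num.sqrt n%:R.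
  by rewrite /c /y sqrtrM ?sqrtrV//; lra.
apply: le_trans sn.
apply: (@le_trans _ _ (expR (- 4 * x) / (5 * Num.sqrt x) * Num.sqrt n%:R * (5 * c))).
  by rewrite ler_wpM2l// !mulr_ge0 ?expR_ge0 ?invr_ge0 ?mulr_ge0// ltW.
rewrite cE.
have -> : expR (- 4 * x) / (5 * Num.sqrt x) * Num.sqrt n%:R * (5 * (Num.sqrt x / Num.sqrt n%:R)) = expR (- 4 * x).
  by field; rewrite !gt_eqF.
by [].
Qed.

Lemma continuous_drift (r : R) : 0 < r < pi -> {for r, continuous b}.
Proof.
move=> rpi; have /andP[r0 rp] := rpi.
have cs := @continuous_sin R r; have cc := @continuous_cos R r.
have I0 : sinI n r != 0 by rewrite gt_eqF// sinI_gt0// r0 ltW.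
have s0 : sin r != 0 by rewrite gt_eqF// sin_gt0_pi.
apply: cvgB; apply: cvgM; try exact: cvg_cst; apply: cvgM.
- exact: continuous_sinX.
- by apply: cvgV => //; exact: is_derive1_continuous (is_derive_sinI n r0).
- exact: cc.
- by apply: cvgV.
Qed.

End drift_bounds.

(** * Test functions *)

Section test_function.
Context {R : realType}.
Variables (n : nat) (k D e : R).
Hypotheses (n0 : (0 < n)%N) (k0 : 0 < k).

Definition cosv (r : R) : R := (Num.sqrt (cos r ^+ 2 + k))^-1.
Local Notation v := cosv.

(* As ln (c + sqrt (c^2 + k)) = arcsinh (c / sqrt k) + ln (sqrt k), the function
   of the introduction up to a constant. *)
Definition test (r : R) : R :=
  - (ln (cos r + Num.sqrt (cos r ^+ 2 + k)) + D * (cos r * v r)) / n%:R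
  + e * sin (r / 4).

Definition test' (r : R) : R :=
  sin r * (v r + D * k * v r ^+ 3) / n%:R + e * (cos (r / 4) / 4).

Definition test'' (r : R) : R :=
  (cos r * (v r + D * k * v r ^+ 3)
   + sin r ^+ 2 * cos r * (v r ^+ 3 + 3 * D * k * v r ^+ 5)) / n%:R
  - e * (sin (r / 4) / 16).

Lemma cosv_arg_gt0 (r : R) : 0 < cos r ^+ 2 + k.
Proof. by rewrite ltr_wpDl// sqr_ge0. Qed.

Lemma cosv_gt0 (r : R) : 0 < v r.
Proof. by rewrite invr_gt0 sqrtr_gt0 cosv_arg_gt0. Qed.

Lemma cosv_sqr (r : R) : (cos r ^+ 2 + k) * v r ^+ 2 = 1.
Proof.
by rewrite exprVn sqr_sqrtr ?mulfV ?gt_eqF// ?ltW// cosv_arg_gt0.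
Qed.

Lemma is_derive_cosarg (r : R) :
  is_derive r 1 (fun r => Num.sqrt (cos r ^+ 2 + k)) (- (cos r * sin r * v r)).
Proof.
have h0 := cosv_arg_gt0 r.
have h := is_derive1D (is_derive1X 2 (is_derive_cos r)) (is_derive1_cst k r).
apply: (is_derive_eq (@is_derive1_comp _ Num.sqrt (fun r => cos r ^+ 2 + k) r _ _
  (is_derive1_sqrt h0) h)).
by rewrite /cosv /= expr1 addr0 invfM; field; rewrite gt_eqF// sqrtr_gt0.
Qed.

Lemma is_derive_cosv (r : R) : is_derive r 1 v (cos r * sin r * v r ^+ 3).
Proof.
have h0 := cosv_arg_gt0 r.
have h1 : Num.sqrt (cos r ^+ 2 + k) != 0 by rewrite gt_eqF// sqrtr_gt0.
change (is_derive r 1 (fun r => (Num.sqrt (cos r ^+ 2 + k))^-1) (cos r * sin r * v r ^+ 3)).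
apply: (is_derive_eq (@is_derive1V _ (fun r => Num.sqrt (cos r ^+ 2 + k)) r _ h1 (is_derive_cosarg r))).
by rewrite /cosv; field.
Qed.

Lemma is_derive_sin4 (r : R) :
  is_derive r 1 (fun r : R => sin (r / 4)) (cos (r / 4) / 4).
Proof.
have h : is_derive r 1 (fun x : R => x / 4) (4^-1).
  apply: (is_derive_eq (is_derive1M (is_derive_id r 1) (is_derive1_cst 4^-1 r))).
  by rewrite mulr0 add0r mulr1.
exact: (@is_derive1_comp _ sin (fun x => x / 4)).
Qed.

Lemma is_derive_cos4 (r : R) :
  is_derive r 1 (fun r : R => cos (r / 4)) (- sin (r / 4) / 4).
Proof.
have h : is_derive r 1 (fun x : R => x / 4) (4^-1).
  apply: (is_derive_eq (is_derive1M (is_derive_id r 1) (is_derive1_cst 4^-1 r))).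
  by rewrite mulr0 add0r mulr1.
exact: (@is_derive1_comp _ cos (fun x => x / 4)).
Qed.

Lemma ln_arg_gt0 (r : R) : 0 < cos r + Num.sqrt (cos r ^+ 2 + k).
Proof.
have : `|cos r| < Num.sqrt (cos r ^+ 2 + k).
  by rewrite -sqrtr_sqr ltr_sqrt ?cosv_arg_gt0// ltrDl.
by rewrite ltr_norml; lra.
Qed.

Lemma is_derive_test (r : R) : is_derive r 1 test (test' r).
Proof.
have n1 : n%:R != 0 :> R by rewrite gt_eqF// ltr0n.
have := cosv_sqr r; have := cosv_gt0 r.
have := ln_arg_gt0 r.
set w := Num.sqrt _ => h0 v0 vv.
have vw : v r = w^-1 by [].
have w0 : w != 0 by rewrite -invr_eq0 -vw gt_eqF.
have wE : w ^+ 2 = cos r ^+ 2 + k by rewrite sqr_sqrtr// ltW// cosv_arg_gt0.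
have dw := is_derive1D (is_derive_cos r) (is_derive_cosarg r).
have dl := @is_derive1_comp _ (@ln R) (fun r => cos r + Num.sqrt (cos r ^+ 2 + k)) r _ _
  (is_derive1_ln h0) dw.
have dc := is_derive1M (is_derive_cos r) (is_derive_cosv r).
apply: (is_derive_eq (is_derive1D (is_derive1M (is_derive1N (is_derive1D dl
  (is_derive1Ml D dc))) (is_derive1_cst n%:R^-1 r)) (is_derive1Ml e (is_derive_sin4 r)))).
rewrite /test' /=; congr (_ + _); rewrite mulr0 add0r mulrC; congr (_ / _).
rewrite -/w vw.
have -> : (cos r + w)^-1 * (- sin r - cos r * sin r / w) = - sin r / w.
  by field; rewrite w0 gt_eqF.
have -> : cos r * (cos r * sin r * w^-1 ^+ 3) + w^-1 * - sin r = - sin r * k * w^-1 ^+ 3.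
  have -> : k = w ^+ 2 - cos r ^+ 2 by rewrite wE; ring.
  by field.
by ring.
Qed.

Lemma is_derive_test' (r : R) : is_derive r 1 test' (test'' r).
Proof.
have n1 : n%:R != 0 :> R by rewrite gt_eqF// ltr0n.
have dv := is_derive_cosv r.
have dp := is_derive1D dv (is_derive1Ml (D * k) (is_derive1X 3 dv)).
apply: (is_derive_eq (is_derive1D (is_derive1M (is_derive1M (is_derive_sin r) dp)
   (is_derive1_cst n%:R^-1 r)) (is_derive1Ml e (is_derive1M (is_derive_cos4 r) (is_derive1_cst 4^-1 r))))).
rewrite /test'' /=; congr (_ + _).
  rewrite mulr0 add0r mulrC; congr (_ / _); ring.
by field.
Qed.

Lemma continuous_cosv : continuous v.
Proof. by move=> r; exact: is_derive1_continuous (is_derive_cosv r). Qed.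

Lemma continuous_test'' : continuous test''.
Proof.
move=> r.
have cs := @continuous_sin R r; have cc := @continuous_cos R r.
have cv := @continuous_cosv r.
have cX m : {for r, continuous (fun r => v r ^+ m)}.
  by apply: (@continuous_comp _ _ _ v (fun y => y ^+ m)); [exact: cv|exact: exprn_continuous].
apply: cvgB.
  apply: cvgM; last exact: cvg_cst.
  apply: cvgD.
    apply: cvgM; first exact: cc.
    by apply: cvgD => //; apply: cvgM; [exact: cvg_cst|exact: cX].
  apply: cvgM.
    apply: cvgM; last exact: cc.
    by apply: (@continuous_comp _ _ _ sin (fun y => y ^+ 2)); [exact: cs|exact: exprn_continuous].
  by apply: cvgD; [exact: cX|apply: cvgM; [exact: cvg_cst|exact: cX]].
apply: cvgM; first exact: cvg_cst.
apply: cvgM; last exact: cvg_cst.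
exact: is_derive1_continuous (is_derive_sin4 r).
Qed.

End test_function.

(** * Generator bounds and growth of the test functions *)

Section test_sub_generator_inequality.
Context {R : realType}.

(* To be read with c = cos r, s = sin r, bs = drift n r * sin r, v = cosv k r. *)
Lemma sub_generator_ineq (n m k c s bs v : R) : 1 <= n -> 1 <= m -> n * k = m ^+ 2 ->
  0 < v -> (c ^+ 2 + k) * v ^+ 2 = 1 -> 0 <= s <= 1 ->
  (0 < c -> bs * c <= n * c ^+ 2 + 2) ->
  (c <= 0 -> bs <= n * `|c| + 12 * Num.sqrt n) ->
  c * (v + -1 * k * v ^+ 3) + s ^+ 2 * c * (v ^+ 3 + 3 * -1 * k * v ^+ 5)
    + bs * (v + -1 * k * v ^+ 3) <= n + 1 + 16 * (n / m).
Proof.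
move=> n1 m1 nk v0 cv /andP[s0 s1] hp hn.
(* The point of D = -1: the leading part of f' now vanishes to second order at the equator, which
   compensates the excess of order sqrt n of the drift there. *)
have PE : v + -1 * k * v ^+ 3 = c ^+ 2 * v ^+ 3.
  have -> : v + -1 * k * v ^+ 3 = v - v * (k * v ^+ 2) by ring.
  have -> : k * v ^+ 2 = 1 - c ^+ 2 * v ^+ 2 by rewrite -cv; ring.
  by ring.
have QE : v ^+ 3 + 3 * -1 * k * v ^+ 5 = v ^+ 3 * (1 - 3 * (k * v ^+ 2)) by ring.
rewrite {}PE {}QE.
have k0 : 0 < k by rewrite -(pmulr_rgt0 _ (lt_le_trans ltr01 n1)) nk exprn_gt0//; lra.
(* Scale-free coordinates with x^2 + y = 1: x is near 1 or -1 far from the equator, and y is near 1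
   close to it. Since y <= 1, v is at most sqrt n / m, which controls all error terms by n / m. *)
pose x := c * v; pose y := k * v ^+ 2.
have y0 : 0 <= y by rewrite mulr_ge0 ?sqr_ge0// ltW.
have xy : x ^+ 2 + y = 1 by rewrite -cv /x /y; ring.
have x1 : `|x| <= 1.
  by rewrite -(@expr_le1 _ 2)// -normrX ger0_norm ?sqr_ge0//; lra.
have /andP[x1l x1r] : -1 <= x <= 1 by rewrite -ler_norml.
have m0 : 0 < m by lra.
have v2 : v ^+ 2 <= n / m ^+ 2.
  rewrite ler_pdivlMr ?exprn_gt0// -nk.
  have -> : v ^+ 2 * (n * k) = n * y by rewrite /y; ring.
  by rewrite ler_piMr//; [lra|have := sqr_ge0 x; lra].
have im : 0 < m^-1 <= 1 by rewrite invr_gt0 m0 invf_le1.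
have v2m : v ^+ 2 <= n / m.
  apply: le_trans v2 _; rewrite expr2 invfM mulrA ler_piMr//; last by case/andP: im.
  by rewrite divr_ge0//; lra.
have vm : Num.sqrt n * v <= n / m.
  have sn0 : 0 <= Num.sqrt n by exact: sqrtr_ge0.
  rewrite -(@ler_pXn2r _ 2) ?nnegrE//; first last.
  - by rewrite divr_ge0; lra.
  - by rewrite mulr_ge0// ltW.
  rewrite exprMn sqr_sqrtr; last lra.
  by rewrite expr_div_n expr2 -mulrA ler_wpM2l//; lra.
have t1 : c * (c ^+ 2 * v ^+ 3) <= 1.
  have -> : c * (c ^+ 2 * v ^+ 3) = x ^+ 3 by rewrite /x; ring.
  by rewrite -[X in X <= _]/(x * (x ^+ 2)); nra.
have t2 : s ^+ 2 * c * (v ^+ 3 * (1 - 3 * (k * v ^+ 2))) <= 2 * (n / m).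
  rewrite -/y.
  have -> : s ^+ 2 * c * (v ^+ 3 * (1 - 3 * y)) = v ^+ 2 * (s ^+ 2 * (x * (1 - 3 * y))).
    by rewrite /x; ring.
  apply: (@le_trans _ _ (v ^+ 2 * 2)); last by lra.
  rewrite ler_wpM2l ?sqr_ge0//.
  have s21 : 0 <= s ^+ 2 <= 1 by rewrite sqr_ge0/= expr2; nra.
  have : -2 <= x * (1 - 3 * y) <= 2.
    by have := sqr_ge0 x => ?; apply/andP; split; nra.
  by move: s21; set S := s ^+ 2; nra.
have t3 : bs * (c ^+ 2 * v ^+ 3) <= n + 12 * (n / m).
  have [c0|c0] := ltP 0 c.
    have xp : 0 < x by rewrite mulr_gt0.
    have -> : bs * (c ^+ 2 * v ^+ 3) = (bs * c) * (x * v ^+ 2) by rewrite /x; ring.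
    apply: (@le_trans _ _ ((n * c ^+ 2 + 2) * (x * v ^+ 2))).
      by rewrite ler_wpM2r ?hp// mulr_ge0 ?sqr_ge0// ltW.
    have -> : (n * c ^+ 2 + 2) * (x * v ^+ 2) = n * x ^+ 3 + 2 * (x * v ^+ 2).
      by rewrite /x; ring.
    have : x ^+ 3 <= 1 by rewrite exprn_ile1// ltW.
    have : x * v ^+ 2 <= v ^+ 2 by rewrite ler_piMl ?sqr_ge0.
    by have := sqr_ge0 v; nra.
  apply: (@le_trans _ _ ((n * `|c| + 12 * Num.sqrt n) * (c ^+ 2 * v ^+ 3))).
    by rewrite ler_wpM2r ?hn// mulr_ge0 ?sqr_ge0 ?exprn_ge0// ltW.
  rewrite ler0_norm//.
  have -> : (n * - c + 12 * Num.sqrt n) * (c ^+ 2 * v ^+ 3) =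
    n * (- x) ^+ 3 + 12 * (Num.sqrt n * v * x ^+ 2) by rewrite /x; ring.
  have : (- x) ^+ 3 <= 1 by rewrite exprn_ile1; [|rewrite /x -mulNr mulr_ge0; lra|lra].
  have : Num.sqrt n * v * x ^+ 2 <= Num.sqrt n * v.
    by rewrite ler_piMr ?mulr_ge0 ?sqrtr_ge0 ?(ltW v0)//; lra.
  by nra.
have nm0 : 0 <= n / m by rewrite divr_ge0; lra.
lra.
Qed.

End test_sub_generator_inequality.

Section test_super_generator_inequality.
Context {R : realType}.

(* As in sub_generator_ineq, with qs = sin_ratio n r * sin r. Where c^2 <= m^4 / n,
   the drift alone is too weak and the term D k v^3 takes over. *)
Lemma super_generator_ineq (n m k D c0 c s bs qs v : R) : 8 <= n -> 3 <= m -> n * k = m ^+ 2 ->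
  0 <= D -> 0 <= c0 -> 1 <= D * c0 * m^-1 ^+ 4 ->
  0 < v -> (c ^+ 2 + k) * v ^+ 2 = 1 -> 0 <= s <= 1 ->
  n * `|c| <= bs -> qs <= bs ->
  (c ^+ 2 <= m ^+ 4 / n -> c0 * Num.sqrt n <= qs) ->
  n * ((1 - n^-1 - 3 * m^-1 ^+ 2) * (1 - m^-1 ^+ 2)) <=
  c * (v + D * k * v ^+ 3) + s ^+ 2 * c * (v ^+ 3 + 3 * D * k * v ^+ 5)
    + bs * (v + D * k * v ^+ 3).
Proof.
move=> n8 m3 nk D0 c00 Dc0 v0 cv /andP[s0 s1] bs1 bs2 hq.
have n0 : 0 < n by lra.
have m0 : 0 < m by lra.
have k0 : 0 < k by rewrite -(pmulr_rgt0 _ n0) nk exprn_gt0//; lra.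
set P := v + D * k * v ^+ 3.
have dkv : 0 <= D * k * v ^+ 3 by rewrite !mulr_ge0 ?exprn_ge0// ltW.
have P0 : 0 < P by rewrite /P; lra.
pose y := k * v ^+ 2.
have y0 : 0 < y by rewrite mulr_gt0 ?exprn_gt0.
have cvy : (`|c| * v) ^+ 2 = 1 - y.
  by rewrite exprMn -normrX ger0_norm ?sqr_ge0// /y -cv; ring.
have y1 : y <= 1 by rewrite -subr_ge0 -cvy sqr_ge0.
have cv0 : 0 <= `|c| * v by rewrite mulr_ge0// ltW.
have cv1 : `|c| * v <= 1 by rewrite -(@expr_le1 _ 2)// cvy; lra.
set i := m^-1; have im : i * m = 1 by rewrite mulVf// gt_eqF.
have i0 : 0 < i by rewrite invr_gt0.
have i3 : 3 * i <= 1 by nra.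
have v2 : v ^+ 2 = n * (i ^+ 2 * y).
  have -> : n * (i ^+ 2 * y) = (n * k) * i ^+ 2 * v ^+ 2 by rewrite /y; ring.
  by rewrite nk -exprMn mulrC -[m * i]mulrC im expr1n mulr1.
have v2m : v ^+ 2 <= n * i ^+ 2.
  by rewrite v2 ler_wpM2l ?(ltW n0)// ler_piMr// sqr_ge0.
(* The two terms coming from f'' are at most n [eta] |c| P in absolute value. As n |c| <= [bs], they
   cost only the fraction [eta] of the drift term. *)
set eta := n^-1 + 3 * i ^+ 2.
have eta0 : 0 <= eta by rewrite addr_ge0 ?mulr_ge0 ?invr_ge0 ?sqr_ge0// ltW.
have eta1 : eta <= 1.
  have : n^-1 <= 8^-1 by rewrite lef_pV2 ?posrE.
  by rewrite /eta expr2; nra.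
have etaE : 1 - n^-1 - 3 * i ^+ 2 = 1 - eta by rewrite /eta; ring.
have main : (bs - n * eta * `|c|) * P <=
    c * P + s ^+ 2 * c * (v ^+ 3 + 3 * D * k * v ^+ 5) + bs * P.
  have s21 : 0 <= s ^+ 2 <= 1 by rewrite sqr_ge0/= expr2; nra.
  have Q0 : 0 <= v ^+ 3 + 3 * D * k * v ^+ 5.
    by rewrite addr_ge0 ?mulr_ge0 ?exprn_ge0// ltW.
  have QP : v ^+ 3 + 3 * D * k * v ^+ 5 <= 3 * (n * i ^+ 2) * P.
    have -> : v ^+ 3 + 3 * D * k * v ^+ 5 = v ^+ 2 * (v + 3 * (D * k * v ^+ 3)) by ring.
    apply: (@le_trans _ _ (n * i ^+ 2 * (v + 3 * (D * k * v ^+ 3)))).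
      by rewrite ler_wpM2r//; lra.
    have -> : 3 * (n * i ^+ 2) * P = n * i ^+ 2 * (3 * P) by ring.
    rewrite ler_wpM2l//.
      by rewrite mulr_ge0 ?sqr_ge0// ltW.
    by rewrite /P; lra.
  have ne : n * eta = 1 + 3 * (n * i ^+ 2) by rewrite /eta; field; rewrite gt_eqF.
  have nc : - `|c| <= c by rewrite lerNl -normrN ler_norm.
  have cn : 0 <= `|c| by [].
  have h1 : - `|c| * P <= c * P by rewrite ler_wpM2r// ltW.
  have h2 : - `|c| * (3 * (n * i ^+ 2) * P) <= s ^+ 2 * c * (v ^+ 3 + 3 * D * k * v ^+ 5).
    set Q := v ^+ 3 + _ in Q0 QP *.
    apply: (@le_trans _ _ (- `|c| * Q)); first by rewrite !mulNr lerN2 ler_wpM2l.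
    rewrite ler_wpM2r//; apply: (@le_trans _ _ (- (s ^+ 2 * `|c|))).
      by rewrite lerN2 ler_piMl//; case/andP: s21.
    by rewrite -mulrN ler_wpM2l ?sqr_ge0.
  rewrite ne; lra.
rewrite etaE; apply: le_trans main.
have bs3 : (1 - eta) * bs <= bs - n * eta * `|c|.
  by have : eta * (n * `|c|) <= eta * bs; [rewrite ler_wpM2l|lra].
apply: (@le_trans _ _ ((1 - eta) * bs * P)); last by rewrite ler_wpM2r// ltW.
rewrite mulrCA -mulrA ler_wpM2l//; first by lra.
(* If y <= m^(-2), then |c| v is close to 1 and the bound n |c| <= [bs] suffices. Otherwise v^2 = n
   y / m^2 exceeds n / m^4, which forces c^2 <= m^4 / n; then [bs] >= c0 sqrt n, D k v^3 = D y v is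
   at least D sqrt n / m^4, and the condition on D and c0 makes the product at least n. *)
have [yi|yi] := leP y (i ^+ 2).
  apply: (@le_trans _ _ (n * `|c| * v)); last first.
    apply: (@le_trans _ _ (n * `|c| * P)); last by rewrite ler_wpM2r// ltW.
    by rewrite ler_wpM2l ?mulr_ge0 ?(ltW n0)// /P; lra.
  rewrite -mulrA ler_wpM2l ?(ltW n0)//.
  apply: (@le_trans _ _ ((`|c| * v) ^+ 2)); first by rewrite cvy; lra.
  by rewrite expr2 ler_piMl.
have c2 : c ^+ 2 <= m ^+ 4 / n.
  have cv2 : c ^+ 2 * v ^+ 2 <= 1 by rewrite -exprMn -[_ ^+ 2]ger0_norm ?sqr_ge0// normrX normrM (gtr0_norm v0) cvy; lra.
  have v2i : n * i ^+ 4 < v ^+ 2.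
    have -> : n * i ^+ 4 = n * (i ^+ 2 * i ^+ 2) by ring.
    by rewrite v2 ltr_pM2l// ltr_pM2l// exprn_gt0.
  rewrite ler_pdivlMr//.
  have im4 : i ^+ 4 * m ^+ 4 = 1 by rewrite -exprMn im expr1n.
  have m40 : 0 < m ^+ 4 by rewrite exprn_gt0.
  rewrite -[leLHS]mulr1 -im4 mulrA ler_piMl ?(ltW m40)//.
  by rewrite -mulrA; have := sqr_ge0 c; nra.
have hbs : c0 * Num.sqrt n <= bs by exact: le_trans (hq c2) bs2.
have sn0 : 0 < Num.sqrt n by rewrite sqrtr_gt0.
have sn2 : Num.sqrt n ^+ 2 = n by rewrite sqr_sqrtr// ltW.
have vl : Num.sqrt n * i ^+ 2 <= v.
  rewrite -(@ler_pXn2r _ 2) ?nnegrE ?(ltW v0)//; last first.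
    by rewrite mulr_ge0 ?sqr_ge0// ltW.
  rewrite exprMn sn2 v2 ler_wpM2l ?(ltW n0)//.
  by rewrite expr2 ler_wpM2l ?sqr_ge0// ltW.
apply: (@le_trans _ _ (c0 * Num.sqrt n * (D * (y * v)))); last first.
  apply: (@le_trans _ _ (c0 * Num.sqrt n * P)); last by rewrite ler_wpM2r// ltW.
  rewrite ler_wpM2l ?mulr_ge0 ?(ltW sn0)//.
  have -> : D * (y * v) = D * k * v ^+ 3 by rewrite /y; ring.
  by rewrite /P; lra.
apply: (@le_trans _ _ (c0 * Num.sqrt n * (D * (i ^+ 2 * (Num.sqrt n * i ^+ 2))))).
  have -> : c0 * Num.sqrt n * (D * (i ^+ 2 * (Num.sqrt n * i ^+ 2))) =
    Num.sqrt n ^+ 2 * (D * c0 * i ^+ 4) by ring.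
  rewrite sn2 ler_wpM2l ?(ltW n0)//.
  by move: Dc0; rewrite -/i; have := sqr_ge0 i; lra.
rewrite ler_wpM2l ?mulr_ge0 ?(ltW sn0)// ler_wpM2l//.
by apply: ler_pM; rewrite ?mulr_ge0 ?sqr_ge0// ?ltW.
Qed.

End test_super_generator_inequality.

Section generator.
Context {R : realType}.

(** The angle r / 4 stays in [0, pi/4], so the correction sin (r / 4) is strictly increasing up to
    and including both ends. *)
Lemma quarter_trig (r : R) : 0 <= r <= pi -> 0 < cos (r / 4) /\ 0 <= sin (r / 4) <= 1.
Proof.
move=> /andP[r0 rp]; have p0 := pi_gt0 R; split.
  by apply: cos_gt0_pihalf; lra.
by rewrite sin_le1 andbT sin_ge0_pi//; lra.
Qed.

Section test_values.
Variables (n : nat) (k D e : R).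
Hypotheses (n0 : (0 < n)%N) (k0 : 0 < k).
Local Notation f := (test n k D e).

Lemma generator_testE (b r : R) :
  test'' n k D e r + b * test' n k D e r =
  (cos r * (cosv k r + D * k * cosv k r ^+ 3)
   + sin r ^+ 2 * cos r * (cosv k r ^+ 3 + 3 * D * k * cosv k r ^+ 5)
   + b * sin r * (cosv k r + D * k * cosv k r ^+ 3)) / n%:R
  + e * (b * (cos (r / 4) / 4) - sin (r / 4) / 16).
Proof. by rewrite /test'' /test'; ring. Qed.

Lemma test'0 : test' n k D e 0 = e / 4.
Proof. by rewrite /test' sin0 !mul0r cos0 add0r mulrA mulr1. Qed.

Lemma test'pi : test' n k D e pi = e * (cos (pi / 4) / 4).
Proof. by rewrite /test' sinpi !mul0r add0r. Qed.

(** The logarithm stays bounded below because (cos r + w)(w - cos r) = k with w - cos r at most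
    [w0], so its argument is at least k / [w0]. *)
Lemma test_bounded : exists M, forall r, `|f r| <= M.
Proof.
pose w0 : R := 1 + Num.sqrt (1 + k).
have w01 : 1 <= w0 by rewrite lerDl sqrtr_ge0.
have w00 : 0 < w0 by lra.
exists ((`|ln w0| + `|ln (k / w0)| + `|D|) / n%:R + `|e|) => r.
have w0k := ln_arg_gt0 k0 r.
set w : R := Num.sqrt (cos r ^+ 2 + k) in w0k *.
have wE : w ^+ 2 = cos r ^+ 2 + k by rewrite sqr_sqrtr// ltW// cosv_arg_gt0.
have cb := cos_le1 r; have cb' := cos_geN1 r.
have ww0 : w <= Num.sqrt (1 + k).
  rewrite ler_sqrt; last by rewrite addr_ge0// ltW.
  by have := cos2Dsin2 r; have := sqr_ge0 (sin r); lra.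
have h1 : cos r + w <= w0 by rewrite /w0; lra.
have h2 : w - cos r <= w0 by rewrite /w0; lra.
have h3 : k / w0 <= cos r + w.
  rewrite ler_pdivrMr//.
  have -> : k = (cos r + w) * (w - cos r).
    have -> : (cos r + w) * (w - cos r) = w ^+ 2 - cos r ^+ 2 by ring.
    by rewrite wE; ring.
  by rewrite ler_wpM2l// ltW.
have l1 : `|ln (cos r + w)| <= `|ln w0| + `|ln (k / w0)|.
  have kw : 0 < k / w0 by rewrite divr_gt0.
  have a1 : ln (cos r + w) <= ln w0 by rewrite ler_ln ?posrE.
  have a2 : ln (k / w0) <= ln (cos r + w) by rewrite ler_ln ?posrE.
  have := ler_norm (ln w0); have := ler_norm (- ln (k / w0)); rewrite normrN.
  have := normr_ge0 (ln w0); have := normr_ge0 (ln (k / w0)).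
  by rewrite ler_norml => ? ? ? ?; apply/andP; split; lra.
have l2 : `|cos r * cosv k r| <= 1.
  rewrite -(@expr_le1 _ 2)// -normrX ger0_norm ?sqr_ge0// -(cosv_sqr k0 r) exprMn.
  by rewrite ler_wpM2r ?sqr_ge0// lerDl ltW.
rewrite /test -/w (le_trans (ler_normD _ _))// lerD//.
  rewrite normrM normrN [`|n%:R^-1|]ger0_norm// ler_wpM2r// (le_trans (ler_normD _ _))// lerD//.
  by rewrite normrM ler_piMr.
by rewrite normrM ler_piMr// ler_norml sin_geN1 sin_le1.
Qed.

(** As (w - 1)(w + 1) = k for w = sqrt (1 + k), the small argument w - 1 of the logarithm at pi is k
    / (w + 1). The term - ln k is the source of ln n, since k = m^2 / n. *)
Lemma test_pi_sub_0 : f pi - f 0 =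
  (2 * ln (1 + Num.sqrt (1 + k)) - ln k + 2 * D / Num.sqrt (1 + k)) / n%:R
  + e * sin (pi / 4).
Proof.
rewrite /test cospi cos0 mul0r sin0 /cosv cospi cos0 sqrrN expr1n mulr0.
set w : R := Num.sqrt (1 + k).
have wE : w ^+ 2 = 1 + k by rewrite sqr_sqrtr// addr_ge0// ltW.
have w0 : 0 <= w by rewrite sqrtr_ge0.
have k1 : 0 < k := k0.
have w1 : 0 < -1 + w.
  rewrite addrC subr_gt0 -(@ltr_pXn2r _ 2) ?nnegrE// expr1n wE; lra.
have -> : ln k = ln (-1 + w) + ln (1 + w).
  rewrite -lnM ?posrE//; last lra.
  congr ln; have -> : (-1 + w) * (1 + w) = w ^+ 2 - 1 by ring.
  by rewrite wE; ring.
ring.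
Qed.

End test_values.

(** The factor 16 in [e] makes the second derivative of [e] sin (r / 4) at most 1 / n in absolute
    value; its drift term has the favourable sign because the drift is nonnegative and [e] < 0. *)
Lemma sub_generator (n : nat) (m r : R) : (0 < n)%N -> 1 <= m -> 0 < r < pi ->
  let k := m ^+ 2 / n%:R in let e := - 16 / n%:R in
  (test'' n k (-1) e r + drift n r * test' n k (-1) e r <= 1 + 2 / n%:R + 16 / m : Prop).
Proof.
move=> n0 m1 rpi k e; have /andP[r0 rp] := rpi.
have n1 : 1 <= n%:R :> R by rewrite ler1n.
have n00 : 0 < n%:R :> R by lra.
have k0 : 0 < k by rewrite divr_gt0// exprn_gt0//; lra.
have nk : n%:R * k = m ^+ 2 by rewrite /k mulrC divfK// gt_eqF.
rewrite generator_testE.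
have s0 := sin_gt0_pi rpi.
have := @sub_generator_ineq R n%:R m k (cos r) (sin r) (drift n r * sin r) (cosv k r) n1 m1 nk
  (cosv_gt0 k0 r) (cosv_sqr k0 r).
rewrite (ltW s0) sin_le1 => /(_ isT (drift_sin_le_cos_gt0 n rpi) (drift_sin_le_cos_le0 n0 rpi)).
set X := (X in X <= _ -> _) => hX.
have hX2 : X / n%:R <= 1 + 1 / n%:R + 16 / m.
  rewrite ler_pdivrMr//.
  have -> // : (1 + 1 / n%:R + 16 / m) * n%:R = n%:R + 1 + 16 * (n%:R / m).
  by field; rewrite !gt_eqF//; lra.
have [c4 /andP[s40 s41]] : 0 < cos (r / 4) /\ 0 <= sin (r / 4) <= 1.
  by apply: quarter_trig; rewrite !ltW.
have b0 := drift_ge0 n0 rpi.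
apply: (@le_trans _ _ (1 + 1 / n%:R + 16 / m + 1 / n%:R)); last by lra.
apply: lerD => //; rewrite /e mulNr mulNr -mulrN mulrAC ler_pM2r ?invr_gt0//.
by have := mulr_ge0 b0 (ltW c4); lra.
Qed.

(* The reciprocal of the constant of sin_ratio_ge_sqrt at x = m^4, times m^4. *)
Definition bump (m : R) : R := m ^+ 4 * (5 * Num.sqrt (m ^+ 4)) / expR (- 4 * m ^+ 4).

Lemma bump_ge0 (m : R) : 0 <= m -> 0 <= bump m.
Proof.
by move=> m0; rewrite /bump !mulr_ge0 ?exprn_ge0 ?sqrtr_ge0 ?invr_ge0 ?expR_ge0.
Qed.

Lemma super_generator (n : nat) (m r : R) : (8 <= n)%N -> 3 <= m ->
  2 * m ^+ 4 <= n%:R -> 0 < r < pi ->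
  let k := m ^+ 2 / n%:R in let e := 16 / n%:R in
  ((1 - n%:R^-1 - 3 * m^-1 ^+ 2) * (1 - m^-1 ^+ 2) - 1 / n%:R <=
  test'' n k (bump m) e r + drift n r * test' n k (bump m) e r : Prop).
Proof.
move=> n8 m3 mn rpi k e; have /andP[r0 rp] := rpi.
have n0 : (0 < n)%N by apply: leq_trans n8.
have n1 : 8 <= n%:R :> R by rewrite ler_nat.
have n00 : 0 < n%:R :> R by lra.
have m0 : 0 < m by lra.
have k0 : 0 < k by rewrite divr_gt0// exprn_gt0.
have nk : n%:R * k = m ^+ 2 by rewrite /k mulrC divfK// gt_eqF.
rewrite generator_testE.
have s0 := sin_gt0_pi rpi.
have m40 : 0 < m ^+ 4 by rewrite exprn_gt0.
have m41 : 1 <= m ^+ 4 by rewrite exprn_ege1//; lra.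
pose c0 := expR (- 4 * m ^+ 4) / (5 * Num.sqrt (m ^+ 4)).
have c00 : 0 <= c0 by rewrite /c0 mulr_ge0 ?expR_ge0 ?invr_ge0 ?mulr_ge0 ?sqrtr_ge0.
have Dc0 : 1 <= bump m * c0 * m^-1 ^+ 4.
  rewrite le_eqVlt; apply/orP; left; apply/eqP; rewrite /bump /c0 exprVn; field.
  by rewrite !gt_eqF ?expR_gt0 ?sqrtr_gt0.
have := @super_generator_ineq R n%:R m k (bump m) c0 (cos r) (sin r) (drift n r * sin r)
  (sin_ratio n r * sin r) (cosv k r) n1 m3 nk (bump_ge0 (ltW m0)) c00 Dc0
  (cosv_gt0 k0 r) (cosv_sqr k0 r).
rewrite (ltW s0) sin_le1 => /(_ isT (drift_sin_ge n0 rpi) (drift_sin_ge_ratio n0 rpi)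
  (sin_ratio_ge_sqrt n0 m41 mn rpi)).
set X := (X in _ <= X -> _); set Y := (_ - _ - _) * _ => hX.
have hX2 : Y <= X / n%:R by rewrite ler_pdivlMr// mulrC.
have [c4 /andP[s40 s41]] : 0 < cos (r / 4) /\ 0 <= sin (r / 4) <= 1.
  by apply: quarter_trig; rewrite !ltW.
have b0 := drift_ge0 n0 rpi.
apply: lerD => //; rewrite /e mulrAC -mulNr ler_pM2r ?invr_gt0//.
by have := mulr_ge0 b0 (ltW c4); lra.
Qed.

(** 18 = 2 + 16: the D term loses at most 2 / n and the sine correction at most 16 / n. *)
Lemma sub_test_growth (n : nat) (m : R) : (0 < n)%N -> 1 <= m ->
  let k := m ^+ 2 / n%:R in let e := - 16 / n%:R in
  ((ln n%:R - 2 * ln m - 18) / n%:R <= test n k (-1) e pi - test n k (-1) e 0 : Prop).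
Proof.
move=> n0 m1 k e.
have n00 : 0 < n%:R :> R by rewrite ltr0n.
have m0 : 0 < m by lra.
have k0 : 0 < k by rewrite divr_gt0// exprn_gt0.
rewrite test_pi_sub_0// /e.
have w1 : 1 <= Num.sqrt (1 + k) by rewrite -[X in X <= _]sqrtr1 ler_sqrt; lra.
have l0 : 0 <= ln (1 + Num.sqrt (1 + k)) by rewrite ln_ge0//; lra.
have lk : ln k = 2 * ln m - ln n%:R.
  by rewrite /k ln_div ?posrE ?exprn_gt0// lnXn// mulr_natl.
have [_ /andP[s40 s41]] : 0 < cos (pi / 4 : R) /\ 0 <= sin (pi / 4 : R) <= 1.
  by apply: quarter_trig; rewrite lexx pi_ge0.
have i1 : 2 * -1 / Num.sqrt (1 + k) >= -2.
  rewrite mulrN1 mulNr lerN2 ler_pdivrMr; lra.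
rewrite [_ * sin _]mulrAC -mulrDl ler_pM2r ?invr_gt0// lk; lra.
Qed.

(** 20 = 4 + 16: k <= 1 gives ln (1 + sqrt (1 + k)) <= sqrt (1 + k) <= 2, and the sine correction
    adds at most 16 / n. *)
Lemma super_test_growth (n : nat) (m : R) : (0 < n)%N -> 1 <= m -> m ^+ 2 <= n%:R ->
  let k := m ^+ 2 / n%:R in let e := 16 / n%:R in
  (test n k (bump m) e pi - test n k (bump m) e 0 <=
  (ln n%:R + 2 * bump m + 20) / n%:R : Prop).
Proof.
move=> n0 m1 mn k e.
have n00 : 0 < n%:R :> R by rewrite ltr0n.
have m0 : 0 < m by lra.
have k0 : 0 < k by rewrite divr_gt0// exprn_gt0.
have k1 : k <= 1 by rewrite ler_pdivrMr// mul1r.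
rewrite test_pi_sub_0// /e.
have w1 : 1 <= Num.sqrt (1 + k) by rewrite -[X in X <= _]sqrtr1 ler_sqrt; lra.
have w2 : Num.sqrt (1 + k) <= 2.
  rewrite -(@ler_pXn2r _ 2) ?nnegrE ?sqrtr_ge0// sqr_sqrtr; [|lra].
  by rewrite expr2; lra.
have l0 : ln (1 + Num.sqrt (1 + k)) <= 2.
  by apply: le_trans (le_ln1Dx _) _; lra.
have lk : ln k = 2 * ln m - ln n%:R.
  by rewrite /k ln_div ?posrE ?exprn_gt0// lnXn// mulr_natl.
have lm : 0 <= ln m by exact: ln_ge0.
have [_ /andP[s40 s41]] : 0 < cos (pi / 4 : R) /\ 0 <= sin (pi / 4 : R) <= 1.
  by apply: quarter_trig; rewrite lexx pi_ge0.
have D0 := bump_ge0 (ltW m0).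
have i1 : 2 * bump m / Num.sqrt (1 + k) <= 2 * bump m.
  by rewrite ler_pdivrMr ?ler_peMr; lra.
rewrite [_ * sin _]mulrAC -mulrDl ler_pM2r ?invr_gt0// lk; lra.
Qed.

End generator.

(** * The Gaussian step *)

Section bounded_integrable.
Context d (T : measurableType d) (R : realType) (P : probability T R).

Lemma bounded_integrable (D : set T) (f : T -> R) (M : R) : measurable D ->
  measurable_fun D f -> (forall x, D x -> `|f x| <= M) ->
  P.-integrable D (EFin \o f).
Proof.
move=> mD mf fM; apply: measurable_bounded_integrable => //.
  by rewrite (le_lt_trans (probability_le1 P mD))// ltry.
exists M; split; first exact: num_real.
move=> y My x Dx; exact: (le_trans (fM _ Dx) (ltW My)).
Qed.

Lemma integrable_add (D : set T) (f g : T -> R) : measurable D ->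
  P.-integrable D (EFin \o f) -> P.-integrable D (EFin \o g) ->
  P.-integrable D (EFin \o (fun x => f x + g x)).
Proof. by move=> mD fi gi; exact: (integrableD mD fi gi). Qed.

Lemma integrable_sub (D : set T) (f g : T -> R) : measurable D ->
  P.-integrable D (EFin \o f) -> P.-integrable D (EFin \o g) ->
  P.-integrable D (EFin \o (fun x => f x - g x)).
Proof. by move=> mD fi gi; exact: (integrableB mD fi gi). Qed.

Lemma integrable_scale (D : set T) (k : R) (f : T -> R) : measurable D ->
  P.-integrable D (EFin \o f) -> P.-integrable D (EFin \o (fun x => k * f x)).
Proof. by move=> mD fi; exact: (integrableZl mD k fi). Qed.

Lemma integrable_const (D : set T) (k : R) : measurable D ->
  P.-integrable D (EFin \o (fun _ : T => k)).
Proof. by move=> mD; apply: (@bounded_integrable D _ `|k|). Qed.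

Lemma RintegralT_cst (k : R) : \int[P]_x k = k.
Proof.
rewrite Rintegral_cst//; transitivity (k * fine 1%E); last by rewrite mulr1.
by congr (_ * fine _); exact: (@probability_setT _ _ _ P).
Qed.

End bounded_integrable.

Section gaussian.
Context {R : realType}.
Variable s : R.
Hypothesis s0 : s != 0.
Local Notation mu := (@lebesgue_measure R).
Local Notation N := (normal_prob 0 s).

(** The density agrees almost everywhere with the Radon-Nikodym derivative, as both have the same
    integral over every measurable set. *)
Lemma integral_normal_prob (f : R -> \bar R) : N.-integrable setT f ->
  (\int[N]_x f x = \int[mu]_x (f x * (normal_pdf 0 s x)%:E))%E.
Proof.
move=> intf; have mf := measurable_int _ intf.
have dom := @normal_prob_dominates R 0 s.
rewrite -(Radon_Nikodym_change_of_variables dom)//=.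
apply: ae_eq_integral => //.
- exact: emeasurable_funM.
- apply: (@emeasurable_funM _ _ _ _ f (EFin \o normal_pdf 0 s)) => //.
  apply/measurable_EFinP; exact: measurable_normal_pdf.
- apply: ae_eqe_mul2l => /=.
  rewrite Radon_NikodymE//=.
  case: cid => /= h [h1 h2 h3].
  apply: integral_ae_eq => //=.
  + by apply/measurableT_comp => //; exact: measurable_normal_pdf.
  + by move=> E E01 mE; rewrite -h3.
Qed.

Lemma Rintegral_normal_prob (f : R -> R) : N.-integrable setT (EFin \o f) ->
  \int[N]_x f x = \int[mu]_x (f x * normal_pdf 0 s x).
Proof.
move=> intf; rewrite /Rintegral integral_normal_prob//.
Qed.

Lemma integralT_opp (g : R -> \bar R) : mu.-integrable setT g ->
  (\int[mu]_x g (- x)%R = \int[mu]_x g x)%E.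
Proof.
move=> ig.
have mg := measurable_int _ ig.
pose phi : measurableTypeR R -> measurableTypeR R := -%R.
have mphi : measurable_fun setT phi by exact: oppr_measurable.
have ge0 (h : R -> \bar R) : measurable_fun [set: measurableTypeR R] h ->
    (forall x, 0 <= h x)%E -> (\int[mu]_x h (- x)%R = \int[mu]_x h x)%E.
  move=> mh h0; have := @ge0_integral_pushforward _ _ _ _ R phi mphi mu setT h measurableT mh.
  rewrite preimage_setT => <-; last by move=> y _; exact: h0.
  by apply: eq_measure_integral => //= A mA _; exact: lebesgue_measureN.
rewrite [LHS]integralE [RHS]integralE; congr (_ - _)%E.
  rewrite -[RHS]ge0//; last exact: measurable_funepos.
  by apply: eq_integral => x _; exact: (congr1 (@^~ x) (funepos_comp g -%R)).
rewrite -[RHS]ge0//; last exact: measurable_funeneg.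
by apply: eq_integral => x _; exact: (congr1 (@^~ x) (funeneg_comp g -%R)).
Qed.

Lemma normal_pdf_opp (x : R) : normal_pdf 0 s (- x) = normal_pdf 0 s x.
Proof. by rewrite normal_pdfE//= /normal_fun !subr0 sqrrN. Qed.

Lemma Rintegral_normal_opp (f : R -> R) (M : R) : measurable_fun setT f ->
  (forall x, `|f x| <= M) -> \int[N]_x f (- x) = \int[N]_x f x.
Proof.
move=> mf fM.
have mfN : measurable_fun setT (fun x : R => f (- x)) by exact: measurableT_comp.
have iN (g : R -> R) : measurable_fun setT g -> (forall x, `|g x| <= M) ->
    N.-integrable setT (EFin \o g).
  by move=> mg gM; apply: (@bounded_integrable _ _ _ _ _ _ M).
rewrite !Rintegral_normal_prob; [|exact: iN..].
rewrite /Rintegral; congr fine; rewrite -[RHS]integralT_opp.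
  by apply: eq_integral => x _; rewrite normal_pdf_opp.
apply: (le_integrable measurableT _ _
  (integrableZl measurableT M (integrable_normal_pdf 0 s))).
- apply/measurable_EFinP; apply: measurable_funM => //.
  exact: measurable_normal_pdf.
- move=> x _ /=; rewrite lee_fin !normrM ler_wpM2r// (le_trans (fM _))//.
  exact: ler_norm.
Qed.

(** The product of exp (-t x^2) with the density of standard deviation s is a multiple of the
    density of standard deviation s', where 1 / s'^2 = 1 / s^2 + 2t. *)
Lemma integral_gaussian_exp (t : R) : 0 <= t ->
  \int[N]_x expR (- t * x ^+ 2) = (Num.sqrt (1 + 2 * t * s ^+ 2))^-1.
Proof.
move=> t0.
have mexp : measurable_fun setT (fun x : R => expR (- t * x ^+ 2)).
  by apply: measurableT_comp => //; exact: measurable_funM.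
rewrite Rintegral_normal_prob; last first.
  apply: (@bounded_integrable _ _ _ _ _ _ 1) => // x _.
  rewrite ger0_norm ?expR_ge0// -expR0 ler_expR mulNr oppr_le0.
  by rewrite mulr_ge0// sqr_ge0.
have s20 : 0 < s ^+ 2 by rewrite exprn_even_gt0.
set a := 1 + 2 * t * s ^+ 2.
have a0 : 0 < a by rewrite /a; have := mulr_ge0 t0 (ltW s20); lra.
pose s' := s / Num.sqrt a.
have s'0 : s' != 0 by rewrite mulf_neq0// invr_neq0// gt_eqF// sqrtr_gt0.
have sa2 : Num.sqrt a ^+ 2 = a by rewrite sqr_sqrtr// ltW.
have E x : expR (- t * x ^+ 2) * normal_pdf 0 s x =
    (Num.sqrt a)^-1 * normal_pdf 0 s' x.
  rewrite !normal_pdfE// /normal_fun mulrCA -expRD [RHS]mulrA; congr (_ * expR _).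
    rewrite /normal_peak /s' expr_div_n sa2 -invfM; congr (_^-1).
    rewrite -sqrtrM ?(ltW a0)//; congr Num.sqrt.
    by field; rewrite gt_eqF.
  rewrite /s' expr_div_n sa2 !subr0 /a; field.
  by rewrite s0 /= -/a gt_eqF.
under eq_Rintegral do rewrite E.
rewrite RintegralZl//; last exact: integrable_normal_pdf.
by rewrite /Rintegral integral_normal_pdf mulr1.
Qed.

End gaussian.

(** * Moduli of continuity and bounds on compact intervals *)

Section compact_interval.
Context {R : realType}.
Implicit Types (f : R -> R) (a b : R).

Lemma itv_uniform_continuity f a b : {within `[a, b], continuous f} ->
  forall e, 0 < e -> exists2 dl, 0 < dl & forall x y,
    x \in `[a, b] -> y \in `[a, b] -> `|x - y| <= dl -> `|f x - f y| <= e.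
Proof.
move=> /subspace_continuousP cf e e0.
have /compact_near_coveringP/near_covering_withinP := @segment_compact R a b.
pose P (dl x : R) := forall y, y \in `[a, b] -> `|x - y| <= dl -> `|f x - f y| <= e.
move=> /(_ R (0^'+) P _) [].
  move=> x xab.
  have : \forall z \near within `[a, b] (nbhs x), `|f x - f z| <= e / 2.
    by have /cvgrPdist_le := cf x xab; apply; rewrite divr_gt0.
  rewrite near_withinE => /nbhs_ballP[eta /= eta0 h].
  exists (ball x (eta / 2), [set dl | dl < eta / 2]) => /=.
    split; first by apply: nbhsx_ballx; rewrite divr_gt0.
    by apply: nbhs_right_lt; rewrite divr_gt0.
  move=> [z dl] [/= xz dle] zab y yab zy.
  have hz : `|f x - f z| <= e / 2.
    by apply: h => //; apply: le_ball xz; lra.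
  have hy : `|f x - f y| <= e / 2.
    apply: h => //; rewrite /ball/=.
    have -> : x - y = (x - z) + (z - y) by ring.
    apply: le_lt_trans (ler_normD _ _) _.
    by move: xz; rewrite /ball/=; lra.
  have -> : f z - f y = (f x - f y) - (f x - f z) by ring.
  by apply: le_trans (ler_normB _ _) _; lra.
move=> eta /= eta0 h; exists (eta / 2); first by rewrite divr_gt0.
move=> x y xab; apply: (h (eta / 2)) => //=; last by rewrite divr_gt0.
by rewrite sub0r normrN gtr0_norm; lra.
Qed.

Lemma itv_bounded f a b : {within `[a, b], continuous f} ->
  exists M, forall x, x \in `[a, b] -> `|f x| <= M.
Proof.
move=> cf.
have /compact_bounded[M [_ h]] := continuous_compact cf (@segment_compact R a b).
exists (M + 1) => x xab; apply: (h (M + 1)); first by rewrite ltrDl.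
by exists x.
Qed.

End compact_interval.

Section second_difference.
Context {R : realType}.
Variables (f f' f'' : R -> R).
Hypotheses (df : forall x : R, is_derive x 1 f (f' x))
  (df' : forall x : R, is_derive x 1 f' (f'' x)).

(** The function u -> f (x + u) + f (x - u) - c u^2 has derivative f' (x + u) - f' (x - u) - 2 c u,
    which is 2 u (f'' z - c) >= 0 for some intermediate z. Symmetrisation removes the first-order
    term. *)
Lemma second_difference_ge (x t c : R) : 0 <= t ->
  (forall z, `|z - x| <= t -> c <= f'' z) ->
  c * t ^+ 2 <= f (x + t) + f (x - t) - 2 * f x.
Proof.
move=> t0 hc.
have dD (z : R) : is_derive z 1 (fun t : R => x + t) 1.
  by apply: (is_derive_eq (is_derive1D (is_derive1_cst x z) (is_derive_id z 1))); rewrite add0r.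
have dB (z : R) : is_derive z 1 (fun t : R => x - t) (-1).
  by apply: (is_derive_eq (is_derive1B (is_derive1_cst x z) (is_derive_id z 1))); rewrite sub0r.
have cf' : continuous f' by move=> z; exact: is_derive1_continuous (df' z).
pose g (u : R) := f (x + u) + f (x - u) - c * u ^+ 2.
have g0 : g 0 = 2 * f x by rewrite /g addr0 subr0; ring.
have dg (u : R) : is_derive u 1 g (f' (x + u) - f' (x - u) - 2 * c * u).
  have d1 := @is_derive1_comp _ f _ u _ _ (df (x + u)) (dD u).
  have d2 := @is_derive1_comp _ f _ u _ _ (df (x - u)) (dB u).
  apply: (is_derive_eq (is_derive1B (is_derive1D d1 d2)
    (is_derive1Ml c (is_derive1X 2 (is_derive_id u 1))))).
  by rewrite /=; ring.
suff : g 0 <= g t by rewrite g0 /g; lra.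
apply: (@ge0_derive_le R g (fun u => f' (x + u) - f' (x - u) - 2 * c * u)) => //.
  move=> u /andP[u0 ut].
  have [||z] := @MVT_segment R f' f'' (x - u) (x + u) _ (fun z _ => df' z).
  - lra.
  - exact: continuous_subspaceT.
  rewrite in_itv/= => /andP[z1 z2] ->.
  have := hc z; rewrite ler_norml => /(_ _); have -> : - t <= z - x <= t by apply/andP; split; lra.
  by move=> /(_ isT); nra.
by apply: continuous_subspaceT => z; exact: is_derive1_continuous (dg z).
Qed.

(* A bounded substitute for y^2 near 0 with explicit Gaussian means: no moment of
   the normal law is needed. *)
Definition gap (y : R) : R := 1 - expR (- 1 * y ^+ 2).

Lemma gap_ge0 y : 0 <= gap y.
Proof. by rewrite subr_ge0 -[X in _ <= X]expR0 ler_expR mulN1r oppr_le0 sqr_ge0. Qed.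

Lemma gap_le1 y : gap y <= 1.
Proof. by rewrite gerBl expR_ge0. Qed.

(** With u = y^2 <= 1 the error u - (1 - exp (-u)) lies between 0 and u^2, and u / 2 <= 1 - exp
    (-u). Stating the error through [gap y ^+ 2] keeps its Gaussian mean explicit. *)
Lemma sqr_sub_gap y : `|y| <= 1 -> `|y ^+ 2 - gap y| <= 4 * gap y ^+ 2.
Proof.
move=> y1; rewrite /gap mulN1r; set u := y ^+ 2.
have u0 : 0 <= u by rewrite sqr_ge0.
have u1 : u <= 1 by rewrite /u -(@real_normK _ y) ?num_real// exprn_ile1.
have e1 : 1 - u <= expR (- u) by exact: expR_ge1Dx.
have e2 : expR (- u) <= (1 + u)^-1.
  by rewrite expRN lef_pV2 ?posrE ?expR_gt0 ?expR_ge1Dx//; lra.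
have e3 : (1 + u)^-1 * (1 + u) = 1 by rewrite mulVf// gt_eqF//; lra.
set E := expR (- u) in e1 e2 *.
have h1 : u - (1 - E) <= u ^+ 2.
  suff : (1 + u)^-1 <= 1 - u + u ^+ 2 by lra.
  by rewrite -(@ler_pM2r _ (1 + u)) ?e3//; nra.
have h2 : u / 2 <= 1 - E.
  suff : (1 + u)^-1 <= 1 - u / 2 by lra.
  by rewrite -(@ler_pM2r _ (1 + u)) ?e3//; nra.
rewrite ger0_norm; last lra.
by apply: le_trans h1 _; rewrite expr2; nra.
Qed.

Lemma gap_ge dl y : 0 <= dl -> dl <= `|y| -> gap dl <= gap y.
Proof.
move=> d0 dy; rewrite lerB// ler_expR !mulN1r lerN2.
by rewrite -[leRHS]ger0_norm ?sqr_ge0// normrX lerXn2r.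
Qed.

Lemma gap_gt0 y : 0 < y -> 0 < gap y.
Proof. by move=> y0; rewrite subr_gt0 -[X in _ < X]expR0 ltr_expR mulN1r oppr_lt0 exprn_gt0. Qed.

Hypotheses (cf'' : continuous f'').
Variable M : R.
Hypothesis fM : forall x, `|f x| <= M.

(** A Taylor bound valid for every y. For |y| <= [eta] it follows from [second_difference_ge], at
    the price 4 [K1] [gap y ^+ 2] of replacing y^2 by [gap y]. For larger y the gap is at least
    [g0], so the second part of C outweighs all bounded terms. *)
Lemma symmetrized_ge (a b e : R) : 0 < e -> exists2 C, 0 <= C &
  forall x y, x \in `[a, b] ->
  (f'' x - e) * gap y - C * gap y ^+ 2 <=
  (f (x + Num.sqrt 2 * y) + f (x - Num.sqrt 2 * y)) / 2 - f x.
Proof.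
move=> e0.
have cw (u v : R) : {within `[u, v], continuous f''} by exact: continuous_subspaceT.
have [dl dl0 hdl] := itv_uniform_continuity (cw (a - 2) (b + 2)) e0.
have [K hK] := itv_bounded (cw a b).
pose eta := Num.min 1 (dl / 2).
have eta0 : 0 < eta by rewrite lt_min ltr01 divr_gt0.
have eta1 : eta <= 1 by rewrite ge_min lexx.
have etad : 2 * eta <= dl by have : eta <= dl / 2; [rewrite ge_min lexx orbT|lra].
have M0 : 0 <= M by apply: le_trans (fM 0).
pose K1 := `|K| + e.
have K10 : 0 <= K1 by rewrite addr_ge0// ltW.
pose g0 := gap eta; have g00 : 0 < g0 by exact: gap_gt0.
have g01 : g0 <= 1 by exact: gap_le1.
pose C := 4 * K1 + (2 * M + K1) / g0 ^+ 2.
have D0 : 0 <= (2 * M + K1) / g0 ^+ 2.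
  by rewrite divr_ge0 ?sqr_ge0// addr_ge0// mulr_ge0.
have C4 : 4 * K1 <= C by rewrite lerDl.
have C5 : (2 * M + K1) / g0 ^+ 2 <= C by rewrite lerDr mulr_ge0.
have C0 : 0 <= C by apply: le_trans C5.
exists C => //.
move=> x y xab.
have cK : `|f'' x - e| <= K1.
  apply: le_trans (ler_normB _ _) _; rewrite /K1 (gtr0_norm e0) lerD2r.
  by apply: le_trans (hK x xab) _; exact: ler_norm.
set c := f'' x - e in cK *.
have /andP[c1 c2] : - K1 <= c <= K1 by rewrite -ler_norml.
have w0 := gap_ge0 y; have w1 := gap_le1 y.
have [ye|ye] := leP `|y| eta.
  have s20 : Num.sqrt 2 ^+ 2 = 2 :> R by rewrite sqr_sqrtr.
  have s21 : Num.sqrt 2 <= 2 :> R.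
    by rewrite -(@ler_pXn2r _ 2) ?nnegrE// s20 expr2; lra.
  have s2p : 0 <= Num.sqrt 2 :> R by [].
  have t0 : 0 <= Num.sqrt 2 * `|y| by rewrite mulr_ge0.
  have := @second_difference_ge x (Num.sqrt 2 * `|y|) c t0.
  have sE : f (x + Num.sqrt 2 * `|y|) + f (x - Num.sqrt 2 * `|y|) =
            f (x + Num.sqrt 2 * y) + f (x - Num.sqrt 2 * y).
    by have [y0|y0] := leP 0 y; [rewrite ger0_norm|rewrite ltr0_norm// mulrN opprK addrC].
  rewrite sE exprMn s20 real_normK ?num_real// => h.
  have {}h : c * (2 * y ^+ 2) <=
      f (x + Num.sqrt 2 * y) + f (x - Num.sqrt 2 * y) - 2 * f x.
    apply: h => z zx.
    have zx2 : `|z - x| <= 2 * eta by have := normr_ge0 y; nra.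
    have zab : z \in `[a - 2, b + 2].
      move: xab zx2; rewrite !in_itv/= ler_norml => /andP[xa xb] /andP[z1 z2].
      by apply/andP; split; lra.
    have xab2 : x \in `[a - 2, b + 2].
      by move: xab; rewrite !in_itv/= => /andP[xa xb]; apply/andP; split; lra.
    have := hdl z x zab xab2 (le_trans zx2 etad).
    by rewrite ler_norml /c; lra.
  have := sqr_sub_gap (le_trans ye eta1); rewrite ler_norml => /andP[g1 g2].
  have w20 := sqr_ge0 (gap y).
  have hc : c * gap y - 4 * K1 * gap y ^+ 2 <= c * y ^+ 2.
    have [cp|cn] := leP 0 c; nra.
  have : 4 * K1 * gap y ^+ 2 <= C * gap y ^+ 2 by rewrite ler_wpM2r.
  lra.
have gy : g0 <= gap y by apply: gap_ge => //; exact: ltW.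
have lhs : - (2 * M) <= (f (x + Num.sqrt 2 * y) + f (x - Num.sqrt 2 * y)) / 2 - f x.
  have := fM (x + Num.sqrt 2 * y); have := fM (x - Num.sqrt 2 * y); have := fM x.
  by rewrite !ler_norml; lra.
apply: le_trans lhs.
have : 2 * M + K1 <= C * gap y ^+ 2.
  apply: (@le_trans _ _ (C * g0 ^+ 2)).
    by rewrite -ler_pdivrMr// exprn_gt0.
  by rewrite ler_wpM2l// lerXn2r ?nnegrE// ltW.
have : c * gap y <= K1 by nra.
lra.
Qed.

End second_difference.

Section gaussian_step.
Context {R : realType}.

(** Multiplied by s = sqrt (1 + u), both inequalities become polynomial in s >= 1. *)
Lemma invsqrt_bounds (u : R) : 0 <= u ->
  1 - u / 2 <= (Num.sqrt (1 + u))^-1 <= 1 - u / 2 + 3 / 8 * u ^+ 2.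
Proof.
move=> u0; set s := Num.sqrt (1 + u).
have s2 : s ^+ 2 = 1 + u by rewrite sqr_sqrtr//; lra.
have s1 : 1 <= s by rewrite -[X in X <= _]sqrtr1 ler_sqrt; lra.
set i := s^-1; have is1 : i * s = 1 by rewrite mulVf// gt_eqF//; lra.
have i0 : 0 < i by rewrite invr_gt0; lra.
have uE : u = s ^+ 2 - 1 by rewrite s2; ring.
clearbody i s; rewrite {}uE; apply/andP; split.
  rewrite -(@ler_pM2r _ s) ?is1; last lra.
  by rewrite expr2; nra.
rewrite -(@ler_pM2r _ s) ?is1; last lra.
have -> : (1 - (s ^+ 2 - 1) / 2 + 3 / 8 * (s ^+ 2 - 1) ^+ 2) * s =
  1 + (s - 1) ^+ 3 * (3 * s ^+ 2 + 9 * s + 8) / 8 by field.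
have z0 : 0 <= (s - 1) ^+ 3 by rewrite exprn_ge0//; lra.
have h8 : 0 <= 3 * s ^+ 2 + 9 * s + 8 by rewrite expr2; nra.
by rewrite lerDl divr_ge0// mulr_ge0.
Qed.

Variables (f f' f'' : R -> R) (M : R).
Hypotheses (df : forall x : R, is_derive x 1 f (f' x))
  (df' : forall x : R, is_derive x 1 f' (f'' x))
  (cf'' : continuous f'') (fM : forall x, `|f x| <= M).

(** The law of y is symmetric, so [symmetrized_ge] can be integrated. The mean of [gap] is 1 - (1 +
    2h)^(-1/2) = h + O(h^2), and that of its square is 1 - 2 (1 + 2h)^(-1/2) + (1 + 4h)^(-1/2) =
    O(h^2). *)
Lemma gaussian_step (a b e : R) : 0 < e -> exists2 h0, 0 < h0 &
  forall h x, 0 < h < h0 -> x \in `[a, b] ->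
  f x + h * f'' x - h * e <=
  \int[normal_prob 0 (Num.sqrt h)]_y f (x + Num.sqrt 2 * y).
Proof.
move=> e0; have e20 : 0 < e / 2 by rewrite divr_gt0.
have [C C0 hC] := symmetrized_ge df df' cf'' fM a b e20.
have [K hK] := itv_bounded (continuous_subspaceT cf'' : {within `[a, b], continuous f''}).
pose K1 := `|K| + e / 2.
have K10 : 0 <= K1 by rewrite addr_ge0// ltW.
(* The quadratic errors below add up to at most (3/2 [K1] + 6 C) h^2 <= L h^2, which is under h e /
   2 for the chosen range of h. *)
pose L := 2 * K1 + 6 * C + 1.
have L0 : 0 < L by rewrite /L; lra.
exists (e / (2 * L)); first by rewrite divr_gt0// mulr_gt0.
move=> h x /andP[h0]; rewrite ltr_pdivlMr ?mulr_gt0// => hL xab.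
set s := Num.sqrt h; set N := normal_prob 0 s.
have s0 : s != 0 by rewrite gt_eqF// sqrtr_gt0.
have s2 : s ^+ 2 = h by rewrite sqr_sqrtr// ltW.
have cf : continuous f by move=> z; exact: is_derive1_continuous (df z).
have cl (k : R) : continuous (fun y : R => f (x + k * y)).
  move=> y; apply: (@continuous_comp _ _ _ (fun y => x + k * y) f); last exact: cf.
  apply: cvgD; first exact: cvg_cst.
  by apply: cvgM; [exact: cvg_cst|exact: cvg_id].
have ml (k : R) : measurable_fun setT (fun y : R => f (x + k * y)).
  exact: continuous_measurable_fun.
have il (k : R) : N.-integrable setT (EFin \o (fun y : R => f (x + k * y))).
  apply: (@bounded_integrable _ _ _ _ _ _ M); [exact: measurableT|exact: ml|].
  by move=> y _; exact: fM.
have ce (t : R) : continuous (fun y : R => expR (- t * y ^+ 2)).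
  move=> y; apply: (@continuous_comp _ _ _ (fun y : R => - t * y ^+ 2) (@expR R)); last first.
    exact: continuous_expR.
  by apply: cvgM; [exact: cvg_cst|exact: exprn_continuous].
have ie (t : R) : 0 <= t -> N.-integrable setT (EFin \o (fun y : R => expR (- t * y ^+ 2))).
  move=> t0; apply: (@bounded_integrable _ _ _ _ _ _ 1); [exact: measurableT| |].
    by apply: continuous_measurable_fun; exact: ce.
  move=> y _; rewrite ger0_norm ?expR_ge0// -[leRHS]expR0 ler_expR mulNr oppr_le0.
  by rewrite mulr_ge0// sqr_ge0.
have sym : \int[N]_y f (x - Num.sqrt 2 * y) = \int[N]_y f (x + Num.sqrt 2 * y).
  rewrite -(@Rintegral_normal_opp R s s0 (fun y => f (x + Num.sqrt 2 * y)) M) //.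
  by apply: eq_Rintegral => y _; rewrite mulrN.
have ip := il (Num.sqrt 2).
have im : N.-integrable setT (EFin \o (fun y => f (x - Num.sqrt 2 * y))).
  apply: eq_integrable (il (- Num.sqrt 2)); first exact: measurableT.
  by move=> y _; rewrite /= mulNr.
have isum := integrable_add measurableT ip im.
have symE : \int[N]_y f (x + Num.sqrt 2 * y) =
    \int[N]_y (2^-1 * (f (x + Num.sqrt 2 * y) + f (x - Num.sqrt 2 * y))).
  rewrite (RintegralZl 2^-1 measurableT isum) (RintegralD measurableT ip im) sym.
  by field.
set c := f'' x - e / 2.
have lowP y : f x + (c * gap y - C * gap y ^+ 2) =
    (f x + c - C) + ((2 * C - c) * expR (- 1 * y ^+ 2) + - C * expR (- 2 * y ^+ 2)).
  have -> : expR (- 2 * y ^+ 2) = expR (- 1 * y ^+ 2) ^+ 2.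
    by rewrite -expRM_natl; congr expR; ring.
  by rewrite /gap; ring.
have ie1 := integrable_scale (2 * C - c) measurableT (ie 1 ler01).
have ie2 := integrable_scale (- C) measurableT (ie 2 (ler0n _ 2)).
have ie3 := integrable_add measurableT ie1 ie2.
have ik := @integrable_const _ _ _ N setT (f x + c - C) measurableT.
have lowE : \int[N]_y (f x + (c * gap y - C * gap y ^+ 2)) =
   f x + c * (1 - (Num.sqrt (1 + 2 * h))^-1)
   - C * (1 - 2 * (Num.sqrt (1 + 2 * h))^-1 + (Num.sqrt (1 + 4 * h))^-1).
  under eq_Rintegral do rewrite lowP.
  rewrite (RintegralD measurableT ik ie3) (RintegralD measurableT ie1 ie2).
  rewrite (RintegralZl _ measurableT (ie 1 ler01)).
  rewrite (RintegralZl _ measurableT (ie 2 (ler0n _ 2))).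
  rewrite (RintegralT_cst N) !integral_gaussian_exp// s2.
  have -> : 2 * 1 * h = 2 * h by ring.
  have -> : 2 * 2 * h = 4 * h by ring.
  by ring.
have main : f x + c * (1 - (Num.sqrt (1 + 2 * h))^-1)
   - C * (1 - 2 * (Num.sqrt (1 + 2 * h))^-1 + (Num.sqrt (1 + 4 * h))^-1) <=
   \int[N]_y f (x + Num.sqrt 2 * y).
  rewrite -lowE symE; apply: le_Rintegral.
  - exact: measurableT.
  - apply: eq_integrable (integrable_add measurableT ik ie3); first exact: measurableT.
    by move=> y _; rewrite /= lowP.
  - exact: (integrable_scale _ measurableT isum).
  - by move=> y _; have := hC x y xab; rewrite -/c; lra.
apply: le_trans _ main.
have h2 : 0 <= 2 * h by lra.
have h4 : 0 <= 4 * h by lra.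
have := invsqrt_bounds h2; have := invsqrt_bounds h4.
set p := (Num.sqrt (1 + 2 * h))^-1; set q := (Num.sqrt (1 + 4 * h))^-1.
move=> /andP[q1 q2] /andP[p1 p2].
have cK : `|c| <= K1.
  apply: le_trans (ler_normB _ _) _; rewrite /K1 (gtr0_norm e20) lerD2r.
  by apply: le_trans (hK x xab) _; exact: ler_norm.
have /andP[c1 c2] : - K1 <= c <= K1 by rewrite -ler_norml.
have t1 : c * h - K1 * (3 / 2 * h ^+ 2) <= c * (1 - p).
  have : `|c * (1 - p - h)| <= K1 * (3 / 2 * h ^+ 2).
    rewrite normrM ler_pM// ler_norml; apply/andP; split; move: p1 p2; rewrite exprMn; lra.
  by rewrite ler_norml; lra.
have t2 : C * (1 - 2 * p + q) <= C * (6 * h ^+ 2).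
  rewrite ler_wpM2l//; move: q2 p1; rewrite exprMn; lra.
have : h * (h * (2 * L)) <= h * e by rewrite ler_wpM2l// ltW.
have hh : 0 <= h ^+ 2 by rewrite sqr_ge0.
have : 0 <= K1 * h ^+ 2 by rewrite mulr_ge0.
have : 0 <= C * h ^+ 2 by rewrite mulr_ge0.
by move: t1 t2 hh; rewrite /c /L; clear; lra.
Qed.

End gaussian_step.

(** * Paths and hitting times *)

Section path.
Context {R : realType} {T : Type}.
Implicit Types (X : R -> T -> R) (x g : R -> R).

Lemma continuous_path_itv x (a b : R) : continuous_path x -> 0 <= a ->
  {within `[a, b], continuous x}.
Proof.
move=> cx a0; apply: continuous_subspaceW cx => z /=.
by rewrite !in_itv/= andbT => /andP[+ _]; exact: le_trans.
Qed.

Lemma continuous_path_pos x (t : R) : continuous_path x -> 0 < t ->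
  {for t, continuous x}.
Proof.
move=> /subspace_continuousP cx t0.
have /= := cx t; rewrite in_itv/= andbT => /(_ (ltW t0)).
have -> // : within `[0, +oo[ (nbhs t) = nbhs t.
apply: within_interior; rewrite /interior/=.
have : nbhs t [set` `]0, +oo[].
  by apply: open_nbhs_nbhs; split; [exact: interval_open|rewrite /= in_itv/= t0].
by apply: filterS => z /=; rewrite !in_itv/= !andbT; exact: ltW.
Qed.

Lemma rat_dense_le g (a b c : R) : a < b -> {within `[a, b], continuous g} ->
  (forall q : rat, a <= ratr q <= b -> g (ratr q) <= c) ->
  forall s, a <= s <= b -> g s <= c.
Proof.
move=> ab cg gc s /andP[sa sb]; rewrite leNgt; apply/negP => gs.
pose e := (g s - c) / 2; have e0 : 0 < e by rewrite divr_gt0// subr_gt0.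
have [dl dl0 h] := itv_uniform_continuity cg e0.
have : Num.max a (s - dl) < Num.min b (s + dl).
  by rewrite lt_min !gt_max ab; apply/andP; split; [|apply/andP; split]; lra.
move=> /rat_in_itvoo[q]; rewrite in_itv/= lt_min gt_max.
move=> /andP[/andP[q1 q2] /andP[q3 q4]].
have qab : a <= ratr q <= b by rewrite !ltW.
have := h s (ratr q); rewrite !in_itv/= sa sb qab => /(_ isT isT).
have -> : `|s - ratr q| <= dl by rewrite ler_norml; apply/andP; split; lra.
move=> /(_ isT); have := gc q qab; rewrite ler_norml /e; lra.
Qed.

(** The inequality is strict because continuity at t keeps the path below pi on a further interval
    of length [eta]. *)
Lemma hitting_time_gt X (w : T) (t : R) : continuous_path (X ^~ w) -> 0 <= t ->
  (forall s, 0 <= s <= t -> X s w < pi) -> (t%:E < hitting_time X pi w)%E.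
Proof.
move=> /subspace_continuousP cx t0 Xt.
have : \forall z \near within `[0, +oo[ (nbhs t), X z w < pi.
  apply: (@cvgr_lt _ _ _ _ _ (X t w)); last by apply: Xt; rewrite t0/=.
  by apply: cx; rewrite /= in_itv/= t0.
rewrite near_withinE => /nbhs_ballP[eta /= eta0 h].
apply: (@lt_le_trans _ _ (t + eta)%:E); first by rewrite lte_fin ltrDl.
apply/ereal_infP => _ /= [s [s0 Xs] <-]; rewrite lee_fin leNgt; apply/negP => st.
have [ts|ts] := leP s t.
  by have := Xt s; rewrite s0 ts Xs ltxx => /(_ isT).
have := h s; rewrite /ball/= in_itv/= s0 Xs ltxx => h'.
have : false by apply: h' => //; rewrite ltr0_norm; lra.
by [].
Qed.

Lemma hitting_time_le X (w : T) (s t : R) : 0 <= s <= t -> X s w = pi ->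
  (hitting_time X pi w <= t%:E)%E.
Proof.
move=> /andP[s0 st] Xs; apply: (@le_trans _ _ s%:E); last by rewrite lee_fin.
by apply: ereal_inf_lbound; exists s.
Qed.

End path.

Section path_step.
Context {R : realType} {T : Type}.
Variables (f f' f'' b : R -> R) (lam e Mb rho : R).
Hypotheses (df : forall x : R, is_derive x 1 f (f' x))
  (b0 : forall x, 0 < x < pi -> 0 <= b x)
  (cb : forall x, 0 < x < pi -> {for x, continuous b})
  (Mb0 : 0 <= Mb)
  (gen : forall x, 0 < x < pi -> lam <= f'' x + Num.min (b x) Mb * f' x)
  (cap : forall x y, 0 < x < pi -> `|y - x| <= 3 * rho -> Mb < b x -> 0 <= f' y)
  (osc' : forall x y, 0 <= x <= pi -> `|y - x| <= 3 * rho ->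
     Mb * `|f' y - f' x| <= e)
  (osc'' : forall x y, 0 <= x <= pi -> 0 <= y <= pi -> `|y - x| <= rho ->
     `|f'' y - f'' x| <= e).

(* The drift is unbounded near 0 and pi: gen truncates it at Mb, and where it
   exceeds Mb the sign of f' makes the excess harmless. *)
Lemma generator_step (x y z : R) : 0 < x < pi -> 0 <= z <= pi ->
  `|y - x| <= 3 * rho -> `|x - z| <= rho ->
  lam - f'' z - 2 * e <= f' y * b x.
Proof.
move=> xpi zpi yx xz.
have xpi' : 0 <= x <= pi by case/andP: xpi => ? ?; rewrite !ltW.
have := osc' xpi' yx; have := osc'' zpi xpi' xz.
have := gen xpi; have := b0 xpi; have := @cap x y xpi yx.
set B := b x; set D := f' y - f' x => hcap B0 hgen; rewrite ler_norml => /andP[h1 h2] h3.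
have -> : f' y = f' x + D by rewrite /D; ring.
have [BM|BM] := leP B Mb.
  rewrite min_l// in hgen.
  have : `|B * D| <= e.
    by rewrite normrM ger0_norm//; apply: le_trans h3; rewrite ler_wpM2r.
  by rewrite ler_norml => /andP[h4 h5]; lra.
rewrite min_r ?(ltW BM)// in hgen.
have h : `|Mb * D| <= e by rewrite normrM ger0_norm.
move: h; rewrite ler_norml => /andP[h4 h5].
have := hcap BM; have -> : f' y = f' x + D by rewrite /D; ring.
by move=> h6; nra.
Qed.

Variables (x beta : R -> R).
Hypotheses (cx : continuous_path x) (cbeta : continuous_path beta).
Variables (a c : R).
Hypotheses (a0 : 0 <= a) (ac : a < c)
  (range : forall s, 0 < s <= c -> 0 < x s < pi)
  (xa : 0 <= x a <= pi)
  (eqn : forall s, 0 <= s <= c ->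
    lebesgue_measure.-integrable `[0, s] (fun u => (b (x u))%:E) /\
    x s = Num.sqrt 2 * beta s + \int[lebesgue_measure]_(u in `[0, s]) b (x u))
  (goodx : forall s, a <= s <= c -> `|x s - x a| <= rho)
  (goodb : forall s, a <= s <= c -> `|beta s - beta a| <= rho).

(** The curve [g] starts at x a plus the whole noise increment of the step and then moves by the
    drift alone, ending at x c. Unlike x it is differentiable inside the step, with derivative b (x
    u), so the mean value theorem applies to f along [g]. Only interior derivatives enter, hence x a
    = 0 is allowed. *)
Lemma path_step :
  (c - a) * (lam - f'' (x a) - 2 * e) <=
  f (x c) - f (x a + Num.sqrt 2 * (beta c - beta a)).
Proof.
pose q2 : R := Num.sqrt 2.
have q20 : 0 <= q2 by exact: sqrtr_ge0.
(* Since |beta c - beta u| <= 2 rho, this bound puts g u within 3 rho of x u. *)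
have q21 : q2 <= 3 / 2.
  rewrite -(@ler_pXn2r _ 2) ?nnegrE// sqr_sqrtr// expr_div_n -!natrX.
  by rewrite ler_pdivlMr// -natrM ler_nat.
pose A u : R := \int[lebesgue_measure]_(v in `[0, u]) b (x v).
have AE u : 0 <= u <= c -> A u = x u - q2 * beta u.
  by move=> /eqn[_ ->]; rewrite addrAC subrr add0r.
pose g u := x a + q2 * (beta c - beta a) + (A u - A a).
have aI : 0 <= a <= c by rewrite a0 ltW.
have cI : 0 <= c <= c by rewrite (le_trans a0 (ltW ac)) lexx.
have gE u : 0 <= u <= c -> g u = x u + q2 * (beta c - beta u).
  by move=> uc; rewrite /g !AE//; ring.
have dg u : a < u < c -> is_derive u 1 g (b (x u)).
  move=> /andP[au uc].
  have u0 : 0 < u by exact: le_lt_trans au.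
  have [||dA A'] := @continuous_FTC1_closed R (fun v => b (x v)) 0 u c uc _ u0.
  - by have [] := eqn cI.
  - apply: (@continuous_comp _ _ _ x b); first exact: continuous_path_pos.
    by apply: cb; apply: range; rewrite u0 ltW.
  have dA1 : is_derive u 1 A (b (x u)).
    by apply: DeriveDef; [exact: dA|rewrite -derive1E A'].
  have := is_derive1D (is_derive1_cst (x a + q2 * (beta c - beta a) - A a) u) dA1.
  rewrite add0r; congr (is_derive _ _ _ _).
  by apply/funext => v; rewrite /g; ring.
have cf : continuous f by move=> z; exact: is_derive1_continuous (df z).
pose G u := f (g u).
have dG u : u \in `]a, c[ -> is_derive u 1 G (f' (g u) * b (x u)).
  by rewrite in_itv/= => /dg h; exact: (@is_derive1_comp _ f g u).
have cG : {within `[a, c], continuous G}.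
  have cg : {within `[a, c], continuous (fun u => x u + q2 * (beta c - beta u))}.
    apply: within_continuousD; first exact: continuous_path_itv.
    apply: within_continuousM; first exact: within_continuous_cst.
    apply: within_continuousB; first exact: within_continuous_cst.
    exact: continuous_path_itv.
  have : {within `[a, c], continuous (fun u => f (x u + q2 * (beta c - beta u)))}.
    by move=> v; apply: continuous_comp; [exact: cg|exact: cf].
  apply: subspace_eq_continuous => v; rewrite inE/= in_itv/= => /andP[av vc].
  by rewrite /from_subspace /G gE// (le_trans a0 av).
have [u uac] := MVT ac dG cG.
have -> : G c = f (x c) by rewrite /G gE// subrr mulr0 addr0.
have -> : G a = f (x a + q2 * (beta c - beta a)) by rewrite /G /g subrr addr0.
rewrite -/q2 => ->; rewrite mulrC ler_wpM2r ?subr_ge0 ?(ltW ac)//.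
move: uac; rewrite in_itv/= => /andP[au uc].
have u0 : 0 < u by exact: le_lt_trans au.
have uI : a <= u <= c by rewrite !ltW.
apply: generator_step => //.
- by apply: range; rewrite u0 ltW.
- rewrite gE ?(ltW u0) ?(ltW uc)// addrAC subrr add0r normrM (ger0_norm q20).
  have h1 := goodb uI; have cI' : a <= c <= c by rewrite ltW/=.
  have h2 := goodb cI'.
  have : `|beta c - beta u| <= 2 * rho.
    have -> : beta c - beta u = (beta c - beta a) - (beta u - beta a) by ring.
    by apply: le_trans (ler_normB _ _) _; lra.
  by have := normr_ge0 (beta c - beta u); nra.
- exact: goodx.
Qed.

End path_step.

Lemma positive_near (R : realType) (g : R -> R) (z : R) : {for z, continuous g} -> 0 < g z ->
  exists2 eta, 0 < eta & forall y, `|y - z| <= eta -> g z / 2 <= g y.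
Proof.
move=> /cvgrPdist_le cg gz.
have [eta /= eta0 h] := cg (g z / 2) (divr_gt0 gz (ltr0n _ 2)).
exists (eta / 2); first by rewrite divr_gt0.
move=> y yz; have := h y; rewrite /= distrC => /(_ _).
have -> : `|y - z| < eta by lra.
by move=> /(_ isT); rewrite ler_norml; lra.
Qed.

(** Near both ends f' is at least some m > 0, and on the remaining compact interval b is bounded; so
    for large [Mb] the drift exceeds [Mb] only where f' >= m. The radius [rho] is chosen after [Mb],
    because the modulus required of f' depends on [Mb]. *)
Lemma local_parameters (R : realType) (f f' f'' b : R -> R) (lam : R)
  (df : forall x : R, is_derive x 1 f (f' x))
  (df' : forall x : R, is_derive x 1 f' (f'' x)) (cf'' : continuous f'')
  (cb : forall x, 0 < x < pi -> {for x, continuous b})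
  (f'0 : 0 < f' 0) (f'pi : 0 < f' pi)
  (gen : forall x, 0 < x < pi -> lam <= f'' x + b x * f' x) (e : R) :
  0 < e -> exists Mb rho,
  [/\ 0 <= Mb, 0 < rho <= 1,
   forall x, 0 < x < pi -> lam <= f'' x + Num.min (b x) Mb * f' x,
   forall x y, 0 < x < pi -> `|y - x| <= 3 * rho -> Mb < b x -> 0 <= f' y &
   [/\ forall x y, 0 <= x <= pi -> `|y - x| <= 3 * rho -> Mb * `|f' y - f' x| <= e,
    forall x y, 0 <= x <= pi -> 0 <= y <= pi -> `|y - x| <= rho -> `|f'' y - f'' x| <= e &
    forall y, `|y - pi| <= 6 * rho -> `|f y - f pi| <= e]].
Proof.
move=> e0.
have p0 := pi_gt0 R.
have cf : continuous f by move=> z; exact: is_derive1_continuous (df z).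
have cf' : continuous f' by move=> z; exact: is_derive1_continuous (df' z).
have [eta1 eta10 h1] := positive_near (@cf' 0) f'0.
have [eta2 eta20 h2] := positive_near (@cf' pi) f'pi.
pose eta := Num.min (Num.min eta1 eta2) (Num.min 1 (pi / 2)) / 2.
have : 0 < Num.min (Num.min eta1 eta2) (Num.min 1 (pi / 2)).
  by rewrite !lt_min eta10 eta20 ltr01 divr_gt0.
set mm := Num.min _ _ in eta * => mm0.
have m1 : mm <= eta1 by rewrite /mm !ge_min lexx.
have m2 : mm <= eta2 by rewrite /mm !ge_min lexx orbT.
have m3 : mm <= 1 by rewrite /mm !ge_min lexx !orbT.
have m4 : mm <= pi / 2 by rewrite /mm !ge_min lexx !orbT.
have eta0 : 0 < eta by rewrite divr_gt0.
have etaE : mm = 2 * eta by rewrite /eta mulrC divfK.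
clearbody mm eta; rewrite {}etaE in m1 m2 m3 m4 *.
pose m := Num.min (f' 0 / 2) (f' pi / 2).
have m0 : 0 < m by rewrite lt_min !divr_gt0.
have near_end y : `|y - 0| <= 2 * eta \/ `|y - pi| <= 2 * eta -> m <= f' y.
  case=> hy; [have := h1 y (le_trans hy m1)|have := h2 y (le_trans hy m2)];
    by apply: le_trans; rewrite ge_min lexx ?orbT.
have [M0 hM0] : exists M, forall x, x \in `[eta, pi - eta] -> `|b x| <= M.
  apply: itv_bounded => x.
  apply: continuous_in_subspaceT x => x; rewrite inE/= in_itv/= => /andP[x1 x2].
  by apply: cb; apply/andP; split; lra.
have [K hK] := itv_bounded (continuous_subspaceT cf'' : {within `[0, pi], continuous f''}).
have K0 : 0 <= K by apply: le_trans (hK 0 _); rewrite // in_itv/= lexx ltW.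
(* The second entry preserves the generator inequality under truncation: f'' + [Mb] f' >= -K + (K +
   |lam|) >= lam where f' >= m. *)
pose Mb := Num.max `|M0| ((K + `|lam|) / m).
have Mb0 : 0 <= Mb by rewrite le_max normr_ge0.
have Mb1 : K + `|lam| <= Mb * m by rewrite -ler_pdivrMr// le_max lexx orbT.
have end_point x : 0 < x < pi -> Mb < b x -> `|x - 0| <= eta \/ `|x - pi| <= eta.
  move=> /andP[x0 xp] bx.
  have [xe|xe] := leP x eta; first by left; rewrite subr0 gtr0_norm.
  have [xe'|xe'] := leP (pi - eta) x; first by right; clear -xe' xp; rewrite ltr0_norm; lra.
  have : `|b x| <= M0 by apply: hM0; rewrite in_itv/= !ltW.
  have : M0 <= Mb by apply: le_trans (ler_norm _) _; rewrite le_max lexx.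
  by have := ler_norm (b x); lra.
have [d1 d10 hd1] := itv_uniform_continuity
  (continuous_subspaceT cf' : {within `[-3, pi + 3], continuous f'})
  (divr_gt0 e0 (ltr_pwDr ltr01 Mb0)).
have [d2 d20 hd2] := itv_uniform_continuity
  (continuous_subspaceT cf'' : {within `[0, pi], continuous f''}) e0.
have [d3 d30 hd3] := itv_uniform_continuity
  (continuous_subspaceT cf : {within `[0, pi + 6], continuous f}) e0.
pose rho := Num.min (Num.min (eta / 6) (d1 / 3)) (Num.min d2 (d3 / 6)).
have rho0 : 0 < rho by rewrite !lt_min d20 !divr_gt0.
have r1 : rho <= eta / 6 by rewrite !ge_min lexx.
have r2 : rho <= d1 / 3 by rewrite !ge_min lexx orbT.
have r3 : rho <= d2 by rewrite !ge_min lexx !orbT.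
have r4 : rho <= d3 / 6 by rewrite !ge_min lexx !orbT.
clearbody rho.
exists Mb, rho; split => //.
- by rewrite rho0; clear -r1 m3 eta0; lra.
- move=> x xpi; have [bM|bM] := leP (b x) Mb; first exact: gen.
  have : m <= f' x by apply: near_end; case: (end_point x xpi bM) => h;
      [left|right]; apply: le_trans h _; clear -eta0; lra.
  have /andP[x0 xp] := xpi.
  have : `|f'' x| <= K by apply: hK; rewrite in_itv/= !ltW.
  by rewrite ler_norml; have := ler_norm lam; nra.
- move=> x y xpi yx bM; apply: (le_trans (ltW m0)); apply: near_end.
  have yz (z : R) : `|y - z| <= `|y - x| + `|x - z|.
    have -> : y - z = (y - x) + (x - z) by ring.
    exact: ler_normD.
  by case: (end_point x xpi bM) => h; [left; have := yz 0|right; have := yz pi];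
    clear -h yx r1 eta0; lra.
split.
- move=> x y /andP[x0 xp] yx.
  have /andP[yx1 yx2] : - (3 * rho) <= y - x <= 3 * rho by rewrite -ler_norml.
  have := hd1 y x; rewrite !in_itv/= => /(_ _ _ _).
  have rho1 : rho <= 1 by clear -r1 m3 eta0; lra.
  have -> : -3 <= y <= pi + 3 by clear -yx1 yx2 x0 xp rho1; lra.
  have -> : -3 <= x <= pi + 3 by clear -x0 xp; lra.
  have -> : `|y - x| <= d1 by clear -yx r2; lra.
  move=> /(_ isT isT isT); rewrite ler_pdivlMr ?ltr_pwDr//.
  by have := normr_ge0 (f' y - f' x); nra.
- by move=> x y xpi ypi yx; apply: hd2 => //; exact: le_trans r3.
- move=> y yp.
  have /andP[y1 y2] : - (6 * rho) <= y - pi <= 6 * rho by rewrite -ler_norml.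
  have rho1 : 6 * rho <= pi by clear -r1 m4 eta0; lra.
  have rho2 : 6 * rho <= 6 by clear -r1 m3 eta0; lra.
  apply: hd3; rewrite ?in_itv/=; [|by rewrite ltW//= lerDl|by clear -yp r4; lra].
  by clear -y1 y2 rho1 rho2; lra.
Qed.

(** * Adapted events and independent increments *)

Section filtration_facts.
Context {R : realType} d {T : measurableType d} (F : R -> set (set T)).
Hypothesis fF : filtration F.
Variable t : R.
Hypothesis t0 : 0 <= t.

Lemma filtrationC (A : set T) : F t A -> F t (~` A).
Proof. by have [_ h _] := filtration_sigma fF t0; move=> /h; rewrite setTD. Qed.

Lemma filtration_bigcup (A : (set T)^nat) : (forall n, F t (A n)) -> F t (\bigcup_n A n).
Proof. by have [_ _ h] := filtration_sigma fF t0; exact: h. Qed.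

Lemma filtration_set0 : F t set0.
Proof. by have [h _ _] := filtration_sigma fF t0. Qed.

Lemma filtration_setT : F t setT.
Proof. by rewrite -setC0; apply: filtrationC; exact: filtration_set0. Qed.

Lemma filtrationU (A B : set T) : F t A -> F t B -> F t (A `|` B).
Proof.
move=> FA FB; rewrite -bigcup2E; apply: filtration_bigcup => -[|[|n]] //=.
exact: filtration_set0.
Qed.

Lemma filtrationI (A B : set T) : F t A -> F t B -> F t (A `&` B).
Proof.
move=> FA FB; rewrite -[A]setCK -[B]setCK -setCU; apply: filtrationC.
by apply: filtrationU; exact: filtrationC.
Qed.

Lemma filtration_bigcap (A : (set T)^nat) : (forall n, F t (A n)) -> F t (\bigcap_n A n).
Proof.
move=> FA; rewrite -[X in F t X]setCK setC_bigcap; apply: filtrationC.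
by apply: filtration_bigcup => n; exact: filtrationC.
Qed.

Lemma filtration_forall (J : countType) (A : J -> set T) : (forall i, F t (A i)) ->
  F t [set w | forall i, A i w].
Proof.
move=> FA; have -> : [set w | forall i, A i w] =
    \bigcap_n (if unpickle n is Some i then A i else setT).
  apply/seteqP; split => [w h n _|w h i]; first by case: (unpickle n).
  by have := h (pickle i) I; rewrite pickleK.
by apply: filtration_bigcap => n; case: (unpickle n) => [i|] //; exact: filtration_setT.
Qed.

Lemma filtration_imply (Q : Prop) (A : set T) : (Q -> F t A) -> F t [set w | Q -> A w].
Proof.
move=> FA; have [q|nq] := pselect Q.
  have -> // : [set w | Q -> A w] = A.
  by apply/seteqP; split => w /= h; [exact: h|move=> _].
  exact: FA.
have -> : [set w | Q -> A w] = setT by apply/seteqP; split => w //= _ /nq.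
exact: filtration_setT.
Qed.

End filtration_facts.

Section independence.
Context {R : realType} d {T : measurableType d} (P : probability T R).
Variables (F : R -> set (set T)) (B : R -> T -> R).
Hypotheses (fF : filtration F) (bB : brownian_motion P F B).

Lemma adapted_measurable (X : R -> T -> R) (t : R) : adapted F X -> 0 <= t ->
  measurable_fun setT (X t).
Proof.
move=> aX t0 _ U mU; rewrite setTI.
by apply: (filtration_measurable fF t0); exact: aX.
Qed.

Variables (s h : R) (xi : T -> R).
Hypotheses (s0 : 0 <= s) (h0 : 0 < h)
  (Fxi : forall U : set R, measurable U -> F s (xi @^-1` U)).
Let Y w := B (s + h) w - B s w.
Local Notation N := (normal_prob 0 (Num.sqrt h)).

(** On rectangles [bm_indep] and [bm_gauss] give the product of the law of xi with N, so by
    uniqueness the pair has this product law; Tonelli's theorem concludes. *)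
Lemma increment_expectation (G : R * R -> \bar R) :
  measurable_fun setT G -> (forall z, 0 <= G z)%E ->
  (\int[P]_w G (xi w, Y w) = \int[P]_w \int[N]_y G (xi w, y))%E.
Proof.
move=> mG G0.
have sh0 : 0 <= s + h by rewrite addr_ge0// ltW.
have mY : measurable_fun setT Y.
  by apply: measurable_funB; apply: adapted_measurable => //; exact: bm_adapted bB.
have mxi : measurable_fun setT xi.
  by move=> _ U mU; rewrite setTI; apply: (filtration_measurable fF s0); exact: Fxi.
have mphi : measurable_fun setT (fun w => (xi w, Y w)) by exact: measurable_fun_pair.
pose xi' : {mfun T >-> measurableTypeR R} :=
  HB.pack xi (isMeasurableFun.Build _ _ T (measurableTypeR R) xi mxi).
pose phi : {mfun T >-> (measurableTypeR R * measurableTypeR R)%type} :=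
  HB.pack (fun w => (xi w, Y w)) (isMeasurableFun.Build _ _ T
    (measurableTypeR R * measurableTypeR R)%type (fun w => (xi w, Y w)) mphi).
pose mu1 := distribution P xi'; pose mu := distribution P phi.
have prodE : forall C, measurable C -> (mu1 \x N)%E C = mu C.
  apply: product_measure_unique => U V mU mV.
  rewrite /mu /mu1 /distribution /pushforward /=.
  have sh : s < s + h by rewrite ltrDl.
  apply: etrans (bm_indep bB s0 sh (Fxi mU) mV) _.
  rewrite (bm_gauss bB s0 sh mV).
  by have -> : s + h - s = h by ring.
transitivity (\int[mu]_z G z)%E.
  by rewrite ge0_integral_distribution.
transitivity (\int[mu1 \x N]_z G z)%E.
  by apply: eq_measure_integral => C mC _; exact: (esym (prodE C mC)).
rewrite fubini_tonelli1//.
rewrite ge0_integral_distribution//.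
  exact: measurable_fun_fubini_tonelli_F.
by move=> x; exact: integral_ge0.
Qed.

End independence.

Section increment_lower.
Context {R : realType} d {T : measurableType d} (P : probability T R).
Variables (F : R -> set (set T)) (B : R -> T -> R).
Hypotheses (fF : filtration F) (bB : brownian_motion P F B).
Variables (s h : R) (xi : T -> R).
Hypotheses (s0 : 0 <= s) (h0 : 0 < h)
  (Fxi : forall U : set R, measurable U -> F s (xi @^-1` U)).
Let Y w := B (s + h) w - B s w.
Local Notation N := (normal_prob 0 (Num.sqrt h)).

Lemma increment_lower (f l : R -> R) (M : R) (A : set T) :
  continuous f -> (forall x, `|f x| <= M) -> measurable_fun setT l ->
  (forall x, 0 <= x <= pi -> `|l x| <= M) ->
  (forall x, 0 <= x <= pi -> l x <= \int[N]_y f (x + Num.sqrt 2 * y)) ->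
  F s A -> (forall w, A w -> 0 <= xi w <= pi) ->
  \int[P]_(w in A) l (xi w) <= \int[P]_(w in A) f (xi w + Num.sqrt 2 * Y w).
Proof.
move=> cf fM ml lM lN FA xiA.
have mA : measurable A by exact: (filtration_measurable fF s0).
have sh0 : 0 <= s + h by rewrite addr_ge0// ltW.
have mY : measurable_fun setT Y.
  by apply: measurable_funB; apply: (adapted_measurable fF) => //; exact: bm_adapted bB.
have mxi : measurable_fun setT xi.
  by move=> _ U mU; rewrite setTI; apply: (filtration_measurable fF s0); exact: Fxi.
have mf : measurable_fun setT f by exact: continuous_measurable_fun.
pose Z w := xi w + Num.sqrt 2 * Y w.
have mZ : measurable_fun setT Z.
  by apply: measurable_funD => //; apply: measurable_funM.
have ilA : P.-integrable A (EFin \o (fun w => l (xi w))).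
  apply: (@bounded_integrable _ _ _ _ _ _ M) => //.
    by apply: measurable_funTS; exact: measurableT_comp.
  by move=> w Aw; exact: lM (xiA w Aw).
have ifA : P.-integrable A (EFin \o (fun w => f (Z w))).
  apply: (@bounded_integrable _ _ _ _ _ _ M) => //.
  by apply: measurable_funTS; exact: measurableT_comp.
have iMA : P.-integrable A (EFin \o (fun _ : T => M)) by exact: integrable_const.
(* The shift by M makes the integrands nonnegative, as [increment_expectation] requires. *)
suff : \int[P]_(w in A) (l (xi w) + M) <= \int[P]_(w in A) (f (Z w) + M).
  by rewrite (RintegralD mA ilA iMA) (RintegralD mA ifA iMA) lerD2r.
(* The event A is encoded in the sign of [xi'], since xi >= 0 on A. The integral over A thereby
   becomes the expectation of a function of ([xi'], Y) alone. *)
pose xi' w := if w \in A then xi w else -1.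
have Fxi' (U : set R) : measurable U -> F s (xi' @^-1` U).
  move=> mU.
  have -> : xi' @^-1` U = (A `&` xi @^-1` U) `|` (~` A `&` [set _ | U (-1)]).
    apply/seteqP; split => w; rewrite /xi' /=; have [Aw|Aw] := pselect (A w);
      rewrite ?(mem_set Aw) ?(memNset Aw).
    - by left.
    - by right.
    - by move=> [[]|[]].
    - by move=> [[]|[]].
  apply: filtrationU => //; first by apply: filtrationI => //; exact: Fxi.
  apply: filtrationI => //; first exact: filtrationC.
  have [h1|h1] := pselect (U (-1)).
    rewrite (_ : [set _ | _] = setT); first exact: filtration_setT.
    by apply/seteqP; split.
  rewrite (_ : [set _ | _] = set0); first exact: filtration_set0.
  by apply/seteqP; split.
pose G (z : R * R) : \bar R :=
  ((f (z.1 + Num.sqrt 2 * z.2) + M) * \1_(`[0, +oo[%classic) z.1)%:E.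
have fM0 x : 0 <= f x + M by have := fM x; rewrite ler_norml; lra.
have mG : measurable_fun setT G.
  apply/measurable_EFinP; apply: measurable_funM.
    apply: measurable_funD => //; apply: measurableT_comp => //.
    apply: measurable_funD => //.
    by apply: measurable_funM => //.
  by apply: measurableT_comp => //; exact: measurable_indic.
have GA (w : T) (y : R) : G (xi' w, y) =
    if w \in A then (f (xi w + Num.sqrt 2 * y) + M)%:E else 0%E.
  rewrite /G /xi' /=; case: ifPn => [|_].
    rewrite inE => /xiA/andP[x0 _].
    by rewrite indicE mem_set ?mulr1//= in_itv/= x0.
  rewrite indicE memNset ?mulr0//= in_itv/= andbT.
  by apply/negP; rewrite -ltNge; lra.
have G0 z : (0 <= G z)%E by rewrite lee_fin mulr_ge0.
have key := increment_expectation fF bB s0 h0 Fxi' mG G0.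
have leftE : (\int[P]_w G (xi' w, Y w) = \int[P]_(w in A) (f (Z w) + M)%:E)%E.
  by rewrite [RHS]integral_mkcond; apply: eq_integral => w _; rewrite GA patchE.
have inner x : 0 <= x <= pi ->
    ((l x + M)%:E <= \int[N]_y (f (x + Num.sqrt 2 * y) + M)%:E)%E.
  move=> x0p.
  have mfx : measurable_fun setT (fun y : R => f (x + Num.sqrt 2 * y)).
    by apply: measurableT_comp => //; apply: measurable_funD => //; exact: measurable_funM.
  have ifx : N.-integrable setT (EFin \o (fun y => f (x + Num.sqrt 2 * y))).
    apply: (@bounded_integrable _ _ _ _ _ _ M); [exact: measurableT|exact: mfx|].
    by move=> y _; exact: fM.
  have iM := @integrable_const _ _ _ N setT M measurableT.
  rewrite -(fineK (integrable_fin_num measurableT (integrable_add measurableT ifx iM))).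
  rewrite lee_fin -/(Rintegral N setT (fun y => f (x + Num.sqrt 2 * y) + M)).
  rewrite (RintegralD measurableT ifx iM) (RintegralT_cst N) lerD2r.
  exact: lN.
rewrite /Rintegral fine_le//.
- by apply: integrable_fin_num => //; exact: (integrable_add mA ilA iMA).
- by apply: integrable_fin_num => //; exact: (integrable_add mA ifA iMA).
rewrite -leftE key [leLHS]integral_mkcond; apply: ge0_le_integral => //.
- move=> w _; rewrite patchE; case: ifPn => //; rewrite inE => /xiA/lM.
  by rewrite lee_fin ler_norml; lra.
- apply/(measurable_restrictT _ mA).1.
  exact: (measurable_int _ (integrable_add mA ilA iMA)).
- have mxi' : measurable_fun setT xi'.
    by move=> _ U mU; rewrite setTI; apply: (filtration_measurable fF s0); exact: Fxi'.
  apply: (@measurableT_comp _ _ _ _ _ _ (fun x => \int[N]_y G (x, y))%E) => //.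
  exact: measurable_fun_fubini_tonelli_F.
- move=> w _; rewrite patchE; case: ifPn => [|wA].
    rewrite inE => Aw; apply: le_trans (inner _ (xiA w Aw)) _.
    rewrite le_eqVlt; apply/orP; left; apply/eqP.
    by apply: eq_integral => y _; rewrite GA mem_set.
  by apply: integral_ge0 => y _.
Qed.

End increment_lower.

(** * The path on a time grid *)

Section grid.
Context {R : realType} {T : Type}.
Variables (X B : R -> T -> R) (rho h : R).

(* Rational times make these events measurable; continuity of the paths recovers
   all times. In below, the margin 1 / (m + 1) turns the path being < pi on
   [0, c] into a countable condition. *)
Definition steady (a c : R) : set T :=
  [set w | forall q : rat, a <= (ratr q : R) <= c ->
     `|X (ratr q) w - X a w| <= rho /\ `|B (ratr q) w - B a w| <= rho].

Definition below (c : R) : set T :=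
  [set w | 0 <= X c w <= pi /\
     exists m : nat, forall q : rat, 0 <= (ratr q : R) <= c ->
       X (ratr q) w <= pi - m.+1%:R^-1].

Definition grid (k : nat) : R := k%:R * h.

(** [alive k] depends on the past of [grid k] only, so the next increment can be averaged over it.
    The range condition is built in so that [alive_range] holds at every outcome and not just almost
    surely. *)
Fixpoint alive (k : nat) : set T :=
  if k is k'.+1 then
    alive k' `&` (steady (grid k') (grid k'.+1) `&` below (grid k'.+1))
  else [set w | 0 <= X 0 w <= pi].

Lemma gridS k : grid k.+1 = grid k + h.
Proof. by rewrite /grid -natr1 mulrDl mul1r. Qed.

Lemma alive_range k w : alive k w -> 0 <= X (grid k) w <= pi.
Proof. by case: k => [|k]; [rewrite /grid mul0r|case=> _ [_ []]]. Qed.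

End grid.

Record regular_path (R : realType) (T : Type) (n : nat) (X B : R -> T -> R) (w : T)
  : Prop := RegularPath {
  rp_contX : continuous_path (X ^~ w) ;
  rp_contB : continuous_path (B ^~ w) ;
  rp_start : X 0 w = 0 ;
  rp_range : forall t : R, 0 < t -> (t%:E < hitting_time X pi w)%E -> 0 < X t w < pi ;
  rp_equation : forall t : R, 0 <= t -> (t%:E < hitting_time X pi w)%E ->
    lebesgue_measure.-integrable `[0, t] (fun s => (drift n (X s w))%:E) /\
    X t w = Num.sqrt 2 * B t w
            + \int[lebesgue_measure]_(s in `[0, t]) drift n (X s w) }.

Section regular_path_facts.
Context {R : realType} {T : Type}.
Variables (n : nat) (X B : R -> T -> R) (rho h : R) (w : T).
Hypotheses (n0 : (0 < n)%N) (h0 : 0 < h) (rw : regular_path n X B w).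
Local Notation grid := (grid h).
Local Notation alive := (alive X B rho h).
Local Notation tau := (hitting_time X pi w).

Lemma below_lt_pi (c s : R) : 0 < c -> below X c w -> 0 <= s <= c -> X s w < pi.
Proof.
move=> c0 [_ [m hm]] sc.
have := rat_dense_le c0 (continuous_path_itv (rp_contX rw) (lexx 0)) hm sc.
by move=> /le_lt_trans; apply; rewrite ltrBlDr ltrDl.
Qed.

Lemma below_hitting (c : R) : 0 < c -> below X c w -> (c%:E < tau)%E.
Proof.
move=> c0 bc; apply: hitting_time_gt; [exact: rp_contX rw|exact: ltW|].
by move=> s; exact: below_lt_pi.
Qed.

(** A continuous path that is < pi on the compact [0, c] attains its maximum there, hence stays
    below pi by a margin 1 / (m + 1). *)
Lemma not_below (c : R) : 0 < c -> ~ below X c w -> exists2 s, 0 <= s <= c & pi <= X s w.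
Proof.
move=> c0 nb; apply: contrapT => nex.
have Xpi s : 0 <= s <= c -> X s w < pi.
  by move=> sc; rewrite ltNge; apply/negP => pX; apply: nex; exists s.
have ct : (c%:E < tau)%E by apply: hitting_time_gt; [exact: rp_contX rw|exact: ltW|].
apply: nb; split; first by have /andP[? ?] := rp_range rw c0 ct; rewrite !ltW.
have [z zc hz] := EVT_max (ltW c0) (continuous_path_itv (rp_contX rw) (lexx 0)).
have zpi : X z w < pi by apply: Xpi; move: zc; rewrite in_itv.
have [m hm] := ltr_add_invr zpi.
exists m => q qc; apply: (@le_trans _ _ (X z w)); last by rewrite lerBrDr ltW.
by apply: hz; rewrite in_itv.
Qed.

Lemma not_below_hitting (c : R) : 0 < c -> ~ below X c w -> (tau <= c%:E)%E.
Proof.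
move=> c0 /(not_below c0)[s /andP[s0 sc] pX].
have := IVT s0 (continuous_path_itv (rp_contX rw) (lexx 0)).
move=> /(_ pi) [|z zs zpi].
  by rewrite (rp_start rw) ge_min le_max pX pi_ge0 orbT.
apply: hitting_time_le zpi; move: zs; rewrite in_itv/= => /andP[-> zs].
exact: le_trans sc.
Qed.

Lemma steady_all (a c : R) : 0 <= a -> a < c -> steady X B rho a c w ->
  forall s, a <= s <= c -> `|X s w - X a w| <= rho /\ `|B s w - B a w| <= rho.
Proof.
move=> a0 ac st s sac.
have cn (g : R -> R) : continuous_path g ->
    {within `[a, c], continuous (fun u => `|g u - g a|)}.
  move=> cg; have cga : {within `[a, c], continuous (fun u => g u - g a)}.
    apply: within_continuousB; last exact: within_continuous_cst.
    exact: continuous_path_itv.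
  by move=> v; apply: (@continuous_comp (subspace `[a, c]) R R (fun u => g u - g a) Num.norm v); [exact: cga|exact: norm_continuous].
split.
  apply: (rat_dense_le ac (cn _ (rp_contX rw))) sac => q qac.
  by have [] := st q qac.
apply: (rat_dense_le ac (cn _ (rp_contB rw))) sac => q qac.
by have [] := st q qac.
Qed.

Lemma grid_ge0 k : 0 <= grid k.
Proof. by rewrite mulr_ge0// ltW. Qed.

Lemma gridS_gt0 k : 0 < grid k.+1.
Proof. by rewrite mulr_gt0. Qed.

Lemma gridS_lt k : grid k < grid k.+1.
Proof. by rewrite gridS ltrDl. Qed.

Lemma alive_lt_pi k s : alive k w -> 0 <= s <= grid k -> X s w < pi.
Proof.
case: k => [_|k [_ [_ bk]]]; last by apply: below_lt_pi => //; exact: gridS_gt0.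
rewrite /grid mul0r => /andP[s0 s1].
have -> : s = 0 by apply/eqP; rewrite eq_le s0 s1.
by rewrite (rp_start rw) pi_gt0.
Qed.

Lemma alive_hitting k : alive k.+1 w -> ((grid k.+1)%:E < tau)%E.
Proof. by move=> [_ [_ bk]]; apply: below_hitting => //; exact: gridS_gt0. Qed.

(** Measurable stand-in for the hitting time truncated at [grid m]; its mean is a sum of survival
    probabilities. *)
Definition lifetime (m : nat) : R := \sum_(k < m) h * \1_(alive k.+1) w.

Lemma lifetime_le_grid m : lifetime m <= grid m.
Proof.
rewrite /lifetime /grid mulr_natl -[X in _ *+ X]card_ord -sumr_const ler_sum// => k _.
by rewrite indicE ler_piMr ?(ltW h0)//; case: (_ \in _).
Qed.

Lemma lifetime_le_hitting m : ((lifetime m)%:E <= tau)%E.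
Proof.
elim: m => [|m ih].
  rewrite /lifetime big_ord0; apply/ereal_infP => _ [s [s0 _] <-].
  by rewrite lee_fin.
rewrite /lifetime big_ord_recr/= indicE; have [am|am] := pselect (alive m.+1 w).
  rewrite mem_set// mulr1; apply: le_trans (ltW (alive_hitting am)).
  rewrite lee_fin gridS lerD2r; exact: lifetime_le_grid.
by rewrite memNset// mulr0 addr0.
Qed.

(** If every step is steady, the path can cease to be alive only by reaching pi, and it does so by
    the end of the first step that is not counted. *)
Lemma hitting_le_lifetime m :
  (forall k, (k < m)%N -> steady X B rho (grid k) (grid k.+1) w) ->
  lifetime m = grid m \/ (tau <= (lifetime m + h)%:E)%E.
Proof.
move=> st; suff : (alive m w /\ lifetime m = grid m) \/ (tau <= (lifetime m + h)%:E)%E.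
  by case=> [[]|]; [left|right].
elim: m st => [st|m ih st].
  left; rewrite /lifetime big_ord0 /grid mul0r; split => //=.
  by rewrite (rp_start rw) lexx pi_ge0.
have {}ih := ih (fun k km => st k (ltnW km)).
have lS : lifetime m.+1 = lifetime m + h * \1_(alive m.+1) w.
  by rewrite /lifetime big_ord_recr.
have lm : lifetime m <= lifetime m.+1.
  by rewrite lS lerDl mulr_ge0// ltW.
case: ih => [[am lmE]|tl]; last first.
  by right; apply: le_trans tl _; rewrite lee_fin lerD2r.
have [bm|bm] := pselect (below X (grid m.+1) w).
  have aS : alive m.+1 w by split => //; split => //; exact: st.
  by left; split => //; rewrite lS lmE indicE mem_set// mulr1 gridS.
right; apply: le_trans (not_below_hitting (gridS_gt0 m) bm) _.
by rewrite lee_fin gridS -lmE lerD2r.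
Qed.

Variables (f f' f'' : R -> R) (lam e Mb : R).
Hypotheses (df : forall x : R, is_derive x 1 f (f' x))
  (rho0 : 0 < rho) (Mb0 : 0 <= Mb)
  (gen : forall x, 0 < x < pi -> lam <= f'' x + Num.min (drift n x) Mb * f' x)
  (cap : forall x y, 0 < x < pi -> `|y - x| <= 3 * rho -> Mb < drift n x -> 0 <= f' y)
  (osc' : forall x y, 0 <= x <= pi -> `|y - x| <= 3 * rho ->
     Mb * `|f' y - f' x| <= e)
  (osc'' : forall x y, 0 <= x <= pi -> 0 <= y <= pi -> `|y - x| <= rho ->
     `|f'' y - f'' x| <= e)
  (oscf : forall y, `|y - pi| <= 6 * rho -> `|f y - f pi| <= e).

Let Z k := X (grid k) w + Num.sqrt 2 * (B (grid k.+1) w - B (grid k) w).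

Lemma alive_step k : alive k.+1 w ->
  f (Z k) <= f (X (grid k.+1) w) - h * (lam - f'' (X (grid k) w) - 2 * e).
Proof.
move=> aS; have ht := alive_hitting aS.
have [ak [st bS]] := aS.
have before s : s <= grid k.+1 -> (s%:E < tau)%E.
  by move=> sk; apply: le_lt_trans ht; rewrite lee_fin.
have stall := steady_all (grid_ge0 k) (gridS_lt k) st.
have := @path_step R f f' f'' (drift n) lam e Mb rho df (@drift_ge0 R n n0)
  (@continuous_drift R n) Mb0 gen cap osc' osc'' (X ^~ w) (B ^~ w)
  (rp_contX rw) (rp_contB rw) (grid k) (grid k.+1) (grid_ge0 k) (gridS_lt k).
have -> : grid k.+1 - grid k = h by rewrite gridS addrAC subrr add0r.
move=> H; rewrite lerBrDr -lerBrDl; apply: H.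
- by move=> s /andP[s0 sk]; apply: (rp_range rw) => //; exact: before.
- exact: alive_range ak.
- by move=> s /andP[s0 sk]; apply: (rp_equation rw) => //; exact: before.
- by move=> s /stall[].
- by move=> s /stall[].
Qed.

(** The path reaches pi during this step, so X is within rho of pi at its beginning; the noise
    increment adds at most 2 rho. *)
Lemma stop_step k : alive k w -> steady X B rho (grid k) (grid k.+1) w ->
  ~ alive k.+1 w -> f (Z k) <= f pi + e.
Proof.
move=> ak st nS.
have nb : ~ below X (grid k.+1) w by move=> b; apply: nS.
have [s /andP[s0 sk] Xs] := not_below (gridS_gt0 k) nb.
have ks : grid k <= s.
  rewrite leNgt; apply/negP => sk'.
  by have := alive_lt_pi ak; move=> /(_ s); rewrite s0 (ltW sk') ltNge Xs => /(_ isT).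
have stall := steady_all (grid_ge0 k) (gridS_lt k) st.
have [h1 _] : `|X s w - X (grid k) w| <= rho /\ `|B s w - B (grid k) w| <= rho.
  by apply: stall; rewrite ks.
have [_ h2] : `|X (grid k.+1) w - X (grid k) w| <= rho /\ `|B (grid k.+1) w - B (grid k) w| <= rho.
  by apply: stall; rewrite lexx (ltW (gridS_lt k)).
have /andP[_ Xk] := alive_range ak.
have q21 : Num.sqrt 2 <= 2 :> R.
  by rewrite -(@ler_pXn2r _ 2) ?nnegrE// sqr_sqrtr// expr2; lra.
have q20 : 0 <= Num.sqrt 2 :> R by [].
have h3 : `|Num.sqrt 2 * (B (grid k.+1) w - B (grid k) w)| <= 2 * rho.
  by rewrite normrM (ger0_norm q20) ler_pM.
have : `|f (Z k) - f pi| <= e.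
  apply: oscf; rewrite ler_norml /Z; move: h1 h3; rewrite !ler_norml.
  by move=> /andP[? ?] /andP[? ?]; apply/andP; split; lra.
by rewrite ler_norml; lra.
Qed.

End regular_path_facts.

Section filtration_functions.
Context {R : realType} d {T : measurableType d} (F : R -> set (set T)).
Hypothesis fF : filtration F.
Variable t : R.
Hypothesis t0 : 0 <= t.

Lemma filtration_preimage_sub (u v : T -> R) :
  (forall U : set R, measurable U -> F t (u @^-1` U)) ->
  (forall U : set R, measurable U -> F t (v @^-1` U)) ->
  forall U : set R, measurable U -> F t ((fun w => u w - v w) @^-1` U).
Proof.
move=> Fu Fv U mU.
(* With F t as its own generated sigma-algebra, [measurable_funB] on that measurable space gives the
   claim. *)
have FE : <<s F t>> = F t by apply: sigma_algebra_id; exact: filtration_sigma fF _ t0.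
have mf (g : T -> R) : (forall U : set R, measurable U -> F t (g @^-1` U)) ->
    measurable_fun [set: g_sigma_algebraType (F t)] g.
  by move=> Fg _ V mV; rewrite setTI; apply: sub_sigma_algebra; exact: Fg.
have := measurable_funB (mf _ Fu) (mf _ Fv) measurableT mU.
by rewrite setTI /measurable/= FE.
Qed.

Variables (X B : R -> T -> R).
Hypotheses (aX : adapted F X) (aB : adapted F B).

Lemma filtration_adapted (Y : R -> T -> R) s (U : set R) : adapted F Y ->
  0 <= s <= t -> measurable U -> F t (Y s @^-1` U).
Proof.
move=> aY /andP[s0 st] mU; apply: (filtration_homo fF s0 st).
exact: aY.
Qed.

Lemma filtration_osc (Y : R -> T -> R) (s u rho : R) : adapted F Y ->
  0 <= s <= t -> 0 <= u <= t -> F t [set w | `|Y s w - Y u w| <= rho].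
Proof.
move=> aY st ut.
have mU : measurable [set x : R | `|x| <= rho].
  have -> : [set x : R | `|x| <= rho] = `[- rho, rho]%classic.
    by apply/seteqP; split => x /=; rewrite in_itv/= ler_norml.
  exact: measurable_itv.
apply: (filtration_preimage_sub _ _ mU) => U mU'; exact: filtration_adapted.
Qed.

Lemma filtration_steady (rho a : R) : 0 <= a <= t ->
  F t (steady X B rho a t).
Proof.
move=> a0t; apply: (@filtration_forall _ _ _ _ fF t t0 rat) => q.
apply: (@filtration_imply _ _ _ _ fF t t0) => /andP[aq qt].
have q0 : 0 <= (ratr q : R) <= t by rewrite qt andbT; case/andP: a0t => /le_trans + _; apply.
by apply: filtrationI => //; exact: filtration_osc.
Qed.

Lemma filtration_below : F t (below X t).
Proof.
have -> : below X t = X t @^-1` `[0, pi]%classic `&`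
    \bigcup_m [set w | forall q : rat, 0 <= (ratr q : R) <= t ->
      (X (ratr q) @^-1` `]-oo, pi - m.+1%:R^-1]%classic) w].
  apply/seteqP; split => w /=.
    move=> [h1 [m h2]]; split; first by rewrite in_itv.
    by exists m => // q /h2; rewrite /= in_itv.
  rewrite in_itv/= => -[h1 [m _ h2]]; split => //.
  by exists m => q /h2; rewrite /= in_itv.
apply: filtrationI => //.
  by apply: filtration_adapted => //; rewrite t0 lexx.
apply: filtration_bigcup => // m.
apply: (@filtration_forall _ _ _ _ fF t t0 rat) => q.
apply: (@filtration_imply _ _ _ _ fF t t0) => q0t.
exact: filtration_adapted.
Qed.

End filtration_functions.

Section alive_measurable.
Context {R : realType} d {T : measurableType d} (F : R -> set (set T)).
Variables (X B : R -> T -> R) (rho h : R).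
Hypotheses (fF : filtration F) (aX : adapted F X) (aB : adapted F B) (h0 : 0 < h).

Lemma filtration_alive k : F (grid h k) (alive X B rho h k).
Proof.
elim: k => [|k ih].
  have g0 : 0 <= grid h 0 by rewrite /grid mul0r.
  have -> : alive X B rho h 0 = X (grid h 0) @^-1` `[0, pi]%classic.
    by apply/seteqP; split => w /=; rewrite /grid mul0r in_itv.
  exact: aX.
have gk : 0 <= grid h k by exact: grid_ge0.
have gk1 : 0 <= grid h k.+1 by exact: grid_ge0.
have gkS : grid h k <= grid h k.+1 by rewrite ltW// gridS_lt.
apply: filtrationI => //; first exact: (filtration_homo fF gk gkS).
apply: filtrationI => //; last exact: filtration_below.
by apply: filtration_steady => //; rewrite gk.
Qed.

Lemma measurable_alive k : measurable (alive X B rho h k).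
Proof.
apply: (filtration_measurable fF (grid_ge0 h0 k)); exact: filtration_alive.
Qed.

Lemma measurable_steady k : measurable (steady X B rho (grid h k) (grid h k.+1)).
Proof.
apply: (filtration_measurable fF (grid_ge0 h0 k.+1)).
apply: filtration_steady => //; first exact: grid_ge0.
by rewrite grid_ge0//= ltW// gridS_lt.
Qed.

End alive_measurable.

Section null_sets.
Context {R : realType} d {T : measurableType d} (P : probability T R).

Lemma ae_le_Rintegral (D : set T) (u v : T -> R) : measurable D -> P (~` D) = 0%E ->
  P.-integrable setT (EFin \o u) -> P.-integrable setT (EFin \o v) ->
  (forall w, D w -> u w <= v w) -> \int[P]_w u w <= \int[P]_w v w.
Proof.
move=> mD D0 iu iv uv.
have mDC : measurable (~` D) by exact: measurableC.
rewrite /Rintegral (negligible_integral mDC measurableT iu D0).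
rewrite (negligible_integral mDC measurableT iv D0) setTD setCK.
apply: le_Rintegral => //.
  exact: integrableS iu.
exact: integrableS iv.
Qed.

Lemma regular_path_ae n (F : R -> set (set T)) (B X : R -> T -> R) :
  radius_diffusion n P F B X ->
  exists D, [/\ measurable D, P (~` D) = 0%E & forall w, D w -> regular_path n X B w].
Proof.
move=> rX.
have : {ae P, forall w, regular_path n X B w}.
  have h1 := rd_continuous rX; have h2 := bm_continuous (rd_brownian rX).
  have h3 := rd_start rX; have h4 := rd_range rX; have h5 := rd_equation rX.
  near=> w; constructor; by [near: w | ].
move=> [N [mN N0 h]]; exists (~` N); split.
- exact: measurableC.
- by rewrite setCK.
- by move=> w Nw; apply: contrapT => nr; apply: Nw; exact: h.
Unshelve. all: by end_near.
Qed.

End null_sets.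

(** * The discretised Dynkin inequality *)

Section indicator_integrals.
Context {R : realType} d {T : measurableType d} (P : probability T R).

Lemma integrable_indicM (S : set T) (g : T -> R) (M : R) : measurable S ->
  measurable_fun setT g -> (forall w, `|g w| <= M) ->
  P.-integrable setT (EFin \o (fun w => \1_S w * g w)).
Proof.
move=> mS mg gM; apply: (@bounded_integrable _ _ _ _ _ _ M) => //.
  by apply: measurable_funM => //; exact: measurable_indic.
move=> w _; rewrite normrM indicE; apply: le_trans (gM w).
by case: (_ \in _); rewrite ?normr1 ?normr0 ?mul1r ?mul0r.
Qed.

Lemma integrable_indicator (S : set T) : measurable S ->
  P.-integrable setT (EFin \o (fun w => \1_S w : R)).
Proof.
move=> mS; apply: (@bounded_integrable _ _ _ _ _ _ 1); [by []|exact: measurable_indic|].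
by move=> w _; rewrite indicE; case: (_ \in _); rewrite ?normr1 ?normr0.
Qed.

Lemma Rintegral_indicM (S : set T) (g : T -> R) :
  \int[P]_(w in S) g w = \int[P]_w (\1_S w * g w).
Proof.
rewrite Rintegral_mkcond; apply: eq_Rintegral => w _.
by rewrite patchE indicE; case: (_ \in _); rewrite ?mul1r ?mul0r.
Qed.

End indicator_integrals.

Section step.
Context {R : realType} d {T : measurableType d} (P : probability T R).
Variables (n : nat) (F : R -> set (set T)) (B X : R -> T -> R).
Hypotheses (n0 : (0 < n)%N) (rX : radius_diffusion n P F B X).
Variables (D : set T).
Hypotheses (mD : measurable D) (D0 : P (~` D) = 0%E)
  (reg : forall w, D w -> regular_path n X B w).
Variables (f f' f'' : R -> R) (M K lam e Mb rho h : R).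
Hypotheses (h0 : 0 < h) (e0 : 0 < e) (rho0 : 0 < rho) (Mb0 : 0 <= Mb)
  (df : forall x : R, is_derive x 1 f (f' x))
  (cf'' : continuous f'') (fM : forall x, `|f x| <= M)
  (f''K : forall x, 0 <= x <= pi -> `|f'' x| <= K)
  (gen : forall x, 0 < x < pi -> lam <= f'' x + Num.min (drift n x) Mb * f' x)
  (cap : forall x y, 0 < x < pi -> `|y - x| <= 3 * rho -> Mb < drift n x -> 0 <= f' y)
  (osc' : forall x y, 0 <= x <= pi -> `|y - x| <= 3 * rho ->
     Mb * `|f' y - f' x| <= e)
  (osc'' : forall x y, 0 <= x <= pi -> 0 <= y <= pi -> `|y - x| <= rho ->
     `|f'' y - f'' x| <= e)
  (oscf : forall y, `|y - pi| <= 6 * rho -> `|f y - f pi| <= e)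
  (gauss : forall x, 0 <= x <= pi -> f x + h * f'' x - h * e <=
     \int[normal_prob 0 (Num.sqrt h)]_y f (x + Num.sqrt 2 * y)).
Local Notation grid := (grid h).
Local Notation alive := (alive X B rho h).
Local Notation steady_ k := (steady X B rho (grid k) (grid k.+1)).

Definition survival k : R := \int[P]_w \1_(alive k) w.
Definition alive_mean k : R := \int[P]_w (\1_(alive k) w * f (X (grid k) w)).
Definition unsteady k : R := \int[P]_w \1_(alive k `\` steady_ k) w.

Let fF := rd_filtration rX.
Let aX := rd_adapted rX.
Let aB := bm_adapted (rd_brownian rX).

(** Three outcomes of a step: the path survives ([alive_step]), it reaches pi during a steady step
    ([stop_step]), or the step is not steady and the bound 2 M is paid. *)
Lemma step_pathwise k w : D w -> alive k w ->
  f (X (grid k) w + Num.sqrt 2 * (B (grid k.+1) w - B (grid k) w))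
  - h * f'' (X (grid k) w) <=
  \1_(alive k.+1) w * f (X (grid k.+1) w)
  - h * (lam - 2 * e) * \1_(alive k.+1) w
  + (f pi + e + h * K) * (1 - \1_(alive k.+1) w)
  + 2 * M * \1_(alive k `\` steady_ k) w.
Proof.
move=> Dw ak.
have M0 : 0 <= M by apply: le_trans (fM 0).
have hK : `|h * f'' (X (grid k) w)| <= h * K.
  rewrite normrM gtr0_norm// ler_wpM2l ?(ltW h0)//; apply: f''K.
  exact: alive_range ak.
have ind (S : set T) : 0 <= \1_S w :> R by rewrite indicE.
have hM := mulr_ge0 M0 (ind (alive k `\` steady_ k)).
have [aS|aS] := pselect (alive k.+1 w).
  have := alive_step n0 h0 (reg Dw) df Mb0 gen cap osc' osc'' aS.
  by rewrite [\1_(alive k.+1) w]indicE mem_set//= subrr mulr1 mul1r; lra.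
rewrite [\1_(alive k.+1) w]indicE memNset//=.
move: hK; rewrite ler_norml => /andP[hK1 hK2].
have [st|st] := pselect (steady_ k w).
  have := stop_step h0 (reg Dw) oscf ak st aS.
  by lra.
rewrite [\1_(alive k `\` _) w]indicE mem_set//=.
have := fM (X (grid k) w + Num.sqrt 2 * (B (grid k.+1) w - B (grid k) w)).
have := fM pi; rewrite !ler_norml => /andP[? ?] /andP[? ?].
by have := e0; lra.
Qed.

(** [increment_lower] bounds the mean of f (Z) over [alive k] from below, and [step_pathwise] bounds
    it from above; the terms h f'' cancel. Outside [alive k] everything vanishes, as [alive k.+1] is
    contained in it. *)
Lemma step_mean k :
  0 <= alive_mean k.+1 - alive_mean k - h * (lam - 2 * e) * survival k.+1
    + (f pi + e + h * K) * (survival k - survival k.+1) + h * e * survival k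
    + 2 * M * unsteady k.
Proof.
have cf : continuous f by move=> z; exact: is_derive1_continuous (df z).
have mf : measurable_fun setT f by exact: continuous_measurable_fun.
have K0 : 0 <= K by apply: le_trans (f''K (x:=0) _); rewrite // lexx pi_ge0.
have gk := grid_ge0 h0 k; have gk1 := grid_ge0 h0 k.+1.
have mX t : 0 <= t -> measurable_fun setT (X t) by exact: (adapted_measurable fF).
have mB t : 0 <= t -> measurable_fun setT (B t) by exact: (adapted_measurable fF).
have mA j : measurable (alive j) by exact: (measurable_alive rho fF aX aB h0).
have mS : measurable (alive k `\` steady_ k).
  by apply: measurableD => //; exact: (measurable_steady rho fF aX aB h0).
pose A := alive k.
pose Z w := X (grid k) w + Num.sqrt 2 * (B (grid k.+1) w - B (grid k) w).
have mZ : measurable_fun setT Z.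
  apply: measurable_funD; first exact: mX.
  by apply: measurable_funM => //; apply: measurable_funB; exact: mB.
pose l x := f x + h * f'' x - h * e.
have ml : measurable_fun setT l.
  apply: measurable_funB => //; apply: measurable_funD => //.
  by apply: measurable_funM => //; exact: continuous_measurable_fun.
pose M' := M + h * K + h * e.
have hK0 : 0 <= h * K by rewrite mulr_ge0// ltW.
have he0 : 0 <= h * e by rewrite mulr_ge0// ltW.
have lM x : 0 <= x <= pi -> `|l x| <= M'.
  move=> xp; rewrite /l (le_trans (ler_normB _ _))// (ger0_norm he0) lerD2r.
  rewrite (le_trans (ler_normD _ _))// lerD//.
  by rewrite normrM (gtr0_norm h0) ler_wpM2l ?f''K// ltW.
have fM' x : `|f x| <= M' by apply: le_trans (fM x) _; rewrite /M'; lra.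
have low := increment_lower fF (rd_brownian rX) gk h0 (aX gk) cf fM' ml lM gauss
  (filtration_alive rho fF aX aB h0 k) (@alive_range _ _ X B rho h k).
rewrite -gridS in low.
pose U w := \1_A w * f (Z w) - \1_A w * l (X (grid k) w).
have iZ : P.-integrable setT (EFin \o (fun w => \1_A w * f (Z w))).
  apply: (@integrable_indicM _ _ _ _ _ _ M); [exact: mA| |by move=> w].
  exact: measurableT_comp.
have il : P.-integrable setT (EFin \o (fun w => \1_A w * l (X (grid k) w))).
  apply: (@bounded_integrable _ _ _ _ _ _ M') => //.
    apply: measurable_funM; first by apply: measurable_indic; exact: mA.
    exact: (measurableT_comp ml (mX _ gk)).
  move=> w _; rewrite indicE; have [Aw|Aw] := pselect (A w).
    by rewrite mem_set// mul1r; apply: lM; exact: alive_range Aw.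
  by rewrite memNset// mul0r normr0 /M'; have := le_trans (normr_ge0 _) (fM 0); lra.
have U0 : 0 <= \int[P]_w U w.
  by rewrite (RintegralB measurableT iZ il) subr_ge0 -!Rintegral_indicM.
apply: le_trans U0 _.
have iX j : P.-integrable setT (EFin \o (fun w => \1_(alive j) w * f (X (grid j) w))).
  apply: (@integrable_indicM _ _ _ _ _ _ M); [exact: mA| |by move=> w].
  by apply: measurableT_comp => //; apply: mX; exact: grid_ge0.
have i1 j : P.-integrable setT (EFin \o (fun w => \1_(alive j) w : R)).
  exact: integrable_indicator.
have iS := integrable_indicator P mS.
pose c := f pi + e + h * K.
pose V w := \1_(alive k.+1) w * f (X (grid k.+1) w) +
  ((- (h * (lam - 2 * e)) - c) * \1_(alive k.+1) w +
   (-1 * (\1_(alive k) w * f (X (grid k) w)) +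
    ((c + h * e) * \1_(alive k) w + 2 * M * \1_(alive k `\` steady_ k) w))).
have mT := @measurableT _ T.
have s1 := integrable_scale (2 * M) mT iS.
have s2 := integrable_scale (c + h * e) mT (i1 k).
have s3 := integrable_scale (-1) mT (iX k).
have s4 := integrable_scale (- (h * (lam - 2 * e)) - c) mT (i1 k.+1).
have t1 := integrable_add mT s2 s1.
have t2 := integrable_add mT s3 t1.
have t3 := integrable_add mT s4 t2.
have t4 := integrable_add mT (iX k.+1) t3.
apply: (@le_trans _ _ (\int[P]_w V w)); last first.
  rewrite (RintegralD mT (iX k.+1) t3) (RintegralD mT s4 t2) (RintegralD mT s3 t1).
  rewrite (RintegralD mT s2 s1) !(RintegralZl _ mT) //.
  rewrite /alive_mean /survival /unsteady /c le_eqVlt; apply/orP; left; apply/eqP.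
  by ring.
apply: (ae_le_Rintegral mD D0 (integrable_sub mT iZ il) t4) => w Dw.
rewrite /V; have [ak|ak] := pselect (alive k w); last first.
  have aS : ~ alive k.+1 w by case.
  have st : ~ (alive k `\` steady_ k) w by case.
  by rewrite /U !indicE !memNset//= !mul0r !mulr0 !addr0 subrr.
have := step_pathwise Dw ak; rewrite /U /A [\1_(alive k) w]indicE mem_set//= !mul1r /l -/(Z w) /c.
by lra.
Qed.

End step.

Section horizon.
Context {R : realType} d {T : measurableType d} (P : probability T R).
Variables (n : nat) (F : R -> set (set T)) (B X : R -> T -> R).
Hypotheses (n0 : (0 < n)%N) (rX : radius_diffusion n P F B X).
Variables (D : set T).
Hypotheses (mD : measurable D) (D0 : P (~` D) = 0%E)
  (reg : forall w, D w -> regular_path n X B w).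
Variables (f f' f'' : R -> R) (M K lam e Mb rho h : R).
Hypotheses (h0 : 0 < h) (e0 : 0 < e) (rho0 : 0 < rho) (Mb0 : 0 <= Mb)
  (df : forall x : R, is_derive x 1 f (f' x))
  (cf'' : continuous f'') (fM : forall x, `|f x| <= M)
  (f''K : forall x, 0 <= x <= pi -> `|f'' x| <= K)
  (gen : forall x, 0 < x < pi -> lam <= f'' x + Num.min (drift n x) Mb * f' x)
  (cap : forall x y, 0 < x < pi -> `|y - x| <= 3 * rho -> Mb < drift n x -> 0 <= f' y)
  (osc' : forall x y, 0 <= x <= pi -> `|y - x| <= 3 * rho ->
     Mb * `|f' y - f' x| <= e)
  (osc'' : forall x y, 0 <= x <= pi -> 0 <= y <= pi -> `|y - x| <= rho ->
     `|f'' y - f'' x| <= e)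
  (oscf : forall y, `|y - pi| <= 6 * rho -> `|f y - f pi| <= e)
  (gauss : forall x, 0 <= x <= pi -> f x + h * f'' x - h * e <=
     \int[normal_prob 0 (Num.sqrt h)]_y f (x + Num.sqrt 2 * y)).
Local Notation grid := (grid h).
Local Notation alive := (alive X B rho h).
Local Notation steady_ k := (steady X B rho (grid k) (grid k.+1)).

Local Notation surv := (survival P B X rho h).
Local Notation amean := (alive_mean P B X f rho h).
Local Notation unst := (unsteady P B X rho h).
Let fF := rd_filtration rX.
Let aX := rd_adapted rX.
Let aB := bm_adapted (rd_brownian rX).
Let mA j : measurable (alive j) := measurable_alive rho fF aX aB h0 j.
Let mT := @measurableT _ T.
Let i1 (S : set T) := @integrable_indicator _ _ _ P S.

Definition all_steady (N : nat) : set T :=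
  [set w | forall k : nat, (k < N)%N -> steady_ k w].

Lemma measurable_all_steady N : measurable (all_steady N).
Proof.
have -> : all_steady N = \bigcap_k (if (k < N)%N then steady_ k else setT).
  apply/seteqP; split => [w h1 k _|w h1 k kN].
    by case: ifPn => // /h1.
  by have := h1 k Logic.I; rewrite kN.
apply: bigcapT_measurable => k; case: ifPn => // _.
exact: (measurable_steady rho fF aX aB h0).
Qed.

Definition unsteady_prob N : R := \int[P]_w \1_(~` all_steady N) w.
Definition mean_lifetime N : R := \int[P]_w lifetime X B rho h w N.

Lemma indicator_01 (S : set T) w : 0 <= (\1_S w : R) <= 1.
Proof. by rewrite indicE; case: (_ \in _); rewrite lexx ler01. Qed.

Lemma survival_01 k : 0 <= surv k <= 1.
Proof.
apply/andP; split.
  by apply: Rintegral_ge0 => w _; case/andP: (indicator_01 (alive k) w).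
rewrite -[leRHS](RintegralT_cst P 1); apply: le_Rintegral; [exact: mT|exact: i1|exact: integrable_const|].
by move=> w _; case/andP: (indicator_01 (alive k) w).
Qed.

Lemma survival_le j k : (j <= k)%N -> surv k <= surv j.
Proof.
move=> /subnK <-; elim: (k - j)%N => // m ih; apply: le_trans ih.
apply: le_Rintegral; [exact: mT|exact: i1|exact: i1|] => w _.
rewrite addSn !indicE; have [aw|aw] := pselect (alive (m + j).+1 w).
  by have [aw' _] := aw; rewrite !mem_set.
by rewrite (memNset aw) ler0n.
Qed.

Lemma survival0 : surv 0 = 1.
Proof.
apply/eqP; rewrite eq_le; case/andP: (survival_01 0) => _ -> /=.
rewrite -[leLHS](RintegralT_cst P 1).
rewrite /survival; apply: (ae_le_Rintegral mD D0 (integrable_const P 1 mT) (i1 (mA 0))).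
move=> w Dw; rewrite indicE mem_set//= (rp_start (reg Dw)) lexx.
exact: pi_ge0.
Qed.

Lemma lifetimeS N w : lifetime X B rho h w N.+1 =
  lifetime X B rho h w N + h * \1_(alive N.+1) w.
Proof. by rewrite /lifetime big_ord_recr. Qed.

Lemma integrable_lifetime N :
  P.-integrable setT (EFin \o (fun w => lifetime X B rho h w N)).
Proof.
elim: N => [|N ih].
  apply: eq_integrable (integrable_const P 0 mT); first exact: mT.
  by move=> w _; rewrite /= /lifetime big_ord0.
apply: eq_integrable (integrable_add mT ih (integrable_scale h mT (i1 (mA N.+1)))).
  exact: mT.
by move=> w _; rewrite /= lifetimeS.
Qed.

Lemma mean_lifetimeE N : mean_lifetime N = h * \sum_(k < N) surv k.+1.
Proof.
rewrite /mean_lifetime; elim: N => [|N ih].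
  under eq_Rintegral do rewrite /lifetime big_ord0.
  by rewrite (RintegralT_cst P) big_ord0 mulr0.
under eq_Rintegral do rewrite lifetimeS.
rewrite (RintegralD mT (integrable_lifetime N) (integrable_scale h mT (i1 (mA N.+1)))).
by rewrite ih (RintegralZl h mT (i1 (mA N.+1))) big_ord_recr/= mulrDr.
Qed.

(** A step that is not steady ends the life of the path, so the events [alive k] minus [steady_ k]
    are disjoint and there is no loss proportional to the number of steps. *)
Lemma sum_unsteady_le N : \sum_(k < N) unst k <= unsteady_prob N.
Proof.
have mS k : measurable (alive k `\` steady_ k).
  by apply: measurableD; [exact: mA|exact: (measurable_steady rho fF aX aB h0)].
pose U m w : R := \sum_(k < m) \1_(alive k `\` steady_ k) w.
have US m w : U m.+1 w = U m w + \1_(alive m `\` steady_ m) w.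
  by rewrite /U big_ord_recr.
have iU m : P.-integrable setT (EFin \o U m).
  elim: m => [|m ih].
    apply: eq_integrable (integrable_const P 0 mT); first exact: mT.
    by move=> w _; rewrite /= /U big_ord0.
  apply: eq_integrable (integrable_add mT ih (i1 (mS m))); first exact: mT.
  by move=> w _; rewrite /= US.
have -> : \sum_(k < N) unst k = \int[P]_w U N w.
  elim: N => [|m ih].
    under eq_Rintegral do rewrite /U big_ord0.
    by rewrite (RintegralT_cst P) big_ord0.
  under eq_Rintegral do rewrite US.
  by rewrite (RintegralD mT (iU m) (i1 (mS m))) big_ord_recr/= ih.
have mC : measurable (~` all_steady N) by apply: measurableC; exact: measurable_all_steady.
apply: (le_Rintegral mT (iU N) (i1 mC)) => w _.
have [st|st] := pselect (all_steady N w).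
  rewrite /U big1 ?(proj1 (andP (indicator_01 _ _)))// => k _.
  by rewrite indicE memNset// => -[_]; apply; exact: st.
rewrite [leRHS]indicE mem_set//=.
(* Disjointness in a form that passes through the induction: at most one failure has occurred, and
   none while the path is alive. *)
suff : U N w + \1_(alive N) w <= 1.
  by have := indicator_01 (alive N) w => /andP[? _]; lra.
elim: N {mC st} => [|m ih].
  by rewrite /U big_ord0 add0r; case/andP: (indicator_01 (alive 0) w).
apply: le_trans ih; rewrite US -addrA lerD2l !indicE.
have [am|am] := pselect (alive m w); last first.
  by rewrite !memNset ?addr0// => -[].
rewrite [in leRHS](mem_set am); have [sm|sm] := pselect (steady_ m w).
  by rewrite (@memNset _ (_ `\` _)) ?add0r; [case: (_ \in _)|case].
by rewrite (@memNset _ (alive m.+1)) ?addr0; [case: (_ \in _)|case=> _ []].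
Qed.

(** Sum of [step_mean], with [alive_mean] and the stopping terms telescoping. In 3 e [grid N], one
    part is the Gaussian error and two come from lam - 2e. Being alive at the end costs M for f and
    at most M for the missing stopping term. *)
Lemma dynkin_sum N :
  lam * mean_lifetime N <= f pi - f 0 + (e + h * K + 3 * e * grid N)
    + 2 * M * (surv N + unsteady_prob N).
Proof.
have e1 := e0; have h1 := h0.
have M0 : 0 <= M by apply: le_trans (fM 0).
have K0 : 0 <= K by apply: le_trans (f''K (x:=0) _); rewrite // lexx pi_ge0.
have cf : continuous f by move=> z; exact: is_derive1_continuous (df z).
have mf : measurable_fun setT f by exact: continuous_measurable_fun.
pose c := f pi + e + h * K.
have sum m : 0 <= amean m - amean 0 - h * (lam - 2 * e) * (\sum_(k < m) surv k.+1)
    + c * (surv 0 - surv m) + h * e * (\sum_(k < m) surv k)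
    + 2 * M * \sum_(k < m) unst k.
  elim: m => [|m ih]; first by rewrite !big_ord0 !mulr0 !subrr !addr0 !mulr0.
  rewrite !big_ord_recr/=.
  have := step_mean n0 rX mD D0 reg h0 e0 Mb0 df cf'' fM f''K gen cap osc' osc'' oscf gauss m.
  rewrite -/c; move: ih.
  by lra.
have mX t : 0 <= t -> measurable_fun setT (X t) by exact: (adapted_measurable fF).
have iX j : P.-integrable setT (EFin \o (fun w => \1_(alive j) w * f (X (grid j) w))).
  apply: (@integrable_indicM _ _ _ _ _ _ M); [exact: mA| |by move=> w].
  exact: (measurableT_comp mf (mX _ (grid_ge0 h0 j))).
have a0 : f 0 <= amean 0.
  rewrite -[leLHS](RintegralT_cst P) /alive_mean.
  apply: (ae_le_Rintegral mD D0 (integrable_const P (f 0) mT) (iX 0)) => w Dw.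
  rewrite indicE mem_set/=; last by rewrite (rp_start (reg Dw)) lexx pi_ge0.
  by rewrite /grid mul0r (rp_start (reg Dw)) mul1r.
have aN : amean N <= M * surv N.
  rewrite /alive_mean /survival -(RintegralZl M mT (i1 (mA N))).
  apply: (le_Rintegral mT (iX N) (integrable_scale M mT (i1 (mA N)))) => w _.
  rewrite mulrC ler_wpM2r//.
  by apply: le_trans (fM (X (grid N) w)); exact: ler_norm.
have := sum N; rewrite survival0 => sN.
have sumle : \sum_(k < N) surv k <= N%:R.
  rewrite -[X in _ <= X%:R]card_ord -sumr_const ler_sum// => k _.
  by case/andP: (survival_01 k).
have sumle' : \sum_(k < N) surv k.+1 <= N%:R.
  rewrite -[X in _ <= X%:R]card_ord -sumr_const ler_sum// => k _.
  by case/andP: (survival_01 k.+1).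
have t1 : h * e * (\sum_(k < N) surv k) <= e * grid N.
  have -> : e * grid N = h * e * N%:R by rewrite /grid; ring.
  by rewrite ler_wpM2l// mulr_ge0// ltW.
have t2 : 2 * e * mean_lifetime N <= 2 * e * grid N.
  rewrite mean_lifetimeE.
  have -> : 2 * e * grid N = 2 * e * (h * N%:R) by rewrite /grid; ring.
  by rewrite ler_wpM2l ?mulr_ge0 ?(ltW e0)// ler_wpM2l// ltW.
have t3 : 2 * M * (\sum_(k < N) unst k) <= 2 * M * unsteady_prob N.
  by rewrite ler_wpM2l ?mulr_ge0// sum_unsteady_le.
have t4 : - c * surv N <= M * surv N.
  have /andP[p0 _] := survival_01 N; rewrite ler_wpM2r//.
  have := fM pi; rewrite ler_norml /c => /andP[? _].
  by have := mulr_ge0 (ltW h0) K0; lra.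
move: sN t2; rewrite mean_lifetimeE -/c.
have -> : h * (lam - 2 * e) * (\sum_(k < N) surv k.+1) =
  lam * (h * \sum_(k < N) surv k.+1) - 2 * e * (h * \sum_(k < N) surv k.+1) by ring.
rewrite /c in t4 *; lra.
Qed.

(** Survival decreases, so each of the N terms is at least the last one: Markov's inequality for the
    lifetime. *)
Lemma survival_le_lifetime N : grid N * surv N <= mean_lifetime N.
Proof.
rewrite mean_lifetimeE /grid mulrAC mulrC ler_wpM2l ?(ltW h0)//.
rewrite mulr_natl -[X in _ *+ X]card_ord -sumr_const ler_sum// => k _.
exact: survival_le.
Qed.

End horizon.

(** * Integrals of a function that may be nonmeasurable *)

Section lower_integral.
Context {R : realType} d {T : measurableType d} (P : probability T R).
Import HBNNSimple.

(* The hitting time need not be measurable, as F is not assumed complete; its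
   integral is a supremum over simple functions below it. *)
Lemma le_integral_nonmeasurable (u v : T -> \bar R) : (forall w, 0 <= u w)%E ->
  (forall w, u w <= v w)%E -> (\int[P]_w u w <= \int[P]_w v w)%E.
Proof.
move=> u0 uv.
have v0 w : (0 <= v w)%E by exact: le_trans (u0 w) (uv w).
rewrite !ge0_integralTE//; apply: ereal_sup_le => _ [g gu <-]; exists g => //= w.
exact: le_trans (gu w) (uv w).
Qed.

Lemma Rintegral_le_integral (D : set T) (g : T -> R) (v : T -> \bar R) (M : R) :
  measurable D -> P (~` D) = 0%E -> measurable_fun setT g ->
  (forall w, 0 <= g w <= M) -> (forall w, 0 <= v w)%E ->
  (forall w, D w -> (g w)%:E <= v w)%E -> ((\int[P]_w g w)%:E <= \int[P]_w v w)%E.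
Proof.
move=> mD D0 mg gM v0 gv.
have gM' w : `|g w| <= M by case/andP: (gM w) => g0 gM'; rewrite ger0_norm.
have ig : P.-integrable setT (EFin \o g).
  by apply: (@bounded_integrable _ _ _ _ _ _ M).
have iDg : P.-integrable setT (EFin \o (fun w => \1_D w * g w)) by exact: integrable_indicM gM'.
apply: (@le_trans _ _ (\int[P]_w (\1_D w * g w))%:E).
  rewrite lee_fin; apply: (ae_le_Rintegral mD D0 ig iDg) => w Dw.
  by rewrite indicE mem_set// mul1r.
rewrite /Rintegral fineK; last exact: integrable_fin_num.
apply: le_integral_nonmeasurable => w.
  by rewrite lee_fin mulr_ge0//; case/andP: (gM w).
have [Dw|Dw] := pselect (D w); first by rewrite indicE mem_set// mul1r; exact: gv.
by rewrite indicE memNset// mul0r.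
Qed.

(** Simple functions are bounded, so the supremum defining the integral only sees bounded measurable
    minorants. *)
Lemma integral_le_bounded (v : T -> \bar R) (C : R) : (forall w, 0 <= v w)%E ->
  (forall (g : T -> R) (M : R), measurable_fun setT g -> (forall w, 0 <= g w <= M) ->
    (forall w, (g w)%:E <= v w)%E -> \int[P]_w g w <= C) ->
  (\int[P]_w v w <= C%:E)%E.
Proof.
move=> v0 h; rewrite ge0_integralTE//; apply: ge_ereal_sup => _ [g gv <-].
have [M [_ hM]] := simple_bounded g.
have gM w : 0 <= g w <= M + 1.
  by rewrite fun_ge0/=; apply: le_trans (hM (M + 1) _ w Logic.I); rewrite ?ltrDl// ler_norm.
have ig : P.-integrable setT (EFin \o g).
  by apply: (@bounded_integrable _ _ _ _ _ _ (M + 1)) => // w _; case/andP: (gM w) => g0 g1; rewrite ger0_norm.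
have := h g (M + 1) _ gM gv => /(_ (measurable_funP _)).
rewrite -integralT_nnsfun -lee_fin /Rintegral fineK//.
exact: integrable_fin_num ig.
Qed.

End lower_integral.

(** * From the lifetime to the hitting time as the mesh shrinks *)

Section horizon_limit.
Context {R : realType} d {T : measurableType d} (P : probability T R).
Variables (n : nat) (F : R -> set (set T)) (B X : R -> T -> R).
Hypotheses (rX : radius_diffusion n P F B X).
Variables (D : set T).
Hypotheses (mD : measurable D) (D0 : P (~` D) = 0%E)
  (reg : forall w, D w -> regular_path n X B w).
Let mT := @measurableT _ T.

Lemma hitting_time_ge0 w : (0 <= hitting_time X pi w)%E.
Proof. by apply/ereal_infP => _ [t [t0 _] <-]; rewrite lee_fin. Qed.

Section fixed_step.
Variables (rho h : R).
Hypothesis h0 : 0 < h.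

Lemma mean_lifetime_le_integral N :
  ((mean_lifetime P B X rho h N)%:E <= \int[P]_w hitting_time X pi w)%E.
Proof.
apply: (@Rintegral_le_integral _ _ _ _ D _ _ (grid h N)) => //.
- have := measurable_int _ (integrable_lifetime rX rho h0 N).
  by move/measurable_EFinP.
- move=> w; rewrite lifetime_le_grid// andbT sumr_ge0// => k _.
  by rewrite mulr_ge0 ?(ltW h0)//; case/andP: (@indicator_01 R _ T (alive X B rho h k.+1) w).
- exact: hitting_time_ge0.
- by move=> w Dw; exact: (lifetime_le_hitting rho h0 (reg Dw)).
Qed.

Lemma Rintegral_le_lifetime N (g : T -> R) : measurable_fun setT g ->
  (forall w, 0 <= g w <= grid h N) -> (forall w, (g w)%:E <= hitting_time X pi w)%E ->
  \int[P]_w g w <=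
    mean_lifetime P B X rho h N + h + grid h N * unsteady_prob P B X rho h N.
Proof.
move=> mg gN gt.
have ig : P.-integrable setT (EFin \o g).
  apply: (@bounded_integrable _ _ _ _ _ _ (grid h N)) => // w _.
  by case/andP: (gN w) => g0 g1; rewrite ger0_norm.
have il := integrable_lifetime rX rho h0 N.
have mS := measurable_all_steady rX rho h0 N.
have iS := integrable_indicator P (measurableC mS).
have iSg := integrable_scale (grid h N) mT iS.
have ic := integrable_const P h mT.
have ilc := integrable_add mT il ic.
have i := integrable_add mT ilc iSg.
apply: le_trans (ae_le_Rintegral mD D0 ig i _) _; last first.
  rewrite (RintegralD mT ilc iSg) (RintegralD mT il ic) (RintegralZl (grid h N) mT iS).
  by rewrite (RintegralT_cst P).
move=> w Dw /=; have /andP[g0 gg] := gN w.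
have l0 : 0 <= lifetime X B rho h w N.
  by apply: sumr_ge0 => k _; rewrite mulr_ge0 ?(ltW h0)//; case/andP: (@indicator_01 R _ T (alive X B rho h k.+1) w).
have gr := grid_ge0 h0 N.
have [st|st] := pselect (all_steady B X rho h N w); last first.
  by rewrite [X in grid h N * X]indicE mem_set// mulr1; have := ltW h0; lra.
rewrite [X in grid h N * X]indicE memNset ?mulr0 ?addr0; last by apply.
have [->|] := hitting_le_lifetime h0 (reg Dw) st; first by have := ltW h0; lra.
by move=> /(le_trans (gt w)); rewrite lee_fin.
Qed.

End fixed_step.

(** Paths in D are uniformly continuous on [0, Th], so each of them is steady on every sufficiently
    fine grid; continuity of P from above turns this into a statement on probabilities. *)
Lemma unsteady_prob_small (rho Th dl : R) : 0 < rho -> 0 < Th -> 0 < dl ->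
  exists N0, forall N, (N0 <= N)%N ->
    unsteady_prob P B X rho (Th / N.+1%:R) N.+1 <= dl.
Proof.
move=> rho0 Th0 dl0.
have h0 N : 0 < Th / N.+1%:R :> R by rewrite divr_gt0.
pose bad N := ~` all_steady B X rho (Th / N.+1%:R) N.+1.
have mbad N : measurable (bad N).
  by apply: measurableC; exact: (measurable_all_steady rX).
(* The sets [bad N] need not be monotone, as the grids are not nested; the tail unions are. *)
pose E m := D `&` \bigcup_(N in [set N | (m <= N)%N]) bad N.
have mE m : measurable (E m).
  by apply: measurableI => //; apply: bigcup_measurable => N _.
have Ecap : \bigcap_m E m = set0.
  apply/seteqP; split => // w h.
  have [Dw _] := h 0%N Logic.I.
  have ucX := itv_uniform_continuity (continuous_path_itv (b:=Th) (rp_contX (reg Dw)) (lexx 0)) rho0.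
  have ucB := itv_uniform_continuity (continuous_path_itv (b:=Th) (rp_contB (reg Dw)) (lexx 0)) rho0.
  have [d1 d10 hX] := ucX; have [d2 d20 hB] := ucB.
  pose dm := Num.min d1 d2; have dm0 : 0 < dm by rewrite lt_min d10.
  have dm1 : dm <= d1 by rewrite ge_min lexx.
  have dm2 : dm <= d2 by rewrite ge_min lexx orbT.
  clearbody dm.
  pose m := Num.truncn (Th / dm).
  have [_ [N /= mN bN]] := h m Logic.I.
  apply: bN => k kN q /andP[kq qk].
  have hN : Th / N.+1%:R <= dm.
    rewrite ler_pdivrMr// mulrC -ler_pdivrMr//.
    apply: le_trans (ltW (truncnS_gt _)) _.
    by rewrite ler_nat.
  have hN0 := h0 N; have gN : grid (Th / N.+1%:R) k.+1 <= Th.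
    by rewrite /grid mulrCA ler_piMr ?(ltW Th0)// ler_pdivrMr// mul1r ler_nat.
  have g0 := grid_ge0 (h0 N) k.
  move: qk; rewrite gridS => qk.
  have dq : `|ratr q - grid (Th / N.+1%:R) k| <= dm.
    by rewrite ger0_norm ?subr_ge0//; rewrite lerBlDl; apply: le_trans qk _; rewrite lerD2l.
  have in1 : ratr q \in `[0, Th].
    rewrite in_itv/=; apply/andP; split; first exact: le_trans g0 kq.
    by apply: le_trans gN; rewrite gridS.
  have in2 : grid (Th / N.+1%:R) k \in `[0, Th].
    by rewrite in_itv/= g0/=; apply: le_trans gN; rewrite gridS lerDl; exact: ltW.
  by split; [apply: hX|apply: hB] => //; exact: le_trans dq _.
have cE : P (E m) @[m --> \oo] --> 0%E.
  have := @nonincreasing_cvg_mu _ _ _ P E; rewrite Ecap measure0; apply => //.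
  - by apply: le_lt_trans (probability_le1 P (mE 0)) _; rewrite ltry.
  - move=> a b ab; apply/subsetPset => w [Dw [N /= bN bw]]; split => //; exists N => //=.
    exact: leq_trans bN.
have /fine_cvgP[_ /cvgrPdist_le/(_ dl dl0)[m _ hm]] := cE.
exists m => N mN.
have PbE : unsteady_prob P B X rho (Th / N.+1%:R) N.+1 = fine (P (bad N)).
  by rewrite /unsteady_prob /Rintegral integral_indic ?setTI ?setIT//; exact: mbad.
have := hm m (leqnn m); rewrite sub0r normrN ger0_norm; last exact: fine_ge0.
move=> Em; rewrite PbE; apply: le_trans Em; apply: fine_le; rewrite ?fin_num_measure//.
have mDC : measurable (~` D) by exact: measurableC.
have PbD : P (bad N `&` ~` D) = 0%E.
  apply/eqP; rewrite eq_le measure_ge0 andbT -D0.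
  by apply: le_measure; rewrite ?inE//; exact: measurableI.
have bU : bad N = (bad N `&` D) `|` (bad N `&` ~` D) by rewrite -setIUr setUv setIT.
rewrite {}bU; apply: le_trans (measureU2 P _ _) _; [exact: measurableI|exact: measurableI|].
rewrite -[leRHS]adde0 -PbD leeD2r//; apply: le_measure; rewrite ?inE//; first exact: measurableI.
by move=> w [bw Dw]; split => //; exists N.
Qed.

End horizon_limit.

(** * Dynkin inequalities for the hitting time *)

Section dynkin.
Context {R : realType} d {T : measurableType d} (P : probability T R).
Variables (n : nat) (F : R -> set (set T)) (B X : R -> T -> R).
Hypotheses (n0 : (0 < n)%N) (rX : radius_diffusion n P F B X).
Variables (f f' f'' : R -> R) (M lam : R).
Hypotheses (df : forall x : R, is_derive x 1 f (f' x))
  (df' : forall x : R, is_derive x 1 f' (f'' x))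
  (cf'' : continuous f'') (fM : forall x, `|f x| <= M)
  (f'0 : 0 < f' 0) (f'pi : 0 < f' pi)
  (gen : forall x, 0 < x < pi -> lam <= f'' x + drift n x * f' x).
Local Notation tau := (hitting_time X pi).

(* S is the mean time spent alive on the grid up to Th, and p the probability of
   being still alive at Th. *)
Lemma dynkin_approx (Th dl : R) : 0 < Th -> 0 < dl ->
  exists S p : R, [/\ 0 <= p <= 1, Th * p <= S,
    lam * S <= f pi - f 0 + 2 * M * p + dl, (S%:E <= \int[P]_w tau w)%E &
    forall g : T -> R, measurable_fun setT g -> (forall w, 0 <= g w <= Th) ->
      (forall w, (g w)%:E <= tau w)%E -> \int[P]_w g w <= S + dl].
Proof.
move=> Th0 dl0; have [D [mD D0 reg]] := regular_path_ae rX.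
have M0 : 0 <= M by apply: le_trans (fM 0).
(* In [dynkin_sum] the error dl is split into thirds: e + 3 e Th, h K and 2 M q, where q bounds the
   probability of an unsteady step. For the last claim h and Th q take half of dl each. *)
pose e := dl / (3 * (1 + 3 * Th)).
have e0 : 0 < e by rewrite divr_gt0// mulr_gt0//; lra.
have eE : e + 3 * e * Th = dl / 3 by rewrite /e; field; lra.
clearbody e.
have [Mb [rho [Mb0 /andP[rho0 _] gen' cap [osc' osc'' oscf]]]] := local_parameters df df' cf''
  (@continuous_drift R n) f'0 f'pi gen e0.
have [h1 h10 gauss] := gaussian_step df df' cf'' fM 0 pi e0.
have [K0 hK0] := itv_bounded (continuous_subspaceT cf'' : {within `[0, pi], continuous f''}).
pose K := `|K0|.
have f''K x : 0 <= x <= pi -> `|f'' x| <= K.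
  by move=> xp; apply: le_trans (ler_norm K0); apply: hK0; rewrite in_itv.
pose q := Num.min (dl / (6 * (M + 1))) (dl / (2 * Th)).
have q0 : 0 < q by rewrite lt_min !divr_gt0// mulr_gt0//; lra.
have q1 : 2 * M * q <= dl / 3.
  have : q <= dl / (6 * (M + 1)) by rewrite ge_min lexx.
  rewrite ler_pdivlMr; last by lra.
  by move=> ?; have := ltW q0; lra.
have q2 : Th * q <= dl / 2.
  have : q <= dl / (2 * Th) by rewrite ge_min lexx orbT.
  by rewrite ler_pdivlMr ?mulr_gt0//; lra.
clearbody q.
have [N0 hN0] := unsteady_prob_small rX mD D0 reg rho0 Th0 q0.
pose hm := Num.min (h1 / 2) (Num.min (dl / (3 * (K + 1))) (dl / 2)).
have K0' : 0 <= K by exact: normr_ge0.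
have hm0 : 0 < hm by rewrite !lt_min !divr_gt0// mulr_gt0//; lra.
pose N := (N0 + Num.truncn (Th / hm))%N.
pose h := Th / N.+1%:R.
have h0 : 0 < h by rewrite divr_gt0.
have hhm : h <= hm.
  rewrite ler_pdivrMr// mulrC -ler_pdivrMr//; apply: le_trans (ltW (truncnS_gt _)) _.
  by rewrite ler_nat ltnS leq_addl.
have hh1 : h < h1 by apply: le_lt_trans hhm _; rewrite gt_min ltr_pdivrMr// ltr_pMr// ltr1n.
have hK : h * K <= dl / 3.
  have : h <= dl / (3 * (K + 1)) by apply: le_trans hhm _; rewrite !ge_min lexx orbT.
  rewrite ler_pdivlMr; last by lra.
  by have := ltW h0; lra.
have hdl : h <= dl / 2 by apply: le_trans hhm _; rewrite !ge_min lexx !orbT.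
have gN : grid h N.+1 = Th by rewrite /grid /h mulrC divfK.
have un : unsteady_prob P B X rho h N.+1 <= q by apply: hN0; exact: leq_addr.
have gauss' x : 0 <= x <= pi -> f x + h * f'' x - h * e <=
    \int[normal_prob 0 (Num.sqrt h)]_y f (x + Num.sqrt 2 * y).
  by move=> xp; apply: gauss; [rewrite h0|rewrite in_itv].
exists (mean_lifetime P B X rho h N.+1), (survival P B X rho h N.+1).
have D1 := dynkin_sum n0 rX mD D0 reg h0 e0 Mb0 df cf'' fM f''K gen' cap osc' osc'' oscf gauss' N.+1.
have D2 := survival_le_lifetime rX rho h0 N.+1.
have pr := survival_01 rX rho h0 N.+1.
rewrite gN in D1 D2.
split => //.
- have : 2 * M * unsteady_prob P B X rho h N.+1 <= 2 * M * q by rewrite ler_wpM2l// mulr_ge0.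
  by move: D1; rewrite mulrDr; move: eE q1 hK; lra.
- exact: (mean_lifetime_le_integral rX mD D0 reg).
- move=> g mg g0 gt.
  have := Rintegral_le_lifetime rX mD D0 reg rho h0 (N:=N.+1) mg.
  rewrite gN => /(_ g0 gt) le1.
  have : Th * unsteady_prob P B X rho h N.+1 <= Th * q by rewrite ler_wpM2l// ltW.
  by move: le1 q2 hdl; lra.
Qed.

(** Bounding p by 1 first gives S <= C for every horizon. Then Th p <= S forces p -> 0 as Th grows,
    which removes the term 2 M p. *)
Lemma integral_hitting_le : 0 < lam ->
  (\int[P]_w tau w <= ((f pi - f 0) / lam)%:E)%E.
Proof.
move=> lam0; have M0 : 0 <= M by apply: le_trans (fM 0).
apply: integral_le_bounded => [w|g L mg gL gt]; first exact: hitting_time_ge0.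
apply/ler_addgt0Pr => eps eps0.
pose dl := Num.min 1 (eps / (2 * (lam^-1 + 1))).
have li0 : 0 < lam^-1 by rewrite invr_gt0.
have dl0 : 0 < dl by rewrite lt_min ltr01 divr_gt0// mulr_gt0//; lra.
have dl1 : dl <= 1 by rewrite ge_min lexx.
have dl2 : dl * (lam^-1 + 1) <= eps / 2.
  have : dl <= eps / (2 * (lam^-1 + 1)) by rewrite ge_min lexx orbT.
  by rewrite ler_pdivlMr; [lra|rewrite mulr_gt0//; lra].
clearbody dl.
pose C := (f pi - f 0 + 2 * M + 1) / lam.
pose Th := 1 + `|L| + 2 * M * `|C| / lam * (2 / eps).
have t0 : 0 <= 2 * M * `|C| / lam * (2 / eps).
  by rewrite !mulr_ge0// ?invr_ge0 ltW.
have Th1 : 1 <= Th by rewrite /Th; have := normr_ge0 L; lra.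
have ThL : L <= Th by rewrite /Th; have := ler_norm L; lra.
have ThC : 2 * M * `|C| / lam <= Th * (eps / 2).
  have -> : 2 * M * `|C| / lam = (2 * M * `|C| / lam * (2 / eps)) * (eps / 2) by field; lra.
  by rewrite ler_wpM2r ?divr_ge0 ?(ltW eps0)// /Th; have := normr_ge0 L; lra.
have Th0 : 0 < Th by lra.
clearbody Th.
have [S [p [/andP[p0 p1] TpS lS _ gS]]] := dynkin_approx Th0 dl0.
have gTh w : 0 <= g w <= Th by case/andP: (gL w) => -> /le_trans; apply.
have {gS} := gS g mg gTh gt.
have SC : S <= C.
  rewrite ler_pdivlMr// mulrC; apply: le_trans lS _.
  by have : M * p <= M * 1; [rewrite ler_wpM2l|lra].
have pC : Th * (2 * M * p / lam) <= Th * (eps / 2).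
  apply: le_trans ThC.
  have -> : Th * (2 * M * p / lam) = (2 * M / lam) * (Th * p) by ring.
  have -> : 2 * M * `|C| / lam = (2 * M / lam) * `|C| by ring.
  rewrite ler_wpM2l; [by []|by rewrite !mulr_ge0// ltW|].
  by apply: le_trans TpS _; apply: le_trans SC _; exact: ler_norm.
rewrite ler_pM2l// in pC.
have : S <= (f pi - f 0) / lam + 2 * M * p / lam + dl * lam^-1.
  by rewrite -!mulrDl ler_pdivlMr// mulrC.
by move: pC dl2; lra.
Qed.

(** Here the assumed bound t on the mean controls S, so again p <= S / Th vanishes for a large
    horizon. *)
Lemma integral_hitting_ge (t : R) : lam <= 0 ->
  (\int[P]_w tau w <= t%:E)%E -> f 0 - f pi <= - lam * t.
Proof.
move=> lam0 tt; have M0 : 0 <= M by apply: le_trans (fM 0).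
apply/ler_addgt0Pr => eps eps0.
pose Th := 1 + 2 * M * `|t| * (2 / eps).
have t0 : 0 <= 2 * M * `|t| * (2 / eps) by rewrite !mulr_ge0// invr_ge0 ltW.
have Th0 : 0 < Th by rewrite /Th; lra.
have ThC : 2 * M * `|t| <= Th * (eps / 2).
  have -> : 2 * M * `|t| = (2 * M * `|t| * (2 / eps)) * (eps / 2) by field; lra.
  by rewrite ler_wpM2r ?divr_ge0 ?(ltW eps0)// /Th lerDr.
clearbody Th.
have e20 : 0 < eps / 2 by rewrite divr_gt0.
have [S [p [/andP[p0 p1] TpS lS St _]]] := dynkin_approx Th0 e20.
have {}St : S <= t by rewrite -lee_fin; exact: le_trans tt.
have pC : Th * (2 * M * p) <= Th * (eps / 2).
  apply: le_trans ThC.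
  have -> : Th * (2 * M * p) = (2 * M) * (Th * p) by ring.
  rewrite ler_wpM2l ?mulr_ge0//.
  by apply: le_trans TpS _; apply: le_trans St _; exact: ler_norm.
rewrite ler_pM2l// in pC.
have : - lam * S <= - lam * t by rewrite ler_wpM2l// oppr_ge0.
by move: lS pC; lra.
Qed.

End dynkin.

(** * Asymptotics *)

Section mean_hitting_time.
Context {R : realType} d {T : measurableType d} (P : probability T R).
Variables (n : nat) (F : R -> set (set T)) (B X : R -> T -> R).
Hypotheses (n0 : (0 < n)%N) (rX : radius_diffusion n P F B X).
Let n0R : 0 < n%:R :> R. Proof. by rewrite ltr0n. Qed.

Lemma mean_hitting_time_ub (m lam : R) : (8 <= n)%N -> 3 <= m -> 2 * m ^+ 4 <= n%:R ->
  0 < lam -> lam <= (1 - n%:R^-1 - 3 * m^-1 ^+ 2) * (1 - m^-1 ^+ 2) - 1 / n%:R ->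
  (\int[P]_w hitting_time X pi w <= ((ln n%:R + 2 * bump m + 20) / n%:R / lam)%:E)%E.
Proof.
move=> n8 m3 mn lam0 lamle.
pose k := m ^+ 2 / n%:R; pose e : R := 16 / n%:R.
have k0 : 0 < k by rewrite divr_gt0// exprn_gt0//; lra.
have e0 : 0 < e by rewrite divr_gt0.
have [M fM] := @test_bounded R n k (bump m) e k0.
have m1 : 1 <= m by lra.
have m2n : m ^+ 2 <= n%:R.
  apply: le_trans mn; have : 1 <= m ^+ 2 by rewrite exprn_ege1.
  by have -> : m ^+ 4 = m ^+ 2 * m ^+ 2 by [ring]; nra.
have [c0 _] : 0 < cos (pi / 4 : R) /\ 0 <= sin (pi / 4 : R) <= 1.
  by apply: quarter_trig; rewrite pi_ge0 lexx.
apply: le_trans (integral_hitting_le n0 rX (@is_derive_test R n k (bump m) e n0 k0)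
  (@is_derive_test' R n k (bump m) e n0 k0) (@continuous_test'' R n k (bump m) e k0) fM _ _ _ lam0) _.
- by rewrite test'0; lra.
- by rewrite test'pi mulr_gt0// divr_gt0.
- by move=> x xp; apply: le_trans lamle _; exact: (super_generator n8 m3 mn xp).
- by rewrite lee_fin ler_pM2r ?invr_gt0//; exact: (super_test_growth n0 m1 m2n).
Qed.

Lemma mean_hitting_time_lb (m t : R) : 1 <= m ->
  (\int[P]_w hitting_time X pi w <= t%:E)%E ->
  (ln n%:R - 2 * ln m - 18) / n%:R <= (1 + 2 / n%:R + 16 / m) * t.
Proof.
move=> m1 Et.
pose k := m ^+ 2 / n%:R; pose e : R := - 16 / n%:R.
have k0 : 0 < k by rewrite divr_gt0// exprn_gt0//; lra.
have e0 : e < 0 by rewrite /e mulNr oppr_lt0 divr_gt0.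
have [M fM] := @test_bounded R n k (-1) e k0.
have [c0 _] : 0 < cos (pi / 4 : R) /\ 0 <= sin (pi / 4 : R) <= 1.
  by apply: quarter_trig; rewrite pi_ge0 lexx.
pose f x := - test n k (-1) e x; pose f' x := - test' n k (-1) e x.
pose f'' x := - test'' n k (-1) e x.
have df (x : R) : is_derive x 1 f (f' x) by apply: is_derive1N; exact: is_derive_test.
have df' (x : R) : is_derive x 1 f' (f'' x) by apply: is_derive1N; exact: is_derive_test'.
have cf'' : continuous f'' by move=> x; apply: continuousN; exact: continuous_test''.
have fM' x : `|f x| <= M by rewrite normrN.
have f'0 : 0 < f' 0 by rewrite /f' test'0; lra.
have f'pi : 0 < f' pi.
  by rewrite /f' test'pi -mulNr mulr_gt0 ?divr_gt0// oppr_gt0.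
have gen x : 0 < x < pi -> - (1 + 2 / n%:R + 16 / m) <= f'' x + drift n x * f' x.
  by move=> xp; rewrite /f'' /f' mulrN -opprD lerN2; exact: (sub_generator n0 m1 xp).
have lam0 : - (1 + 2 / n%:R + 16 / m) <= 0.
  have : 0 <= 2 / n%:R :> R by rewrite divr_ge0.
  by have : 0 <= 16 / m by [rewrite divr_ge0//; lra]; lra.
have := integral_hitting_ge n0 rX df df' cf'' fM' f'0 f'pi gen lam0 Et.
rewrite opprK /f opprK addrC; apply: le_trans.
exact: (sub_test_growth n0 m1).
Qed.

End mean_hitting_time.

(** The threshold N is found before the probability space, which may change with n. *)
Lemma mean_hitting_time_ratio (R : realType) (eps : R) : 0 < eps <= 1 ->
  exists N, forall n, (N <= n)%N -> 0 < ln n%:R / n%:R :> R /\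
  forall d (T : measurableType d) (P : probability T R)
    (F : R -> set (set T)) (B X : R -> T -> R), radius_diffusion n P F B X ->
  exists2 t, (\int[P]_w hitting_time X pi w = t%:E)%E &
    `|1 - t / (ln n%:R / n%:R)| <= eps.
Proof.
(* With this m, 16 / m = eps / 4 and m^(-2) <= eps / 64. The three parts of [A] then ensure 2 m^4 <=
   n, 1 / n <= eps / 16, and that ln n dominates the constants [C1] and [C2], which depend on m
   only. *)
move=> /andP[eps0 eps1]; pose m := 64 / eps.
have m64 : 64 <= m by rewrite ler_pdivlMr//; lra.
pose C1 := 2 * bump m + 20; pose C2 := 2 * ln m + 18.
pose L := 1 + 2 * `|C1| / eps + 4 * `|C2| / eps.
pose A := 2 * m ^+ 4 + 16 / eps + expR L.
exists (8 + Num.truncn A)%N.+1 => n Nn.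
have n8 : (8 <= n)%N by apply: leq_trans Nn; rewrite -addnS leq_addr.
have n0 : (0 < n)%N by exact: leq_trans n8.
have n0R : 0 < n%:R :> R by rewrite ltr0n.
have An : A <= n%:R.
  apply: le_trans (ltW (truncnS_gt A)) _; rewrite ler_nat.
  by apply: leq_trans Nn; rewrite ltnS leq_addl.
have p1 : 0 <= 2 * m ^+ 4 by rewrite mulr_ge0// exprn_ge0//; lra.
have p2 : 0 <= 16 / eps by rewrite divr_ge0// ltW.
have p3 := expR_gt0 L.
have mn : 2 * m ^+ 4 <= n%:R by rewrite /A in An; lra.
have en : n%:R^-1 <= eps / 16.
  have : 16 / eps <= n%:R by rewrite /A in An; lra.
  by rewrite ler_pdivrMr// => h; rewrite ler_pdivlMr// mulrC ler_pdivrMr// mulrC.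
have Ln : L <= ln n%:R.
  rewrite -[leLHS](expRK L) ler_ln ?posrE ?expR_gt0//; rewrite /A in An; lra.
set l := ln n%:R in Ln *.
have c1 : C1 <= eps / 2 * l.
  apply: le_trans (ler_norm _) _.
  have : 2 * `|C1| / eps <= l.
    apply: le_trans Ln; rewrite /L; have : 0 <= 4 * `|C2| / eps by rewrite divr_ge0 ?mulr_ge0// ltW.
    by lra.
  by rewrite ler_pdivrMr//; lra.
have c2 : C2 <= eps / 4 * l.
  apply: le_trans (ler_norm _) _.
  have : 4 * `|C2| / eps <= l.
    apply: le_trans Ln; rewrite /L; have : 0 <= 2 * `|C1| / eps by rewrite divr_ge0 ?mulr_ge0// ltW.
    by lra.
  by rewrite ler_pdivrMr//; lra.
have l0 : 0 < l.
  apply: lt_le_trans Ln; rewrite /L.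
  have : 0 <= 2 * `|C1| / eps by rewrite divr_ge0 ?mulr_ge0// ltW.
  have : 0 <= 4 * `|C2| / eps by rewrite divr_ge0 ?mulr_ge0// ltW.
  by lra.
have ni0 : 0 < n%:R^-1 :> R by rewrite invr_gt0.
have mi : m^-1 = eps / 64 by rewrite /m invf_div.
split=> [|d T P F B X rX]; first by rewrite divr_gt0.
(* The lower bound of the generator is at least 1 - 2 / n - 4 m^(-2) >= 1 - eps / 8 - eps / 16,
   which exceeds 1 - eps / 4. *)
have lam0 : 0 < 1 - eps / 4 by lra.
have ub : (\int[P]_w hitting_time X pi w <= ((l + 2 * bump m + 20) / n%:R / (1 - eps / 4))%:E)%E.
  apply: (mean_hitting_time_ub n0 rX n8 _ mn lam0); first by lra.
  rewrite mi div1r; have q2 : (eps / 64) ^+ 2 <= eps / 64 by rewrite expr2 -[leRHS]mulr1 ler_wpM2l; lra.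
  have q0 : 0 <= (eps / 64) ^+ 2 by rewrite sqr_ge0.
  set q := (eps / 64) ^+ 2 in q2 q0 *; set i := n%:R^-1 in en ni0 *.
  have : 0 <= (i + 3 * q) * q by rewrite mulr_ge0//; lra.
  by move: q2 q0 en ni0; clearbody q i; clear; lra.
have E0 : (0 <= \int[P]_w hitting_time X pi w)%E.
  by apply: integral_ge0 => w _; apply/ereal_infP => _ [s [s0 _] <-]; rewrite lee_fin.
have Efin : (\int[P]_w hitting_time X pi w)%E \is a fin_num.
  by rewrite ge0_fin_numE//; apply: le_lt_trans ub _; rewrite ltry.
exists (fine (\int[P]_w hitting_time X pi w)); first by rewrite fineK.
set t := fine _.
have ubt : t <= (l + 2 * bump m + 20) / n%:R / (1 - eps / 4).
  by rewrite -lee_fin fineK.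
have t0 : 0 <= t by exact: fine_ge0.
have lbt : (l - 2 * ln m - 18) / n%:R <= (1 + 2 / n%:R + 16 / m) * t.
  by apply: (mean_hitting_time_lb n0 rX); [lra|rewrite fineK].
have -> : t / (l / n%:R) = (t * n%:R) / l by field; rewrite !gt_eqF.
set s := t * n%:R.
have s0 : 0 <= s by rewrite mulr_ge0.
have ubs : s * (1 - eps / 4) <= l + C1.
  by rewrite -ler_pdivlMr// /s -ler_pdivlMr// mulrAC /C1 addrA.
have lbs : l - C2 <= (1 + eps / 2) * s.
  move: lbt; rewrite ler_pdivrMr// => lbt; rewrite /C2 opprD addrA; apply: le_trans lbt _.
  rewrite -mulrA -/s ler_wpM2r//; have -> : 16 / m = eps / 4 by rewrite mi; lra.
  by lra.
rewrite distrC ler_distl; clearbody s l C1 C2.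
apply/andP; split.
  rewrite ler_pdivlMr//; have h : 0 < 1 + eps / 2 by lra.
  rewrite -(ler_pM2l h); apply: le_trans lbs.
  have : (1 + eps / 2) * (1 - eps) * l <= (1 - eps / 4) * l.
    by rewrite ler_wpM2r ?(ltW l0)//; nra.
  by move: c2; clear -eps0; lra.
rewrite ler_pdivrMr// -(ler_pM2r lam0); apply: le_trans ubs _.
have : (1 + eps / 2) * l <= (1 + eps) * (1 - eps / 4) * l.
  by rewrite ler_wpM2r ?(ltW l0)//; nra.
by move: c1; clear -eps0; lra.
Qed.

Unset Implicit Arguments.

Theorem theorem2 (R : realType) (d : nat -> measure_display)
    (T : forall n, measurableType (d n)) (P : forall n, probability (T n) R)
    (F : forall n, R -> set (set (T n))) (B X : forall n, R -> T n -> R)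
    (hX : forall n, (1 <= n)%N -> radius_diffusion n (P n) (F n) (B n) (X n)) :
  ((\int[P n]_w hitting_time (X n) pi w) / (ln n%:R / n%:R)%:E)%E
    @[n --> \oo] --> 1%:E.
Proof.
have ratio n t : (\int[P n]_w hitting_time (X n) pi w)%E = t%:E -> 0 < ln n%:R / n%:R :> R ->
    ((\int[P n]_w hitting_time (X n) pi w) / (ln n%:R / n%:R)%:E)%E =
    (t / (ln n%:R / n%:R))%:E.
  by move=> -> l0; rewrite inver gt_eqF.
(* Convergence in the extended reals first requires the ratio to be eventually finite; the tolerance
   1 is enough for that. *)
apply/fine_cvgP; split.
  have [|N hN] := @mean_hitting_time_ratio R 1; first by rewrite ltr01 lexx.
  (* The threshold is N + 1 and not N, so that n >= 1, as [hX] demands. *)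
  exists N.+1 => // n /= Nn; have [l0 /(_ _ _ _ _ _ _ (hX n (leq_ltn_trans (leq0n N) Nn)))] := hN n (ltnW Nn).
  by case=> t Et _; rewrite (ratio n t).
apply/cvgrPdist_le => eps eps0.
have [|N hN] := @mean_hitting_time_ratio R (Num.min eps 1).
  by rewrite lt_min eps0 ltr01 ge_min lexx orbT.
exists N.+1 => // n /= Nn; have [l0 /(_ _ _ _ _ _ _ (hX n (leq_ltn_trans (leq0n N) Nn)))] := hN n (ltnW Nn).
by case=> t Et; rewrite (ratio n t)//= le_min => /andP[].
Qed.
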